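(* Let $\mathbb K\in\{\mathbb R,\mathbb C\}$ and let $\theta\subset\Delta=\{\alpha_1,\dots,\alpha_{d-1}\}$ be symmetric. Suppose $\Gamma\subset\mathsf{PSL}(d,\mathbb K)$ is a non-elementary $\mathsf P_\theta$-transverse subgroup, $\phi_1,\phi_2\in\mathfrak a_\theta^*$ and $\delta^{\phi_1}(\Gamma)=\delta^{\phi_2}(\Gamma)=1$. If $\phi=\lambda\phi_1+(1-\lambda)\phi_2$ where $\lambda\in(0,1)$, then $$\delta^\phi(\Gamma)\le 1.$$ Moreover, if $\delta^\phi(\Gamma)=1$ and $Q_\Gamma^\phi$ diverges at its critical exponent (i.e. $Q^\phi_\Gamma(\delta^\phi(\Gamma))=+\infty$), then $\ell^{\phi_1}(\gamma)=\ell^{\phi_2}(\gamma)$ for all $\gamma\in\Gamma$.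
   Context: $\mathfrak a=\{\mathrm{diag}(a_1,\dots,a_d): a_i\in\mathbb R,\ \sum a_i=0\}$. The Cartan projection of $g\in\mathsf{PSL}(d,\mathbb K)$ is $\kappa(g)=\mathrm{diag}(\log\sigma_1(g),\dots,\log\sigma_d(g))$, where $\sigma_1(g)\ge\dots\ge\sigma_d(g)$ are the singular values of a lift of $g$ to $\mathsf{SL}(d,\mathbb K)$. The simple roots are $\alpha_j(\mathrm{diag}(a_1,\dots,a_d))=a_j-a_{j+1}$, $\Delta=\{\alpha_1,\dots,\alpha_{d-1}\}$, with fundamental weights $\omega_{\alpha_j}(\mathrm{diag}(a_1,\dots,a_d))=a_1+\dots+a_j$. A subset $\theta\subset\Delta$ is symmetric if $\alpha_k\in\theta\iff\alpha_{d-k}\in\theta$. Set $\mathfrak a_\theta=\{\mathrm{diag}(a_1,\dots,a_d)\in\mathfrak a: a_j=a_{j+1}\text{ for all }\alpha_j\notin\theta\}$; the restrictions $\omega_\alpha|_{\mathfrak a_\theta}$, $\alpha\in\theta$, form a basis of $\mathfrak a_\theta^*$. The partial Cartan projection $\kappa_\theta:\mathsf{PSL}(d,\mathbb K)\to\mathfrak a_\theta$ is defined by $\omega_\alpha(\kappa_\theta(g))=\omega_\alpha(\kappa(g))$ for all $\alpha\in\theta$. For $\phi\in\mathfrak a_\theta^*$, the $\phi$-length of $g$ is $\ell^\phi(g)=\lim_{n\to\infty}\frac1n\phi(\kappa_\theta(g^n))$ (the limit exists). $\mathcal F_\theta$ is the manifold of partial flags $F=(F^j)_{\alpha_j\in\theta}$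 in $\mathbb K^d$ with $\dim F^j=j$ (nested). Flags $F,G\in\mathcal F_\theta$ are transverse if $F^j\oplus G^{d-j}=\mathbb K^d$ for all $\alpha_j\in\theta$. A subgroup $\Gamma$ is $\mathsf P_\theta$-divergent if $\min_{\alpha\in\theta}\alpha(\kappa(\gamma_n))\to+\infty$ for every sequence $\{\gamma_n\}$ of distinct elements of $\Gamma$. If $\alpha(\kappa(g))>0$ for all $\alpha\in\theta$, then $U_\theta(g)\in\mathcal F_\theta$ is the flag whose $j$-dimensional part is $k\langle e_1,\dots,e_j\rangle$, where $g=k\,e^{\kappa(g)}\,\ell$ is a singular value decomposition. For $\Gamma$ $\mathsf P_\theta$-divergent, the limit set $\Lambda_\theta(\Gamma)\subset\mathcal F_\theta$ is the set of limits of convergent sequences $U_\theta(\gamma_n)$ with $\gamma_n\in\Gamma$ distinct. $\Gamma$ is $\mathsf P_\theta$-transverse if it is $\mathsf P_\theta$-divergent and any two distinct flags in $\Lambda_\theta(\Gamma)$ are transverse; it is non-elementary if $\Lambda_\theta(\Gamma)$ is infinite. For a discrete subgroup $\Gamma$ and $\phi\in\mathfrak a_\theta^*$, $Q_\Gamma^\phi(s)=\sum_{\gamma\in\Gamma}e^{-s\phi(\kappa_\theta(\gamma))}$ and $\delta^\phi(\Gamma)=\inf\{s>0: Q_\Gamma^\phi(s)<+\infty\}\in[0,+\infty]$ is its critical exponent. *)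

(* Defs.v *)
From HB Require Import structures.
From mathcomp Require Import all_boot all_order all_algebra.
From mathcomp Require Import all_classical all_reals all_analysis.
From mathcomp Require Import complex.

Set Implicit Arguments.
Unset Strict Implicit.
Unset Printing Implicit Defensive.

Import Order.TTheory GRing.Theory Num.Theory.
Import numFieldNormedType.Exports.

Local Open Scope classical_set_scope.
Local Open Scope ring_scope.
Local Open Scope quotient_scope.

(* Dimension and index conventions: d = n.+1, and the simple root usually      *)
(* written alpha_j (1 <= j <= d-1) has index i = j-1 : 'I_n.  The matching     *)
(* subspaces of K^d have dimension j = i.+1, and alpha_(d-j) has index         *)
(* rev_ord i.                                                                  *)

Section SpecialLinear.
Variables (K : fieldType) (n : nat).

Definition SL : Type := {A : 'M[K]_n.+1 | \det A == 1}.

HB.instance Definition _ := Choice.on SL.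

Implicit Types A B C : SL.

Fact SL_mul_subproof A B : \det (val A *m val B) == 1.
Proof. by rewrite det_mulmx (eqP (valP A)) (eqP (valP B)) mulr1. Qed.
Fact SL_one_subproof : \det (1%:M : 'M[K]_n.+1) == 1.
Proof. by rewrite det1. Qed.
Fact SL_inv_subproof A : \det (invmx (val A)) == 1.
Proof. by rewrite det_inv (eqP (valP A)) invr1. Qed.

Definition SL_mul A B : SL :=
  exist (fun X : 'M[K]_n.+1 => \det X == 1) _ (SL_mul_subproof A B).
Definition SL_one : SL :=
  exist (fun X : 'M[K]_n.+1 => \det X == 1) _ SL_one_subproof.
Definition SL_inv A : SL :=
  exist (fun X : 'M[K]_n.+1 => \det X == 1) _ (SL_inv_subproof A).

Lemma SL_unit A : val A \in unitmx.
Proof. by rewrite unitmxE (eqP (valP A)) unitr1. Qed.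

Fact SL_mulA : associative SL_mul.
Proof. by move=> A B C; apply: val_inj; rewrite /= mulmxA. Qed.
Fact SL_mul1 : left_id SL_one SL_mul.
Proof. by move=> A; apply: val_inj; rewrite /= mul1mx. Qed.
Fact SL_mulr1 : right_id SL_one SL_mul.
Proof. by move=> A; apply: val_inj; rewrite /= mulmx1. Qed.
Fact SL_mulV : left_inverse SL_one SL_inv SL_mul.
Proof. by move=> A; apply: val_inj; rewrite /= mulVmx ?SL_unit. Qed.
Fact SL_mulrV : right_inverse SL_one SL_inv SL_mul.
Proof. by move=> A; apply: val_inj; rewrite /= mulmxV ?SL_unit. Qed.

HB.instance Definition _ :=
  isGroup.Build SL SL_mulA SL_mul1 SL_mulr1 SL_mulV SL_mulrV.

(* Two elements of SL are identified in PSL when they differ by a (central)    *)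
(* scalar matrix c%:M; automatically c ^+ d = 1.                               *)
Definition proportional A B : bool :=
  `[< exists c : K, val A = c *: val B >].

Fact proportional_equiv : equiv_class_of proportional.
Proof.
split.
- by move=> A; apply/asboolP; exists 1; rewrite scale1r.
- suff S A B : proportional A B -> proportional B A.
    by move=> A B; apply/idP/idP; exact: S.
  move/asboolP=> [c eAB]; apply/asboolP; exists c^-1.
  rewrite eAB scalerA mulVf ?scale1r //; apply/eqP => c0.
  by move: (valP A); rewrite eAB c0 scale0r det0 eq_sym oner_eq0.
- move=> B A C /asboolP[a eAB] /asboolP[b eBC].
  by apply/asboolP; exists (a * b); rewrite eAB eBC scalerA.
Qed.

Canonical proportional_equiv_rel := EquivRelPack proportional_equiv.

Definition PSL : Type := {eq_quot proportional}.

HB.instance Definition _ : EqQuotient _ proportional PSL :=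
  EqQuotient.on PSL.
HB.instance Definition _ := Choice.on PSL.

Implicit Types x y z : PSL.

Definition PSL_mul x y : PSL := \pi_PSL (repr x * repr y)%g.
Definition PSL_one : PSL := \pi_PSL 1%g.
Definition PSL_inv x : PSL := \pi_PSL ((repr x)^-1)%g.

Lemma PSL_piP A B : \pi_PSL A = \pi_PSL B <-> exists c, val A = c *: val B.
Proof.
split=> [/eqmodP /asboolP //|AB]; apply/eqmodP; exact/asboolP.
Qed.

Lemma PSL_piM A B : PSL_mul (\pi_PSL A) (\pi_PSL B) = \pi_PSL (A * B)%g.
Proof.
rewrite /PSL_mul; apply/PSL_piP.
have /PSL_piP[a ea] := reprK (\pi_PSL A).
have /PSL_piP[b eb] := reprK (\pi_PSL B).
exists (a * b).
by rewrite /= ea eb -scalemxAl -scalemxAr scalerA.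
Qed.

Lemma PSL_piV A : PSL_inv (\pi_PSL A) = \pi_PSL (A^-1)%g.
Proof.
have AV : PSL_mul (\pi_PSL A) (PSL_inv (\pi_PSL A)) = PSL_one.
  by rewrite /PSL_inv -{1}[\pi_PSL A]reprK PSL_piM mulgV.
rewrite -[LHS]reprK -[repr _]mul1g -(mulVg A) -mulgA -PSL_piM -PSL_piM reprK.
by rewrite AV PSL_piM mulg1.
Qed.

Fact PSL_mulA : associative PSL_mul.
Proof.
elim/quotW=> A; elim/quotW=> B; elim/quotW=> C.
by rewrite (PSL_piM B) (PSL_piM A B) !PSL_piM mulgA.
Qed.
Fact PSL_mul1 : left_id PSL_one PSL_mul.
Proof. by move=> x; rewrite -[x]reprK PSL_piM mul1g. Qed.
Fact PSL_mulr1 : right_id PSL_one PSL_mul.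
Proof. by move=> x; rewrite -[x]reprK PSL_piM mulg1. Qed.
Fact PSL_mulV : left_inverse PSL_one PSL_inv PSL_mul.
Proof. by move=> x; rewrite -[x]reprK PSL_piV PSL_piM mulVg. Qed.
Fact PSL_mulrV : right_inverse PSL_one PSL_inv PSL_mul.
Proof. by move=> x; rewrite -[x]reprK PSL_piV PSL_piM mulgV. Qed.

HB.instance Definition _ :=
  isGroup.Build PSL PSL_mulA PSL_mul1 PSL_mulr1 PSL_mulV PSL_mulrV.

End SpecialLinear.

Section Roots.
Variables (R : realType) (n : nat).
Implicit Types (v : 'rV[R]_n.+1) (i : 'I_n) (theta : {set 'I_n}).

Definition coord_sum v : R^o := \sum_j v 0 j.

Definition simple_root i v : R^o :=
  v 0 (widen_ord (leqnSn n) i) - v 0 (lift ord0 i).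

Definition fund_weight i v : R^o := \sum_(j < n.+1 | (j <= i)%N) v 0 j.

Fact coord_sum_linear : linear coord_sum.
Proof.
move=> a u v; rewrite /coord_sum scaler_sumr -big_split /=.
by apply: eq_bigr => j _; rewrite !mxE.
Qed.
HB.instance Definition _ :=
  GRing.isLinear.Build R 'rV[R]_n.+1 R^o _ coord_sum coord_sum_linear.

Fact simple_root_linear i : linear (simple_root i).
Proof.
move=> a u v; rewrite /simple_root !mxE scalerBr opprD addrACA; congr (_ + _).
Qed.
HB.instance Definition _ i :=
  GRing.isLinear.Build R 'rV[R]_n.+1 R^o _ (simple_root i)
    (simple_root_linear i).

Fact fund_weight_linear i : linear (fund_weight i).
Proof.
move=> a u v; rewrite /fund_weight scaler_sumr -big_split /=.
by apply: eq_bigr => j _; rewrite !mxE.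
Qed.
HB.instance Definition _ i :=
  GRing.isLinear.Build R 'rV[R]_n.+1 R^o _ (fund_weight i)
    (fund_weight_linear i).

Definition cartan : {vspace 'rV[R]_n.+1} := lker (linfun coord_sum).

Definition cartan_theta theta : {vspace 'rV[R]_n.+1} :=
  (cartan :&: \bigcap_(i | i \notin theta) lker (linfun (simple_root i)))%VS.

Lemma mem_cartan_theta theta v :
  v \in cartan_theta theta <->
  \sum_j v 0 j = 0 /\
  forall i, i \notin theta ->
    v 0 (widen_ord (leqnSn n) i) = v 0 (lift ord0 i).
Proof.
rewrite /cartan_theta memv_cap /cartan memv_ker lfunE /=.
rewrite memvE; split.
  case/andP=> /eqP v0 /subv_bigcapP vth; split=> // i /vth.
  by rewrite -memvE memv_ker lfunE /= subr_eq0 => /eqP.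
case=> v0 vth; apply/andP; split; first exact/eqP.
apply/subv_bigcapP => i ith.
by rewrite -memvE memv_ker lfunE /= subr_eq0 vth.
Qed.

Definition symmetric_roots theta : Prop :=
  forall i, (i \in theta) = (rev_ord i \in theta).

End Roots.

Notation cartan_dual R theta := 'Hom(subvs_of (cartan_theta R theta), R^o).

Inductive base_field := RealField | ComplexField.

Section BaseField.
Variable R : realType.

Definition scalars (b : base_field) : numFieldType :=
  match b with RealField => R | ComplexField => R[i] end.

Definition of_real (b : base_field) : R -> scalars b :=
  match b with RealField => idfun | ComplexField => real_complex R end.

Definition conj_scalar (b : base_field) : scalars b -> scalars b :=
  match b with RealField => idfun | ComplexField => @conjc R end.

End BaseField.

Section Cartan.
Variables (R : realType) (b : base_field) (n : nat).
Local Notation K := (scalars R b).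
Implicit Types (A k l : 'M[K]_n.+1) (s : 'rV[R]_n.+1).
Implicit Types (g : PSL K n) (theta : {set 'I_n}).

(* Orthogonal matrices when K is real, unitary ones when K is complex. *)
Definition unitary k : Prop :=
  k *m map_mx (@conj_scalar R b) k^T = 1%:M.

Definition is_svd A k s l : Prop :=
  [/\ unitary k, unitary l,
      forall j, 0 <= s 0 j,
      forall i j : 'I_n.+1, (i <= j)%N -> s 0 j <= s 0 i
    & A = k *m diag_mx (map_mx (@of_real R b) s) *m l].

(* Every square matrix has a singular value decomposition, and the vector s is *)
(* the same in all of them.                                                    *)
Definition singular_values A : 'rV[R]_n.+1 :=
  xget 0 [set s | exists k l, is_svd A k s l].

(* repr g is a lift of g to SL; another lift differs by a scalar of modulus 1. *)
Definition kappa g : 'rV[R]_n.+1 :=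
  map_mx (@ln R) (singular_values (val (repr g))).

(* The constraints below have exactly one solution v in a_theta, because the   *)
(* restricted fundamental weights are a basis of the dual of a_theta.          *)
Definition kappa_theta theta g : subvs_of (cartan_theta R theta) :=
  xget 0 [set v | forall i, i \in theta ->
    fund_weight i (vsval v) = fund_weight i (kappa g)].

Definition phi_length theta (phi : cartan_dual R theta) g : R :=
  limn (fun m : nat => m%:R^-1 * phi (kappa_theta theta (g ^+ m)%g) : R).

Definition poincare theta (Gamma : set (PSL K n)) (phi : cartan_dual R theta)
    (s : R) : \bar R :=
  \esum_(g in Gamma) (expR (- (s * phi (kappa_theta theta g))))%:E.

Definition critical_exponent theta (Gamma : set (PSL K n))
    (phi : cartan_dual R theta) : \bar R :=
  ereal_inf [set s%:E | s in
    [set s : R | 0 < s /\ (poincare Gamma phi s < +oo)%E]].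

End Cartan.

Section Flags.
Variables (K : numFieldType) (n : nat) (theta : {set 'I_n}).

Local Notation flag_index := {i : 'I_n | i \in theta}.

(* The component of index i has dimension i.+1. *)
Definition is_flag (F : {ffun flag_index -> {vspace 'cV[K]_n.+1}}) : bool :=
  [forall i : flag_index, \dim (F i) == (val i).+1] &&
  [forall i : flag_index, forall j : flag_index, (val i <= val j)%N ==> (F i <= F j)%VS].

Definition flag : Type :=
  {F : {ffun flag_index -> {vspace 'cV[K]_n.+1}} | is_flag F}.
HB.instance Definition _ := Choice.on flag.

Implicit Types (F G : flag) (A B : 'M[K]_n.+1).

(* F i is spanned by the first i.+1 columns of A. *)
Definition adapted A F : Prop :=
  forall i : flag_index, val F i =
    <<[seq col j A | j : 'I_n.+1 <- enum 'I_n.+1 & (j <= val i)%N]>>%VS.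

(* The manifold topology of the flag variety GL(d, K) / P_theta, that is, the  *)
(* quotient topology for the map sending A in GL(d, K) to the flag adapted to  *)
(* A: a set of flags is open when its preimage is open in GL(d, K).            *)
Definition flag_open (U : set flag) : Prop :=
  forall A F, A \in unitmx -> adapted A F -> U F ->
    \forall B \near A, B \in unitmx -> forall G, adapted B G -> U G.

Fact flag_openT : flag_open setT.
Proof. by move=> A F _ _ _; apply: (@filterE _ (nbhs A)). Qed.
Fact flag_openI : setI_closed flag_open.
Proof.
move=> U V oU oV A F uA AF [UF VF].
apply: filterS2 (oU A F uA AF UF) (oV A F uA AF VF) => B UB VB uB G BG.
by split; [exact: UB | exact: VB].
Qed.
Fact flag_open_bigU (I : Type) (f : I -> set flag) :
  (forall i, flag_open (f i)) -> flag_open (\bigcup_i f i).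
Proof.
move=> of_ A F uA AF [i _ fiF].
by apply: filterS (of_ i A F uA AF fiF) => B fB uB G BG; exists i => //; exact: fB.
Qed.

HB.instance Definition _ :=
  isOpenTopological.Build flag flag_openT flag_openI flag_open_bigU.

(* The component of G of index j = rev_ord i has dimension d - i.+1. *)
Definition transverse F G : Prop :=
  forall i j : flag_index, val j = rev_ord (val i) ->
    directv (val F i + val G j) /\ (val F i + val G j)%VS = fullv.

End Flags.

Section TransverseGroups.
Variables (R : realType) (b : base_field) (n : nat) (theta : {set 'I_n}).
Local Notation K := (scalars R b).
Implicit Types (g : PSL K n) (Gamma : set (PSL K n)).

Definition divergent Gamma : Prop :=
  forall gamma : nat -> PSL K n,
    injective gamma -> (forall m, Gamma (gamma m)) ->
    \big[mine/+oo%E]_(i in theta) (simple_root i (kappa (gamma m)))%:E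
      @[m --> \oo] --> +oo%E.

(* U_theta is defined (and the flag F is then unique) only at those g with     *)
(* alpha (kappa g) > 0 for all alpha in theta.                                 *)
Definition is_Utheta g (F : flag K theta) : Prop :=
  (forall i, i \in theta -> 0 < simple_root i (kappa g)) /\
  exists k l, is_svd (val (repr g)) k (map_mx expR (kappa g)) l /\ adapted k F.

Definition limit_set Gamma : set (flag K theta) :=
  [set F | exists (gamma : nat -> PSL K n) (U : nat -> flag K theta),
    [/\ injective gamma, forall m, Gamma (gamma m),
        forall m, is_Utheta (gamma m) (U m) & U m @[m --> \oo] --> F]].

Definition transverse_group Gamma : Prop :=
  [/\ group_closed [in Gamma], divergent Gamma
    & forall F G, limit_set Gamma F -> limit_set Gamma G -> F != G ->
        transverse F G].

Definition non_elementary Gamma : Prop := infinite_set (limit_set Gamma).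

End TransverseGroups.

(* Main.v *)
(* Write a and b for phi1 and phi2 composed with kappa_theta, seen as functions *)
(* on Gamma, c = lambda a + (1 - lambda) b, and D = a - b.  The first claim is   *)
(* the convexity bound e^(-s c) <= e^(-s a) + e^(-s b).  For the second, if D is *)
(* bounded on Gamma then D(gamma^m) / m tends to 0 and the lengths agree; so it  *)
(* is enough to show that the sum of e^(-c) is finite as soon as D is unbounded. *)
(*                                                                               *)
(* Let d(g, h) compare the flags U_theta(g) and U_theta(h).  Divergence and      *)
(* transversality imply that all but finitely many g send everything away from   *)
(* g^-1 close to g, and that a and b are additive, up to a constant, on the      *)
(* products p q for which d(p^-1, q) is bounded below; call p a prefix of p q in *)
(* this case.  Two prefixes of an element are comparable, up to finitely many    *)
(* exceptions, and since the limit set has three points, any p and q satisfy     *)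
(* d(p^-1, h q) >= eta for some h in a fixed finite set.                         *)
(*                                                                               *)
(* Cut every g at its first prefix p with |D(p)| >= N, if there is one.  The map *)
(* (p, q) |-> p h q is finite-to-one on first prefixes p, so that the sums of    *)
(* e^(-s a) and e^(-s b) over first prefixes are bounded independently of N and  *)
(* of s in (1, 2].  As |D(p)| >= N, the sum of e^(-s c) over first prefixes is   *)
(* then O(e^(- min(lambda, 1 - lambda) N)), and for N large the g with such a    *)
(* prefix contribute less than half of the total sum of e^(-s c).  The other g   *)
(* contribute a bounded amount: inserting a word w with |D(w)| huge is again     *)
(* finite-to-one.  Hence the total stays bounded as s decreases to 1.            *)

From HB Require Import structures.
Require Import Defs.
From mathcomp Require Import all_boot all_order perm all_algebra.
From mathcomp Require Import all_classical all_reals all_analysis.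
From mathcomp Require Import ring lra zify complex.
Import Order.TTheory GRing.Theory Num.Theory.
Import numFieldNormedType.Exports.
Local Open Scope classical_set_scope.
Local Open Scope ring_scope.

Set Implicit Arguments.
Unset Strict Implicit.
Unset Printing Implicit Defensive.

(** * Quasi-additive functions on convergence groups *)

(** Since c = b + lambda D = a - (1 - lambda) D, the weight e^(-c) is exponentially smaller than
    e^(-a) + e^(-b) wherever |D| is large. If D is unbounded, this gain, taken once along each long
    element, is enough to make the sum of e^(-c) converge at the exponent 1.

    The argument has two halves. The first concerns an abstract group with a pseudometric d, in
    which g stands for its attracting point and g^-1 for its repelling point. Its inputs are the
    convergence property, quasi-additivity and left quasi-invariance of a and b, and bounded sums
    for every s > 1. [uniform_escape] provides the finite set of words to insert between two
    elements, [prefix_at_linear] and [prefix_at_trans] order the prefixes of an element, and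
    [bounded_sums_of_unbounded_difference] is the renewal inequality.

    The second half verifies these inputs for a transverse group. Minors of size i.+1 replace
    exterior powers: [ext_norm] is comparable with e^(omega_i (kappa g)) and submultiplicative, and
    [plucker_contract] says that the attracting flag of g h is close to that of g when g has a large
    gap and the norm of g h shows no cancellation. The absence of cancellation, [transverse_gap],
    comes from compactness of the unitary group and transversality of distinct limit flags. It gives
    [flag_dist_convergence] and [weight_quasi_additive]. *)

Lemma pigeonhole_seq (T : eqType) (f : nat -> T) (s : seq T) :
  (forall m, f m \in s) -> exists i j, (i < j)%N /\ f i = f j.
Proof.
move=> fs; pose t := map f (iota 0 (size s).+1).
have /negP : ~ uniq t.
  move=> ut; suff : (size t <= size s)%N by rewrite size_map size_iota ltnn.
  by apply: uniq_leq_size ut _ => _ /mapP[i _ ->].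
case/(uniqPn (f 0%N)) => i [j [ij]]; rewrite size_map size_iota => js.
have is_ := ltn_trans ij js.
rewrite !(nth_map 0%N) ?size_iota // !nth_iota // !add0n.
by move=> fij; exists i, j.
Qed.

Section ConvergenceGroup.
Variables (R : realType) (G : groupType) (d : G -> G -> R).
Implicit Types (g h p q x y : G) (K F : seq G) (f : G -> R).

(* An element g of the group stands for its attracting point, g^-1 for its repelling *)
(* point: this is the convergence property without a boundary at infinity.           *)
Definition convergence_metric := forall eta : R, 0 < eta ->
  exists K, forall h x, h \notin K -> eta <= d x h^-1%g -> d (h * x)%g h <= eta.

Definition quasi_additive f := forall eta : R, 0 < eta ->
  exists C : R, forall p q, eta <= d p^-1%g q -> `|f (p * q)%g - f p - f q| <= C.

Definition left_quasi_invariant f := forall h,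
  exists C : R, forall x, `|f (h * x)%g - f x| <= C.

Definition proper_below f := forall N : R, exists K, forall g, f g <= N -> g \in K.

Hypotheses (d_sym : forall x y, d x y = d y x)
           (d_refl : forall x, d x x = 0)
           (d_tri : forall x y z, d x z <= d x y + d y z).

Definition infinite_pred (P : G -> Prop) := forall K, exists2 g, g \notin K & P g.

(* For g in P1 and h in P2, the conjugates g^n h g^-n stay in a finite set, so h commutes *)
(* with a power g^j; but h g^j is close to h whereas g^j h is close to g.                 *)
Lemma no_almost_fixed_point f (eta : R) (P1 P2 : G -> Prop) :
  convergence_metric -> quasi_additive f -> left_quasi_invariant f -> proper_below f ->
  0 < eta -> infinite_pred P1 -> infinite_pred P2 ->
  (forall x y, P1 x -> P2 y -> 3 * eta <= d x y) ->
  (forall F, exists q, [/\ forall x, x \in F -> d (x * q)%g q < eta,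
      forall x, P1 x -> 10 * eta <= d x q & forall x, P2 x -> 10 * eta <= d x q]) ->
  False.
Proof.
move=> conv qadd qinv prop eta0 inf1 inf2 sep fixq.
have [K HK] := conv _ eta0; have [C HC] := qadd _ eta0.
have [g gK P1g] := inf1 (K ++ map (fun x => x^-1)%g K).
have [h hK P2h] := inf2 (K ++ map (fun x => x^-1)%g K).
have notK z : z \notin K ++ map (fun x => x^-1)%g K -> (z \notin K).
  by rewrite mem_cat negb_or => /andP[].
move/notK in gK; move/notK in hK.
have fixed z q : z \notin K -> d (z * q)%g q < eta -> 10 * eta <= d z q -> d q z^-1%g < eta.
  move=> zK zq fz; rewrite ltNge; apply/negP => /(HK _ _ zK) H.
  have := d_tri z (z * q)%g q; rewrite (d_sym z (z * q)%g) => H2.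
  by lra.
have [q0 [fix0 away1 away2]] := fixq [:: g; h].
have gq0 := fixed g q0 gK (fix0 g (mem_head _ _)) (away1 g P1g).
have hq0 : d q0 h^-1%g < eta.
  by apply: fixed (away2 h P2h) => //; apply: fix0; rewrite !inE eqxx orbT.
have aux u v w : 10 * eta <= d u q0 -> d q0 w < eta -> d v u <= eta -> eta <= d v w.
  move=> uq qw vu; have := d_tri u v w; have := d_tri u w q0.
  by rewrite (d_sym w) (d_sym u v) => *; lra.
have gstep y : d y g <= eta \/ d y h <= eta -> d (g * y)%g g <= eta.
  case=> H; apply: HK => //.
    exact: aux (away1 _ P1g) gq0 H.
  exact: aux (away2 _ P2h) gq0 H.
have hstep y : d y g <= eta \/ d y h <= eta -> d (h * y)%g h <= eta.
  case=> H; apply: HK => //.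
    exact: aux (away1 _ P1g) hq0 H.
  exact: aux (away2 _ P2h) hq0 H.
have gpow n y : d y g <= eta \/ d y h <= eta -> d (g ^+ n.+1 * y)%g g <= eta.
  move=> Hy; elim: n => [|n IHn]; first by rewrite expg1; exact: gstep.
  by rewrite expgS -mulgA; apply: gstep; left.
have gpowS n : d (g ^+ n.+1)%g g <= eta.
  case: n => [|n]; first by rewrite expg1 d_refl ltW.
  by rewrite expgSr; apply: gpow; left; rewrite d_refl ltW.
have [Ch HCh] := qinv h.
have [K3 HK3] := prop (3 * C + Ch).
pose gam n := (g ^+ n.+1 * h * g ^- n.+1)%g.
have gamP n : gam n \in K ++ K3 ++ map (fun x => x^-1)%g K3.
  set y := (g ^+ n.+1)%g in @gam *.
  have gamE : gam n = (y * h * y^-1)%g by [].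
  have [q [fixF aw1 aw2]] := fixq [:: (y^-1)%g; (h * y^-1)%g; gam n; g; h].
  have f1 : d (y^-1 * q)%g q < eta by apply: fixF; rewrite !inE eqxx.
  have f2 : d (gam n * q)%g q < eta by apply: fixF; rewrite !inE eqxx !orbT.
  have gq : 10 * eta <= d g q by exact: aw1.
  have yg : d y g <= eta by exact: gpowS.
  have yq : 9 * eta <= d y q.
    by have := d_tri g y q; rewrite (d_sym g y) => *; lra.
  have A1 : `|f (y^-1 * q)%g - f y^-1%g - f q| <= C.
    by apply: HC; rewrite invgK; lra.
  have A2 : `|f (y^-1 * (gam n * q))%g - f y^-1%g - f (gam n * q)%g| <= C.
    apply: HC; rewrite invgK; have := d_tri y (gam n * q)%g q; lra.
  have E : (y^-1 * (gam n * q))%g = (h * (y^-1 * q))%g.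
    by rewrite gamE -!mulgA mulKg.
  have A3 := HCh (y^-1 * q)%g.
  rewrite !mem_cat; have [//|gamK] := boolP (gam n \in K).
  have A4 : `|f (gam n * q)%g - f q| <= 2 * C + Ch.
    move: A1 A2 A3; rewrite E !ler_norml => /andP[? ?] /andP[? ?] /andP[? ?].
    by apply/andP; split; lra.
  have [H|H] := leP eta (d (gam n)^-1%g q).
    suff -> : gam n \in K3 by rewrite orbT.
    apply: HK3; move: A4 (HC _ _ H); rewrite !ler_norml => /andP[? ?] /andP[? ?].
    by lra.
  (* Now (gam n)^-1 is near q, so gam n sends y g, which is near g and far from q, close to gam n;
     but gam n y g = y h g is also close to g. Hence gam n is near g, and q = (gam n)^-1 (gam n q)
     is the product to split: this time f bounds (gam n)^-1. *)
  have D1 : d (gam n * (y * g))%g (gam n) <= eta.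
    apply: HK => //; have yg2 : d (y * g)%g g <= eta.
      by apply: gpow; left; rewrite d_refl ltW.
    have := d_tri g (y * g)%g q; have := d_tri (y * g)%g (gam n)^-1%g q.
    rewrite (d_sym g (y * g)%g); lra.
  have D2 : d (gam n * (y * g))%g g <= eta.
    rewrite gamE -!mulgA mulKg; apply: gpow; right.
    by apply: hstep; left; rewrite d_refl ltW.
  have D3 : eta <= d (gam n) (gam n * q)%g.
    have := d_tri g (gam n * (y * g))%g q; have := d_tri (gam n * (y * g))%g (gam n) q.
    have := d_tri (gam n) (gam n * q)%g q.
    rewrite (d_sym g (gam n * (y * g))%g); lra.
  suff : (gam n)^-1%g \in K3.
    by move/(map_f (fun x => x^-1)%g); rewrite invgK => ->; rewrite !orbT.
  have := HC (gam n)^-1%g (gam n * q)%g; rewrite invgK mulKg => /(_ D3).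
  move=> A5; apply: HK3; move: A4 A5; rewrite !ler_norml => /andP[? ?] /andP[? ?].
  by lra.
have [i [j [ij gamij]]] := pigeonhole_seq gamP.
have comm : (h * g ^+ (j - i))%g = (g ^+ (j - i) * h)%g.
  have ejk : (j = i + (j - i))%N by rewrite subnKC // ltnW.
  set k := (j - i)%N in ejk *; move: gamij; rewrite /gam ejk -addSn expgnDr invgM.
  rewrite -!mulgA => /mulgI; rewrite !mulgA => /mulIg e.
  by rewrite {1}e mulgVK.
move: comm; have : (0 < j - i)%N by rewrite subn_gt0.
case: (j - i)%N => // m _ comm.
have H1 : d (h * g ^+ m.+1)%g h <= eta by apply: hstep; left; exact: gpowS.
have H2 : d (h * g ^+ m.+1)%g g <= eta.
  by rewrite comm; apply: gpow; right; rewrite d_refl ltW.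
have := sep g h P1g P2h; have := d_tri g (h * g ^+ m.+1)%g h.
rewrite (d_sym g (h * _)%g); lra.
Qed.

(** If no finite F works, then for every F some x has q and all h q, h in F, within eta / 2 of it,
    so that every h in F almost fixes q. Three separated families of attracting points then
    contradict [no_almost_fixed_point]. *)
Lemma uniform_escape f (eta : R) (P1 P2 P3 : G -> Prop) :
  convergence_metric -> quasi_additive f -> left_quasi_invariant f -> proper_below f ->
  0 < eta -> infinite_pred P1 -> infinite_pred P2 -> infinite_pred P3 ->
  (forall x y, P1 x -> P2 y -> 20 * eta <= d x y) ->
  (forall x y, P1 x -> P3 y -> 20 * eta <= d x y) ->
  (forall x y, P2 x -> P3 y -> 20 * eta <= d x y) ->
  exists F, forall x q, exists2 h, h \in F & eta / 2 <= d x (h * q)%g.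
Proof.
move=> conv qadd qinv prop eta0 i1 i2 i3 s12 s13 s23.
apply: contrapT => /forallNP H.
have fixq F : exists q, forall x, x \in F -> d (x * q)%g q < eta.
  move: (H (1%g :: F)) => /existsNP[x /existsNP[q nq]]; exists q => h hF.
  have lt h' : h' \in 1%g :: F -> d x (h' * q)%g < eta / 2.
    by move=> h'F; rewrite ltNge; apply/negP => le; apply: nq; exists h'.
  have := lt h; rewrite inE hF orbT => /(_ isT).
  have := lt 1%g (mem_head _ _); rewrite mul1g => l1 l2.
  have := d_tri (h * q)%g x q; rewrite (d_sym (h * q)%g x); lra.
have noq P P' : infinite_pred P -> infinite_pred P' ->
    (forall x y, P x -> P' y -> 20 * eta <= d x y) ->
    exists F, forall q, (forall x, x \in F -> d (x * q)%g q < eta) ->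
      (forall x, P x -> 10 * eta <= d x q) -> (forall x, P' x -> 10 * eta <= d x q) ->
      False.
  move=> iP iP' sep; apply: contrapT => /forallNP nF.
  apply: (@no_almost_fixed_point f eta P P') => //.
    by move=> x y Px Py; have := sep _ _ Px Py; lra.
  move=> F; move: (nF F) => /existsNP[q nq]; exists q.
  apply: contrapT => n3; apply: nq => ? ? ?; exact: n3.
have [F12 H12] := noq _ _ i1 i2 s12; have [F13 H13] := noq _ _ i1 i3 s13.
have [F23 H23] := noq _ _ i2 i3 s23.
have [q Hq] := fixq (F12 ++ F13 ++ F23).
have near P : ~ (forall x, P x -> 10 * eta <= d x q) ->
    exists2 x, P x & d x q < 10 * eta.
  move/existsNP => [x /not_implyP[Px]] /negP; rewrite -ltNge => lt.
  by exists x.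
have clash P P' : (forall x y, P x -> P' y -> 20 * eta <= d x y) ->
    (exists2 x, P x & d x q < 10 * eta) -> (exists2 x, P' x & d x q < 10 * eta) -> False.
  move=> sep [x Px xq] [y P'y yq]; have := sep _ _ Px P'y.
  by have := d_tri x q y; rewrite (d_sym q y); lra.
have Hq12 x : x \in F12 -> d (x * q)%g q < eta by move=> xF; apply: Hq; rewrite mem_cat xF.
have Hq13 x : x \in F13 -> d (x * q)%g q < eta.
  by move=> xF; apply: Hq; rewrite !mem_cat xF orbT.
have Hq23 x : x \in F23 -> d (x * q)%g q < eta.
  by move=> xF; apply: Hq; rewrite !mem_cat xF !orbT.
(* The three families are 20 eta apart, so q is within 10 eta of members of at most one of them; the
   other two satisfy the hypotheses of [no_almost_fixed_point]. *)
have [w1|/near n1] := pselect (forall x, P1 x -> 10 * eta <= d x q).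
  have [w2|/near n2] := pselect (forall x, P2 x -> 10 * eta <= d x q).
    exact: H12 Hq12 w1 w2.
  have [w3|/near n3] := pselect (forall x, P3 x -> 10 * eta <= d x q).
    exact: H13 Hq13 w1 w3.
  exact: clash s23 n2 n3.
have [w2|/near n2] := pselect (forall x, P2 x -> 10 * eta <= d x q); last first.
  exact: clash s12 n1 n2.
have [w3|/near n3] := pselect (forall x, P3 x -> 10 * eta <= d x q); last first.
  exact: clash s13 n1 n3.
exact: H23 Hq23 w2 w3.
Qed.

(* p is a prefix of g when the factorisation g = p (p^-1 g) is quasi-additive. *)
Definition prefix_at (r : R) p g := r <= d p^-1%g (p^-1 * g)%g.

Lemma prefix_at_le (r r' : R) p g : r' <= r -> prefix_at r p g -> prefix_at r' p g.
Proof. exact: le_trans. Qed.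

Definition contracts_off (eta : R) K :=
  forall h x, h \notin K -> eta <= d x h^-1%g -> d (h * x)%g h <= eta.

(** Put h = p1^-1 p2 and x = p2^-1 g, so that h x = p1^-1 g. Either x is away from h^-1, and then
    p1^-1 g is close to p1^-1 p2, or p2^-1 g is close to h^-1 = p2^-1 p1. Being a prefix is thus
    passed from g to one of the two elements, at the cost of eta. *)
Lemma prefix_at_linear (eta r : R) K p1 p2 g : contracts_off eta K ->
  prefix_at r p1 g -> prefix_at r p2 g -> (p1^-1 * p2)%g \notin K ->
  prefix_at (r - eta) p1 p2 \/ prefix_at (r - eta) p2 p1.
Proof.
rewrite /prefix_at => HK g1 g2 hK.
have [H|H] := leP eta (d (p2^-1 * g)%g (p1^-1 * p2)^-1%g); [left|right].
  have := HK _ _ hK H; rewrite mulgA mulgK => H2.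
  have := d_tri p1^-1%g (p1^-1 * p2)%g (p1^-1 * g)%g.
  by rewrite (d_sym (p1^-1 * p2)%g); lra.
rewrite invgM invgK in H.
by have := d_tri p2^-1%g (p2^-1 * p1)%g (p2^-1 * g)%g; rewrite (d_sym (p2^-1 * p1)%g); lra.
Qed.

(** Contraction is used twice: p2^-1 p1 is close to p2^-1, hence away from p2^-1 g, and therefore
    p1^-1 g is close to p1^-1 p2. *)
Lemma prefix_at_trans (eta r r2 : R) K p1 p2 g : contracts_off eta K ->
  prefix_at r p1 p2 -> prefix_at r2 p2 g -> eta <= r -> 2 * eta <= r2 ->
  (p1^-1 * p2)%g \notin K -> (p1^-1 * p2)^-1%g \notin K ->
  prefix_at (r - eta) p1 g.
Proof.
rewrite /prefix_at => HK g1 g2 r1 r2l hK hK'.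
have := HK _ p1^-1%g hK'; rewrite invgK => /(_ (le_trans r1 g1)).
rewrite invgM invgK mulgK => H1.
have := HK _ (p2^-1 * g)%g hK; rewrite mulgA mulgK invgM invgK => H2.
have H3 : d (p1^-1 * g)%g (p1^-1 * p2)%g <= eta.
  apply: H2; have := d_tri p2^-1%g (p2^-1 * p1)%g (p2^-1 * g)%g.
  by rewrite (d_sym (p2^-1 * p1)%g (p2^-1 * g)%g); lra.
have := d_tri p1^-1%g (p1^-1 * g)%g (p1^-1 * p2)%g; lra.
Qed.

End ConvergenceGroup.

(** * Sums over finite subsets of a group *)

Section FiniteSums.
Variable R : realType.

Definition bounded_sums (T : eqType) (w : T -> R) :=
  exists B : R, forall X : seq T, uniq X -> \sum_(x <- X) w x <= B.

Lemma ler_sum_subset (T : eqType) (s s' : seq T) (w : T -> R) :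
  (forall x, 0 <= w x) -> uniq s -> uniq s' -> {subset s <= s'} ->
  \sum_(x <- s) w x <= \sum_(x <- s') w x.
Proof.
move=> w0 us us' ss'.
rewrite (perm_big [seq x <- s' | x \in s]) /=.
  by rewrite big_filter [leRHS](bigID (fun x => x \in s)) lerDl sumr_ge0.
apply: uniq_perm => //; first exact: filter_uniq.
by move=> x; rewrite mem_filter /=; case: (boolP (x \in s)) => // /ss' ->.
Qed.

Lemma sum_fiber_le (T U : eqType) (m : T -> U) (w : U -> R) (M : nat) (Q : R) (Z : seq T) :
  (forall u, 0 <= w u) -> (forall X, uniq X -> \sum_(x <- X) w x <= Q) -> uniq Z ->
  (forall x, x \in Z -> exists L : seq T, (size L <= M)%N /\
     forall y, y \in Z -> m y = m x -> y \in L) ->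
  \sum_(x <- Z) w (m x) <= M%:R * Q.
Proof.
move=> w0 wQ uZ fib; rewrite -(big_map m xpredT w) -big_undup_iterop_count.
have -> : \sum_(u <- undup (map m Z)) iterop (count_mem u (map m Z)) +%R (w u) 0
   = \sum_(u <- undup (map m Z)) w u *+ count_mem u (map m Z) by [].
apply: (@le_trans _ _ (\sum_(u <- undup (map m Z)) M%:R * w u)); last first.
  by rewrite -mulr_sumr ler_wpM2l // wQ // undup_uniq.
rewrite [leLHS]big_seq [leRHS]big_seq; apply: ler_sum => u.
rewrite mem_undup => /mapP[x xZ ->]; rewrite mulr_natl; apply: ler_wpMn2l => //.
have [L [sL HL]] := fib x xZ; apply: leq_trans sL.
rewrite count_map -size_filter; apply: uniq_leq_size; first by rewrite filter_uniq.
by move=> y; rewrite mem_filter /= => /andP[/eqP mE yZ]; exact: HL.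
Qed.

(* The product of the sum over S with the sum over a finite set Y is at most C M times the *)
(* total sum, because m has fibres of size at most M; take Y nearly optimal and divide.    *)
Lemma sum_insertion (G : eqType) (w : G -> R) (S : G -> Prop) (m : G -> G -> G)
    (C : R) (M : nat) (g0 : G) :
  0 <= C -> bounded_sums w -> (forall g, 0 < w g) ->
  (forall p q, S p -> w p * w q <= C * w (m p q)) ->
  (forall p q, S p -> exists L : seq (G * G), (size L <= M)%N /\
     forall p' q', S p' -> m p' q' = m p q -> (p', q') \in L) ->
  forall X, uniq X -> (forall x, x \in X -> S x) -> \sum_(x <- X) w x <= C * M%:R.
Proof.
move=> C0 [B wB] w0 wm fib X uX XS.
pose E := [set r : R | exists2 Y : seq G, uniq Y & r = \sum_(y <- Y) w y].
have ubE : has_ubound E by exists B => _ [Y uY ->]; exact: wB.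
have leQ Y : uniq Y -> \sum_(y <- Y) w y <= sup E.
  by move=> uY; apply: ub_le_sup => //; exists Y.
have Q0 : 0 < sup E.
  by apply: lt_le_trans (leQ [:: g0] isT); rewrite big_seq1.
have [s0|s0] := leP (\sum_(x <- X) w x) 0.
  by apply: le_trans s0 _; rewrite mulr_ge0.
suff : sup E <= C * M%:R * sup E / \sum_(x <- X) w x.
  by rewrite ler_pdivlMr // mulrC ler_pM2r.
apply: ge_sup; first by exists (\sum_(y <- [::]) w y); exists [::].
move=> _ [Y uY ->]; rewrite ler_pdivlMr // mulrC big_distrlr /=.
rewrite -(big_allpairs (F := fun z : G * G => w z.1 * w z.2)) -mulrA.
have uZ : uniq [seq (x, y) | x <- X, y <- Y].
  by apply: allpairs_uniq => // -[? ?] [? ?].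
have ZS z : z \in [seq (x, y) | x <- X, y <- Y] -> S z.1.
  by case/allpairsP => -[x y] [/= xX yY ->]; exact: XS.
apply: (@le_trans _ _ (\sum_(z <- [seq (x, y) | x <- X, y <- Y]) C * w (m z.1 z.2))).
  by rewrite [leLHS]big_seq [leRHS]big_seq; apply: ler_sum => z /ZS; exact: wm.
rewrite -mulr_sumr ler_wpM2l //.
apply: (@sum_fiber_le _ _ (fun z : G * G => m z.1 z.2)) => //.
  by move=> u; exact: ltW.
move=> [x y] /ZS /= Sx; have [L [sL HL]] := fib x y Sx.
by exists L; split=> // -[x' y'] /ZS /= Sx' E'; exact: HL.
Qed.

(** Each g with f g at most N contributes at least e^(-s N) to a bounded sum. *)
Lemma sublevel_finite (G : eqType) (s : R) (f : G -> R) : 0 < s ->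
  bounded_sums (fun g => expR (- (s * f g))) ->
  forall N : R, exists K : seq G, forall g, f g <= N -> g \in K.
Proof.
move=> s0 [B HB] N; apply: contrapT => /forallNP nK.
have big n : exists X : seq G, [/\ uniq X, size X = n & forall x, x \in X -> f x <= N].
  elim: n => [|n [X [uX sX XN]]]; first by exists [::].
  move: (nK X) => /existsNP[g /not_implyP[gN /negP gX]].
  exists (g :: X); split; rewrite /= ?gX ?sX // => x.
  by rewrite inE => /predU1P[->//|/XN].
have le n : n%:R * expR (- (s * N)) <= B.
  have [X [uX sX XN]] := big n; apply: le_trans (HB X uX).
  rewrite -sX mulr_natl -sum1_size -sumrMnr /=; rewrite [leLHS]big_seq [leRHS]big_seq.
  by apply: ler_sum => x /XN fN; rewrite mulr1n ler_expR lerN2 ler_pM2l.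
have := le (Num.bound `|B / expR (- (s * N))|).
rewrite -ler_pdivlMr ?expR_gt0 // leNgt => /negP; apply.
by apply: le_lt_trans (ler_norm _) _; exact: archi_boundP.
Qed.

Lemma left_quasi_invariant_unif (G : groupType) (f : G -> R) (F : seq G) :
  left_quasi_invariant f ->
  exists C, 0 <= C /\ forall h x, h \in F -> `|f (h * x)%g - f x| <= C.
Proof.
move=> qinv; elim: F => [|h F [C [C0 HC]]]; first by exists 0.
have [C' HC'] := qinv h; exists (C + `|C'|); split; first by rewrite addr_ge0.
move=> k x; rewrite inE => /predU1P[->|/HC/le_trans]; last by apply; rewrite lerDl.
by apply: le_trans (HC' x) _; rewrite (le_trans (ler_norm _)) // lerDr.
Qed.

End FiniteSums.

Lemma quasi_additive_lin (R : realType) (G : groupType) (d : G -> G -> R) f g (u v : R) :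
  quasi_additive d f -> quasi_additive d g -> quasi_additive d (fun x => u * f x + v * g x).
Proof.
move=> qf qg eta eta0; have [C HC] := qf _ eta0; have [C' HC'] := qg _ eta0.
exists (`|u| * C + `|v| * C') => p q H.
rewrite (_ : _ - _ - _ = u * (f (p * q)%g - f p - f q) + v * (g (p * q)%g - g p - g q));
  last by ring.
apply: le_trans (ler_normD _ _) _; rewrite !normrM.
by apply: lerD; apply: ler_wpM2l => //; [exact: HC|exact: HC'].
Qed.

Lemma left_quasi_invariant_lin (R : realType) (G : groupType) (f g : G -> R) (u v : R) :
  left_quasi_invariant f -> left_quasi_invariant g ->
  left_quasi_invariant (fun x => u * f x + v * g x).
Proof.
move=> qf qg h; have [C HC] := qf h; have [C' HC'] := qg h.
exists (`|u| * C + `|v| * C') => x.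
rewrite (_ : _ - _ = u * (f (h * x)%g - f x) + v * (g (h * x)%g - g x)); last by ring.
apply: le_trans (ler_normD _ _) _; rewrite !normrM.
by apply: lerD; apply: ler_wpM2l.
Qed.

(** The smaller of a g and b g is at most their convex combination, so each term is bounded by one
    of the two given terms. *)
Lemma bounded_sums_convex (R : realType) (T : eqType) (a b : T -> R) (lam s : R) :
  0 <= lam -> lam <= 1 -> 0 < s ->
  bounded_sums (fun g => expR (- (s * a g))) -> bounded_sums (fun g => expR (- (s * b g))) ->
  bounded_sums (fun g => expR (- (s * (lam * a g + (1 - lam) * b g)))).
Proof.
move=> lam0 lam1 s0 [A HA] [B HB].
exists (A + B) => X uX; apply: le_trans (lerD (HA X uX) (HB X uX)).
rewrite -big_split; apply: ler_sum => g _ /=.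
have [ab|ab] := leP (a g) (b g).
  apply: ler_wpDr; first exact: expR_ge0.
  rewrite ler_expR lerN2 ler_pM2l // -subr_ge0.
  have -> : lam * a g + (1 - lam) * b g - a g = (1 - lam) * (b g - a g) by ring.
  by apply: mulr_ge0; rewrite subr_ge0.
apply: ler_wpDl; first exact: expR_ge0.
rewrite ler_expR lerN2 ler_pM2l // -subr_ge0.
have -> : lam * a g + (1 - lam) * b g - b g = lam * (a g - b g) by ring.
by apply: mulr_ge0; rewrite ?subr_ge0 // ltW.
Qed.

(** * The renewal argument *)

Section Renewal.
Variables (R : realType) (G : groupType) (d : G -> G -> R).
Hypotheses (d_sym : forall x y, d x y = d y x)
           (d_tri : forall x y z, d x z <= d x y + d y z)
           (d_conv : convergence_metric d).
Variables (a b : G -> R) (lam : R).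
Hypotheses (lam0 : 0 < lam) (lam1 : lam < 1).
Hypotheses (a_add : quasi_additive d a) (b_add : quasi_additive d b)
           (a_inv : left_quasi_invariant a) (b_inv : left_quasi_invariant b).
Hypotheses (a_sum : forall s, 1 < s -> bounded_sums (fun g => expR (- (s * a g))))
           (b_sum : forall s, 1 < s -> bounded_sums (fun g => expR (- (s * b g)))).
Variables (eta : R) (F : seq G).
Hypotheses (eta0 : 0 < eta)
  (escape : forall x q, exists2 h, h \in F & 10 * eta <= d x (h * q)%g).
Implicit Types (g h p q x y : G) (s : R) (T : G -> Prop).

Let c g := lam * a g + (1 - lam) * b g.
Let D g := a g - b g.

Let c_add : quasi_additive d c. Proof. exact: quasi_additive_lin. Qed.
Let c_inv : left_quasi_invariant c. Proof. exact: left_quasi_invariant_lin. Qed.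

Let c_sum s : 1 < s -> bounded_sums (fun g => expR (- (s * c g))).
Proof.
have [l0 l1] := (lam0, lam1).
by move=> s1; apply: bounded_sums_convex; [lra|lra|lra|exact: a_sum|exact: b_sum].
Qed.

Let c_proper : proper_below c.
Proof.
move=> N; apply: (@sublevel_finite R G 2 c) => //; apply: c_sum; exact: ltr1n.
Qed.

Let conv_sym : exists2 K : seq G, contracts_off d eta K & forall h, (h^-1%g \in K) = (h \in K).
Proof.
have [K HK] := d_conv eta0; exists (K ++ map (fun x => x^-1)%g K).
  by move=> h x; rewrite mem_cat negb_or => /andP[hK _]; exact: HK.
move=> h; rewrite !mem_cat orbC; congr (_ || _).
  by rewrite (mem_map (@invg_inj _)).
by rewrite -{2}[h]invgK (mem_map (@invg_inj _)).
Qed.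

Let escape_fun : exists phi : G -> G -> G,
  forall x q, phi x q \in F /\ 10 * eta <= d x (phi x q * q)%g.
Proof.
have /choice[phi Hphi] : forall z : G * G, exists h, h \in F /\ 10 * eta <= d z.1 (h * z.2)%g.
  by move=> [x q]; have [h] := escape x q; exists h.
by exists (fun x q => phi (x, q)) => x q; exact: (Hphi (x, q)).
Qed.

Let common : exists C : R, 0 <= C /\ forall p q, eta <= d p^-1%g q ->
  [/\ `|a (p * q)%g - a p - a q| <= C, `|b (p * q)%g - b p - b q| <= C
    & `|c (p * q)%g - c p - c q| <= C].
Proof.
have [A HA] := a_add eta0; have [B HB] := b_add eta0; have [C HC] := c_add eta0.
exists (`|A| + `|B| + `|C|); split=> [|p q H]; first by rewrite !addr_ge0.
have [[nA nB] nC] := (ler_norm A, ler_norm B, ler_norm C).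
have [[pA pB] pC] := (normr_ge0 A, normr_ge0 B, normr_ge0 C).
have [[hA hB] hC] := (HA _ _ H, HB _ _ H, HC _ _ H).
by split; lra.
Qed.

Let common_F : exists C : R, 0 <= C /\ forall h q, h \in F ->
  [/\ `|a (h * q)%g - a q| <= C, `|b (h * q)%g - b q| <= C
    & `|c (h * q)%g - c q| <= C].
Proof.
have [A [A0 HA]] := left_quasi_invariant_unif F a_inv.
have [B [B0 HB]] := left_quasi_invariant_unif F b_inv.
have [C [C0 HC]] := left_quasi_invariant_unif F c_inv.
exists (A + B + C); split=> [|p q H]; first by rewrite !addr_ge0.
by split; [have := HA _ q H|have := HB _ q H|have := HC _ q H]; lra.
Qed.

(** First means of least c: c has finite sublevel sets, so a minimum exists, and c grows along
    prefixes up to a constant. The threshold 5 eta leaves room below the 10 eta of the insertions,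
    because each comparison of prefixes costs eta. *)
Definition first_prefix T p := T p /\ exists2 g, prefix_at d (5 * eta) p g &
  forall p', T p' -> prefix_at d (5 * eta) p' g -> c p <= c p'.

(** One of p1 and p2 is a prefix of the other, say p1 of p2, and then also of the element g2 in
    which p2 is first. Minimality gives c p2 <= c p1, while c p2 is c p1 + c (p1^-1 p2) up to a
    constant, so that c (p1^-1 p2) is bounded above. The list K serves all T at once, which keeps
    later bounds independent of the threshold N. *)
Let first_prefix_fiber : exists K : seq G, forall T p1 p2 g,
  first_prefix T p1 -> first_prefix T p2 ->
  prefix_at d (10 * eta) p1 g -> prefix_at d (10 * eta) p2 g -> (p1^-1 * p2)%g \in K.
Proof.
have [K HK Ksym] := conv_sym; have [C [C0 HC]] := common.
have [Kc HKc] := c_proper C.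
have e0 := eta0.
have key T p1 p2 : first_prefix T p1 -> first_prefix T p2 ->
    prefix_at d (9 * eta) p1 p2 -> (p1^-1 * p2)%g \in K ++ Kc.
  move=> [T1 _] [T2 [g g2 min2]] pre; rewrite mem_cat.
  have [//|nK] := boolP ((p1^-1 * p2)%g \in K); apply: HKc.
  have g1 : prefix_at d (5 * eta) p1 g.
    have := prefix_at_trans d_sym d_tri HK pre g2; rewrite Ksym => H.
    by apply: prefix_at_le (H _ _ nK nK); lra.
  have := min2 _ T1 g1.
  have [|_ _] := HC p1 (p1^-1 * p2)%g; first by move: pre; rewrite /prefix_at; lra.
  by rewrite mulVKg ler_norml => /andP[]; lra.
exists ((K ++ Kc) ++ map (fun x => x^-1)%g (K ++ Kc)) => T p1 p2 g S1 S2 g1 g2.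
rewrite mem_cat; have [/(prefix_at_linear d_sym d_tri HK g1 g2)|] := boolP ((p1^-1 * p2)%g \notin K).
  rewrite (_ : _ - _ = 9 * eta); last by ring.
  case=> [/(key _ _ _ S1 S2)->//|/(key _ _ _ S2 S1)].
  by move/(map_f (fun x => x^-1)%g); rewrite invgM invgK => ->; rewrite orbT.
by rewrite negbK mem_cat => ->.
Qed.

Let insertion_weight (E s x y z : R) : 0 <= E -> 1 < s -> s <= 2 ->
  z <= x + y + E ->
  expR (- (s * x)) * expR (- (s * y)) <= expR (2 * E) * expR (- (s * z)).
Proof.
move=> E0 s1 s2 zxy; rewrite -!expRD ler_expR.
have s0 : 0 <= s by lra.
have H1 : s * (z - x - y) <= s * E by rewrite ler_wpM2l //; lra.
have H2 : s * E <= 2 * E by rewrite ler_wpM2r.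
by rewrite -subr_ge0 (_ : _ - _ = 2 * E - s * (z - x - y)); [lra|ring].
Qed.

(** The map (p, q) |-> p h q, with h in F chosen by [escape_fun], makes p a prefix of the product.
    By [first_prefix_fiber] another preimage has first entry p k with k in K, and then the inserted
    word determines the rest; hence at most |K| |F| preimages, and [sum_insertion] applies to a and
    b separately. *)
Let first_prefix_sums : exists C1 : R, 0 <= C1 /\ forall T s, 1 < s -> s <= 2 ->
  forall X, uniq X -> (forall x, x \in X -> first_prefix T x) ->
  \sum_(x <- X) expR (- (s * a x)) <= C1 /\ \sum_(x <- X) expR (- (s * b x)) <= C1.
Proof.
have [phi Hphi] := escape_fun; have [K HK] := first_prefix_fiber.
have [C [C0 HC]] := common; have [CF [CF0 HCF]] := common_F.
pose m p q := (p * (phi p^-1 q * q))%g.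
have e0 := eta0.
have mpre p q : prefix_at d (10 * eta) p (m p q).
  by rewrite /prefix_at /m mulKg; have [] := Hphi p^-1%g q.
have E0 : 0 <= C + CF by lra.
have gen T s (f : G -> R) : (forall p q, f (m p q) <= f p + f q + (C + CF)) ->
    (bounded_sums (fun g => expR (- (s * f g)))) -> 1 < s -> s <= 2 ->
    forall X, uniq X -> (forall x, x \in X -> first_prefix T x) ->
    \sum_(x <- X) expR (- (s * f x)) <= expR (2 * (C + CF)) * (size K * size F)%:R.
  move=> fm fs s1 s2; apply: (@sum_insertion R G _ (first_prefix T) m _ _ 1%g) => //.
  - by move=> g; exact: expR_gt0.
  - by move=> p q Sp; exact: insertion_weight.
  move=> p q Sp.
  exists [seq ((p * z.1)%g, (z.2^-1 * ((p * z.1)^-1 * m p q))%g) |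
    z <- [seq (k, h) | k <- K, h <- F]].
  rewrite size_map size_allpairs; split=> // p' q' Sp' mE.
  apply/mapP; exists ((p^-1 * p')%g, phi p'^-1%g q').
    apply/allpairsP; exists ((p^-1 * p')%g, phi p'^-1%g q'); split=> //=.
      by apply: (HK T _ _ (m p q)) => //; rewrite -mE.
    by have [] := Hphi p'^-1%g q'.
  by rewrite /= mulVKg -mE /m !mulKg.
have fm p q : [/\ a (m p q) <= a p + a q + (C + CF), b (m p q) <= b p + b q + (C + CF)
    & c (m p q) <= c p + c q + (C + CF)].
  have [hF hd] := Hphi p^-1%g q; have [A1 B1 D1] := HCF _ q hF.
  have [|A2 B2 D2] := HC p (phi p^-1 q * q)%g; first by apply: le_trans hd; lra.
  move: A1 B1 D1 A2 B2 D2; rewrite !ler_norml -/(m p q).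
  by move=> /andP[? ?] /andP[? ?] /andP[? ?] /andP[? ?] /andP[? ?] /andP[? ?]; split; lra.
exists (expR (2 * (C + CF)) * (size K * size F)%:R); split.
  by rewrite mulr_ge0 ?expR_ge0.
move=> T s s1 s2 X uX XS; split; apply: (gen T) => //.
- by move=> p q; have [] := fm p q.
- exact: a_sum.
- by move=> p q; have [] := fm p q.
- exact: b_sum.
Qed.

Let abs_sum_bound (f : G -> R) K x : x \in K -> `|f x| <= \sum_(k <- K) `|f k|.
Proof.
elim: K => // k K IH; rewrite inE big_cons => /predU1P[->|/IH H].
  by rewrite lerDl sumr_ge0.
by rewrite (le_trans H) // lerDr.
Qed.

Definition avoids T g := forall p, T p -> ~ prefix_at d (5 * eta) p g.

(** The map is (g, q) |-> g u f2 q with u = f1 w. Suppose g1 and g2 give the same product z and g1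
    is a prefix of g2; compare g1 u1 with g2, both prefixes of z. They may differ by an element of
    K. If g1 u1 is a prefix of g2, then |D| is below N at g1 and at g1 u1, against the size of |D
    u1|. If g2 is a prefix of g1 u1, then c (g1^-1 g2) is bounded by c u1 up to constants. So g1^-1
    g2 lies in a finite list. *)
Let avoiding_sums (N : R) : (forall M : R, exists w, M < `|D w|) ->
  exists C2 : R, forall s, 1 < s -> s <= 2 ->
  forall X, uniq X -> (forall x, x \in X -> avoids (fun p => N <= `|D p|) x) ->
  \sum_(x <- X) expR (- (s * c x)) <= C2.
Proof.
move=> unb; have [phi Hphi] := escape_fun; have [K HK Ksym] := conv_sym.
have [C [C0 HC]] := common; have [CF [CF0 HCF]] := common_F.
have e0 := eta0.
pose BK := \sum_(k <- K) `|D k|.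
have BK0 : 0 <= BK by apply: sumr_ge0.
(* Putting a word of F in front of w changes D by at most 2 CF. What remains exceeds BK, so that f w
   is outside K, and 2 N + 2 C, so that |D| cannot be below N both before and after f w. *)
have [w Hw] := unb (2 * `|N| + 2 * C + 2 * CF + BK).
have Dw f : f \in F -> 2 * `|N| + 2 * C + BK < `|D (f * w)%g|.
  move=> fF; have [A1 B1 _] := HCF _ w fF.
  have : `|D w - D (f * w)%g| <= 2 * CF.
    move: A1 B1; rewrite /D !ler_norml => /andP[? ?] /andP[? ?].
    by apply/andP; split; lra.
  have := ler_dist_dist (D w) (D (f * w)%g); have := ler_norm (`|D w| - `|D (f * w)%g|).
  by lra.
have N0 := normr_ge0 N; have NN := ler_norm N.
have fwK f : f \in F -> (f * w)%g \notin K.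
  by move=> fF; apply/negP => /(abs_sum_bound D); have := Dw _ fF; rewrite -/BK; lra.
have [K0 HK0] := c_proper 0.
pose cm := \sum_(k <- K0) `|c k|.
have cm0 : 0 <= cm by apply: sumr_ge0.
have c_min g : - cm <= c g.
  have [cg|cg] := leP (c g) 0; last by lra.
  by move/HK0/(abs_sum_bound c): cg; rewrite ler_norml -/cm => /andP[].
pose cM := \sum_(f <- F) `|c (f * w)%g|.
have cM0 : 0 <= cM by apply: sumr_ge0.
have c_max f : f \in F -> c (f * w)%g <= cM.
  move=> fF; have := abs_sum_bound (fun f => c (f * w)%g) fF; rewrite -/cM.
  by have := ler_norm (c (f * w)%g); lra.
have [Kc HKc] := c_proper (3 * C + cM + cm).
pose f1 g := phi g^-1%g w; pose u g := (f1 g * w)%g.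
pose f2 g q := phi (g * u g)^-1%g q.
pose m g q := (g * (u g * (f2 g q * q)))%g.
have f1F g : f1 g \in F by have [] := Hphi g^-1%g w.
have f2F g q : f2 g q \in F by have [] := Hphi (g * u g)^-1%g q.
have pre_gu g : prefix_at d (10 * eta) g (g * u g)%g.
  by rewrite /prefix_at mulKg; have [] := Hphi g^-1%g w.
have pre_m g q : prefix_at d (10 * eta) (g * u g)%g (m g q).
  by rewrite /prefix_at /m (mulgA g (u g)) mulKg; have [] := Hphi (g * u g)^-1%g q.
have pre_g g q : prefix_at d (9 * eta) g (m g q).
  rewrite (_ : 9 * eta = 10 * eta - eta); last by ring.
  apply: (prefix_at_trans d_sym d_tri HK (pre_gu g) (pre_m g q)); rewrite ?mulKg; try lra.
    exact: fwK.
  by rewrite Ksym fwK.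
pose T p := N <= `|D p|.
pose Ku := K ++ [seq (f * w * k)%g | f <- F, k <- K] ++ Kc.
have key g1 g2 z : avoids T g1 -> avoids T g2 -> prefix_at d (8 * eta) g1 g2 ->
    prefix_at d (10 * eta) (g1 * u g1)%g z -> prefix_at d (9 * eta) g2 z ->
    (g1^-1 * g2)%g \in Ku.
  move=> av1 av2 g12 pz1 pz2; rewrite !mem_cat.
  have [k2|nk2] := boolP ((g1 * u g1)^-1 * g2 \in K)%g.
    apply/orP; right; apply/orP; left; apply/allpairsP.
    exists (f1 g1, ((g1 * u g1)^-1 * g2)%g); split => //=.
    by rewrite -/(u g1) invgM -(mulgA (u g1)^-1%g) mulVKg.
  have pz1' : prefix_at d (9 * eta) (g1 * u g1)%g z by apply: prefix_at_le pz1; lra.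
  have small g g' : avoids T g' -> prefix_at d (8 * eta) g g' -> `|D g| < N.
    move=> av pre; rewrite ltNge; apply/negP => /av; apply.
    by apply: prefix_at_le pre; lra.
  have Dg1 : `|D g1| < N by exact: small g12.
  have addu : eta <= d g1^-1%g (u g1).
    by have := pre_gu g1; rewrite /prefix_at mulKg; lra.
  have [A1 B1 C1] := HC _ _ addu.
  have := prefix_at_linear d_sym d_tri HK pz1' pz2 nk2.
  rewrite (_ : 9 * eta - eta = 8 * eta); last by ring.
  case=> [g12'|g21].
    have Dgu := small _ _ av2 g12'.
    have : `|D (u g1)| <= 2 * N + 2 * C.
      move: A1 B1 Dg1 Dgu; rewrite /D !ler_norml !ltr_norml.
      move=> /andP[? ?] /andP[? ?] /andP[? ?] /andP[? ?].
      by apply/andP; split; lra.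
    by have := Dw _ (f1F g1); rewrite -/(u g1); lra.
  apply/orP; right; apply/orP; right; apply: HKc.
  have [|_ _ C2] := HC g2 (g2^-1 * (g1 * u g1))%g.
    by move: g21; rewrite /prefix_at; lra.
  have [|_ _ C3] := HC g1 (g1^-1 * g2)%g.
    by move: g12; rewrite /prefix_at; lra.
  move: C1 C2 C3; rewrite !mulVKg !ler_norml => /andP[? ?] /andP[? ?] /andP[? ?].
  have := c_min (g2^-1 * (g1 * u g1))%g; have := c_max _ (f1F g1); rewrite -/(u g1).
  by lra.
pose Ku2 := Ku ++ map (fun x => x^-1)%g Ku.
have fib g1 g2 q1 q2 : avoids T g1 -> avoids T g2 -> m g1 q1 = m g2 q2 ->
    (g1^-1 * g2)%g \in Ku2.
  move=> av1 av2 mE; rewrite mem_cat.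
  have P1 := pre_g g1 q1; have P2 := pre_g g2 q2; rewrite -mE in P2.
  have [/(prefix_at_linear d_sym d_tri HK P1 P2)|] := boolP ((g1^-1 * g2)%g \notin K).
    rewrite (_ : 9 * eta - eta = 8 * eta); last by ring.
    case=> [g12|g21].
      by rewrite (key _ _ _ av1 av2 g12 (pre_m g1 q1) P2).
    have := key _ _ _ av2 av1 g21; move: (pre_m g2 q2); rewrite -mE.
    move=> H /(_ _ H P1)/(map_f (fun x => x^-1)%g).
    by rewrite invgM invgK => ->; rewrite orbT.
  by rewrite negbK /Ku !mem_cat => ->.
have E0 : 0 <= 2 * C + cM + CF by lra.
exists (expR (2 * (2 * C + cM + CF)) * (size Ku2 * size F * size F)%:R) => s s1 s2.
apply: (@sum_insertion R G _ (avoids T) m _ _ 1%g) => //.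
- exact: c_sum.
- by move=> g; exact: expR_gt0.
- move=> g q av; apply: insertion_weight => //.
  have [|_ _ C1] := HC g (u g).
    by have := pre_gu g; rewrite /prefix_at mulKg; lra.
  have [|_ _ C2] := HC (g * u g)%g (f2 g q * q)%g.
    by have := pre_m g q; rewrite /prefix_at /m (mulgA g (u g)) mulKg; lra.
  have [_ _ C3] := HCF _ q (f2F g q); have := c_max _ (f1F g); rewrite -/(u g).
  move: C1 C2 C3; rewrite /m !mulgA !ler_norml => /andP[? ?] /andP[? ?] /andP[? ?].
  by lra.
move=> g q av.
exists [seq ((g * z.1.1)%g, (z.2^-1 * ((z.1.2 * w)^-1 * ((g * z.1.1)^-1 * m g q)))%g) |
  z : (G * G) * G <- [seq (e, f) | e <- [seq (k, f) | k <- Ku2, f <- F], f <- F]].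
rewrite size_map !size_allpairs; split=> // g' q' av' mE.
apply/mapP; exists ((g^-1 * g')%g, f1 g', f2 g' q').
  apply/allpairsP; exists ((g^-1 * g')%g, f1 g', f2 g' q'); split=> //=.
  apply/allpairsP; exists ((g^-1 * g')%g, f1 g'); split=> //=.
  exact: fib av av' (esym mE).
by rewrite /= mulVKg -mE /m !mulKg.
Qed.

Let argmin_seq (P : G -> Prop) : (exists p, P p) ->
  exists p, P p /\ forall p', P p' -> c p <= c p'.
Proof.
move=> [p0 P0]; have [K HK] := c_proper (c p0).
suff [p [Pp Hp]] : exists p, P p /\ forall p', p' \in p0 :: K -> P p' -> c p <= c p'.
  exists p; split=> // p' Pp'; have [/HK p'K|/ltW] := leP (c p') (c p0).
    by apply: Hp; rewrite // inE p'K orbT.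
  by apply: le_trans; apply: Hp; rewrite // mem_head.
elim: K {HK} => [|k K [p [Pp Hp]]].
  by exists p0; split=> // p'; rewrite inE => /eqP ->.
have [[Pk kp]|nk] := pselect (P k /\ c k <= c p).
  exists k; split=> // p'; rewrite !inE => /or3P[/eqP->|/eqP->//|p'K] Pp'.
    by apply: le_trans kp _; apply: Hp; rewrite // mem_head.
  by apply: le_trans kp _; apply: Hp; rewrite // inE p'K orbT.
exists p; split=> // p'; rewrite !inE => /or3P[/eqP->|/eqP->|p'K] Pp'.
- by apply: Hp; rewrite // mem_head.
- by rewrite leNgt; apply/negP => /ltW kp; apply: nk.
- by apply: Hp; rewrite // inE p'K orbT.
Qed.

(** If D g >= 0 then b g = c g - lam D g, otherwise a g = c g - (1 - lam) |D g|: one of a and b lies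
    below c by at least mu N. *)
Let tilt (mu N s : R) (g : G) : 0 <= N -> 1 < s -> mu <= lam -> mu <= 1 - lam ->
  0 <= mu -> N <= `|D g| ->
  expR (mu * N) * expR (- (s * c g)) <= expR (- (s * a g)) + expR (- (s * b g)).
Proof.
move=> N0 s1 mul mul1 mu0 ND; rewrite -expRD.
have key (x : R) : 0 <= x -> mu * N <= x -> mu * N <= s * x.
  by move=> x0 H; apply: le_trans H _; rewrite ler_peMl // ltW.
have lm0 := lam0; have lm1 := lam1.
have [Dg|Dg] := leP 0 (D g).
  rewrite ger0_norm // in ND; apply: ler_wpDl; first exact: expR_ge0.
  rewrite ler_expR; have := key (lam * D g).
  have -> : - (s * b g) = - (s * c g) + s * (lam * D g) by rewrite /c /D; ring.
  move=> H; rewrite addrC lerD2l; apply: H; first by apply: mulr_ge0 => //; exact: ltW.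
  exact: ler_pM.
rewrite ltr0_norm // in ND; apply: ler_wpDr; first exact: expR_ge0.
rewrite ler_expR; have := key ((1 - lam) * - D g).
have -> : - (s * a g) = - (s * c g) + s * ((1 - lam) * - D g) by rewrite /c /D; ring.
move=> H; rewrite addrC lerD2l; apply: H; last by exact: ler_pM.
by apply: mulr_ge0; lra.
Qed.

(** Renewal: for 1 < s <= 2, let S be the supremum of the finite sums of e^(-s c). Cutting at first
    prefixes bounds the elements having one by S / 2, and [avoiding_sums] bounds the others by C2,
    so S <= 2 C2 uniformly in s. *)
Theorem bounded_sums_of_unbounded_difference :
  (forall M : R, exists w, M < `|a w - b w|) ->
  bounded_sums (fun g => expR (- (lam * a g + (1 - lam) * b g))).
Proof.
move=> unb; have lm0 := lam0; have lm1 := lam1; have e0 := eta0.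
have [C1 [C10 HC1]] := first_prefix_sums; have [C [C0 HC]] := common.
pose mu := Num.min lam (1 - lam).
have mu0 : 0 < mu by rewrite /mu lt_min lam0 subr_gt0.
have mul : mu <= lam by rewrite /mu ge_min lexx.
have mul1 : mu <= 1 - lam by rewrite /mu ge_min lexx orbT.
pose E := expR (2 * C); have Egt0 : 0 < E by exact: expR_gt0.
(* E bounds the error of cutting g at its prefix. This N makes e^(mu N) exceed 4 C1 E, so that E
   times the sum over first prefixes is at most 1 / 2. *)
pose N := 4 * C1 * E / mu.
have N0 : 0 <= N by rewrite /N divr_ge0 ?mulr_ge0 // ltW.
have muN : 4 * C1 * E < expR (mu * N).
  have -> : mu * N = 4 * C1 * E by rewrite /N mulrC divfK // gt_eqF.
  by apply: lt_le_trans (expR_ge1Dx _); lra.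
have [C2 HC2] := avoiding_sums N unb.
pose T p := N <= `|D p|.
have /choice[pr Hpr] : forall g, exists q, (exists p, T p /\ prefix_at d (5 * eta) p g) ->
    [/\ T q, prefix_at d (5 * eta) q g &
      forall p', T p' -> prefix_at d (5 * eta) p' g -> c q <= c p'].
  move=> g.
  have [/argmin_seq[p [[Tp pg] min]]|no] :=
      pselect (exists p, T p /\ prefix_at d (5 * eta) p g); last by exists 1%g.
  by exists p => _; split=> // p' Tp' pg'; exact: min.
have first_sum s X : 1 < s -> s <= 2 -> uniq X -> (forall x, x \in X -> first_prefix T x) ->
    2 * E * \sum_(x <- X) expR (- (s * c x)) <= 1.
  move=> s1 s2 uX XS; have [Ha Hb] := HC1 T s s1 s2 X uX XS.
  suff H : expR (mu * N) * \sum_(x <- X) expR (- (s * c x)) <= 2 * C1.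
    have X0 : 0 <= \sum_(x <- X) expR (- (s * c x)) by apply: sumr_ge0 => *; exact: expR_ge0.
    have [C1z|C1p] := eqVneq C1 0.
      have : \sum_(x <- X) expR (- (s * c x)) <= 0.
        by rewrite -(pmulr_rle0 _ (expR_gt0 (mu * N))); apply: le_trans H _; rewrite C1z mulr0.
      rewrite -(pmulr_rle0 _ (mulr_gt0 (ltr0Sn R 1) Egt0)) => Hs.
      by apply: le_trans Hs _; exact: ler01.
    have C1pos : 0 < C1 by rewrite lt_neqAle eq_sym C1p.
    rewrite -(ler_pM2l (mulr_gt0 (ltr0Sn R 1) C1pos)) mulr1.
    apply: le_trans H; rewrite mulrA; apply: ler_wpM2r => //.
    by apply: le_trans (ltW muN); rewrite le_eqVlt; apply/orP; left; apply/eqP; ring.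
  apply: (@le_trans _ _ (\sum_(x <- X) (expR (- (s * a x)) + expR (- (s * b x))))).
    rewrite mulr_sumr [leLHS]big_seq [leRHS]big_seq; apply: ler_sum => x /XS [Tx _].
    by apply: tilt => //; exact: ltW.
  by rewrite big_split /=; lra.
have split_le s g : 1 < s -> s <= 2 -> (exists p, T p /\ prefix_at d (5 * eta) p g) ->
    expR (- (s * c g)) <=
      E * (expR (- (s * c (pr g))) * expR (- (s * c ((pr g)^-1 * g)%g))).
  move=> s1 s2 /Hpr[_ pg _]; rewrite /E -!expRD ler_expR.
  have [|_ _] := HC (pr g) ((pr g)^-1 * g)%g; first by move: pg; rewrite /prefix_at; lra.
  rewrite mulVKg ler_norml => /andP[H _].
  set x := c (pr g) in H *; set y := c ((pr g)^-1 * g)%g in H *; set z := c g in H *.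
  have s0 : 0 <= s by lra.
  have H1 : s * (x + y - z) <= s * C by rewrite ler_wpM2l //; lra.
  have H2 : s * C <= 2 * C by rewrite ler_wpM2r.
  by rewrite -subr_ge0 (_ : _ - _ = 2 * C - s * (x + y - z)); [lra|ring].
have C20 : 0 <= C2.
  by have := HC2 (3 / 2) _ _ [::] isT; rewrite big_nil; apply => //; lra.
have bnd s X : 1 < s -> s <= 2 -> uniq X -> \sum_(x <- X) expR (- (s * c x)) <= 2 * C2.
  move=> s1 s2; pose w g := expR (- (s * c g)).
  have w0 g : 0 <= w g by exact: expR_ge0.
  (* For s > 1 the supremum is finite by [c_sum], so it may be subtracted from both sides; only the
     resulting bound 2 C2 is uniform in s. *)
  pose S := [set r : R | exists2 Y : seq G, uniq Y & r = \sum_(y <- Y) w y].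
  have ubS : has_ubound S by have [B HB] := c_sum s1; exists B => _ [Y uY ->]; exact: HB.
  have leS Y : uniq Y -> \sum_(y <- Y) w y <= sup S.
    by move=> uY; apply: ub_le_sup => //; exists Y.
  have S0 : 0 <= sup S by have := leS [::] isT; rewrite big_nil.
  suff : sup S <= C2 + sup S / 2 by move=> H uX; apply: le_trans (leS X uX) _; lra.
  apply: ge_sup; first by exists (\sum_(y <- [::]) w y); exists [::].
  move=> _ [Y uY ->]; pose av g : bool := `[< avoids T g >].
  rewrite (bigID av) /= -(big_filter Y av) -(big_filter Y (fun g => ~~ av g)).
  apply: lerD.
    apply: HC2 => //; first by rewrite filter_uniq.
    by move=> x; rewrite mem_filter => /andP[/asboolP].
  set Z := [seq g <- Y | ~~ av g]; have ZT g : g \in Z -> exists p, T p /\ prefix_at d (5 * eta) p g.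
    rewrite mem_filter /= => /andP[/asboolPn H _]; apply: contrapT => no; apply: H => p Tp pg.
    by apply: no; exists p.
  apply: (@le_trans _ _ (\sum_(g <- Z) E * (w (pr g) * w ((pr g)^-1 * g)%g))).
    rewrite [leLHS]big_seq [leRHS]big_seq; apply: ler_sum => g /ZT; exact: split_le.
  (* An element is recovered from its first prefix and the remainder, so the sum over Z is at most
     the product of the sum over prefixes and the sum over remainders. *)
  pose P1 := undup (map pr Z); pose P2 := undup (map (fun g => (pr g)^-1 * g)%g Z).
  have PS : 2 * E * \sum_(x <- P1) w x <= 1.
    apply: first_sum => //; first exact: undup_uniq.
    move=> x; rewrite mem_undup => /mapP[g /ZT/Hpr[Tg pg min] ->].
    by split=> //; exists g.
  have : \sum_(g <- Z) w (pr g) * w ((pr g)^-1 * g)%g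
      <= (\sum_(x <- P1) w x) * (\sum_(x <- P2) w x).
    rewrite big_distrlr /= -(big_allpairs (F := fun z : G * G => w z.1 * w z.2)).
    rewrite -(big_map (fun g => (pr g, (pr g)^-1 * g)%g) xpredT (fun z => w z.1 * w z.2)).
    apply: ler_sum_subset => //.
    - by move=> z; rewrite mulr_ge0.
    - rewrite map_inj_uniq ?filter_uniq // => g g' [-> /mulgI]; exact.
    - by apply: allpairs_uniq; rewrite ?undup_uniq // => -[? ?] [? ?].
    move=> z /mapP[g gZ ->]; apply/allpairsP; exists (pr g, (pr g)^-1 * g)%g.
    by split=> //=; rewrite mem_undup; apply/mapP; exists g.
  have L2 : \sum_(x <- P2) w x <= sup S by apply: leS; exact: undup_uniq.
  rewrite -mulr_sumr => H.
  have P10 : 0 <= \sum_(x <- P1) w x by apply: sumr_ge0.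
  have H2 : E * \sum_(g <- Z) w (pr g) * w ((pr g)^-1 * g)%g
      <= E * ((\sum_(x <- P1) w x) * sup S).
    by apply: ler_wpM2l; [exact: ltW|apply: le_trans H _; exact: ler_wpM2l].
  apply: le_trans H2 _; rewrite mulrA; have := ler_wpM2r S0 PS; lra.
exists (2 * C2 * expR 1) => X uX.
pose M := \sum_(x <- X) `|c x|; have M0 : 0 <= M by apply: sumr_ge0.
(* For this s, (s - 1) c x <= 1 on the finite list X, so passing from s to 1 costs a factor e
   only. *)
pose s := 1 + (M + 1)^-1.
have M1 : 0 < M + 1 by lra.
have i0 : 0 < (M + 1)^-1 by rewrite invr_gt0.
have i1 : (M + 1)^-1 <= 1 by rewrite invf_le1 //; lra.
have s1 : 1 < s by rewrite /s; lra.
have s2 : s <= 2 by rewrite /s; lra.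
apply: (@le_trans _ _ ((\sum_(x <- X) expR (- (s * c x))) * expR 1)); last first.
  by apply: ler_wpM2r; [exact: expR_ge0|exact: bnd].
rewrite mulr_suml [leLHS]big_seq [leRHS]big_seq; apply: ler_sum => x xX.
rewrite -expRD ler_expR -/(c x).
have cM : c x <= M by apply: le_trans (ler_norm _) _; exact: abs_sum_bound.
have : (M + 1)^-1 * c x <= 1.
  by rewrite mulrC ler_pdivrMr // mul1r; lra.
by rewrite /s; lra.
Qed.

End Renewal.

(** * Minors and singular values *)

Section ScalarNorm.
Variables (R : realType) (b : base_field).
Local Notation K := (scalars R b).
Local Notation conj := (@conj_scalar R b).
Local Notation ofR := (@of_real R b).
Implicit Types (x y z : K).

Fact conj_scalar_zmod : zmod_morphism conj.
Proof. case: b => // x y; exact: (rmorphB (@conjc R)). Qed.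
HB.instance Definition _ := GRing.isZmodMorphism.Build K K conj conj_scalar_zmod.
Fact conj_scalar_monoid : monoid_morphism conj.
Proof. case: b => //; split=> [|x y]; [exact: (rmorph1 (@conjc R))|exact: (rmorphM (@conjc R))]. Qed.
HB.instance Definition _ := GRing.isMonoidMorphism.Build K K conj conj_scalar_monoid.

Fact of_real_zmod : zmod_morphism ofR.
Proof. case: b => // x y; exact: (rmorphB (real_complex R)). Qed.
HB.instance Definition _ := GRing.isZmodMorphism.Build R K ofR of_real_zmod.
Fact of_real_monoid : monoid_morphism ofR.
Proof.
case: b => //; split=> [|x y]; first exact: (rmorph1 (real_complex R)).
exact: (rmorphM (real_complex R)).
Qed.
HB.instance Definition _ := GRing.isMonoidMorphism.Build R K ofR of_real_monoid.

Lemma conj_scalarK x : conj (conj x) = x.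
Proof. by move: x; case: b => // x; exact: conjcK. Qed.

(* The norm of K as a numFieldType takes its values in K. *)
Definition rnorm : K -> R :=
  match b return scalars R b -> R with
  | RealField => fun u => `|u : R|
  | ComplexField => fun u => Normc.normc u
  end.

Lemma normr_rnorm x : `|x| = ofR (rnorm x).
Proof. by rewrite /rnorm; move: x; case: b. Qed.

Lemma of_real_le (u v : R) : (ofR u <= ofR v) = (u <= v).
Proof. by case: b => //; exact: lecR. Qed.

Lemma of_real_lt (u v : R) : (ofR u < ofR v) = (u < v).
Proof. by case: b => //; exact: ltcR. Qed.

Lemma of_real_inj : injective ofR.
Proof. by case: b => //; exact: complexI. Qed.

Lemma pos_of_real x : 0 < x -> exists2 e : R, 0 < e & x = ofR e.
Proof.
move: x; case: b => [x x0|]; first by exists x.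
move=> /= x x0; have xr : (complex.Re x)%:C%C = x by apply: RRe_real; exact: gtr0_real.
by exists (complex.Re x); [rewrite -ltcR xr|].
Qed.

Lemma rnorm_ge0 x : 0 <= rnorm x.
Proof. by rewrite -of_real_le -normr_rnorm rmorph0. Qed.

Lemma rnormM x y : rnorm (x * y) = rnorm x * rnorm y.
Proof.
apply: of_real_inj; rewrite -normr_rnorm normrM rmorphM /= -!normr_rnorm. by []. Qed.

Lemma rnormD x y : rnorm (x + y) <= rnorm x + rnorm y.
Proof. by rewrite -of_real_le rmorphD /= -!normr_rnorm ler_normD. Qed.

Lemma rnormN x : rnorm (- x) = rnorm x.
Proof. by apply: of_real_inj; rewrite -!normr_rnorm normrN. Qed.

Lemma rnormB x y : rnorm (x - y) = rnorm (y - x).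
Proof. by rewrite -rnormN opprB. Qed.

Lemma rnorm_of_real (u : R) : rnorm (ofR u) = `|u|.
Proof.
by rewrite /rnorm /of_real; case: b => //=; rewrite expr0n addr0 sqrtr_sqr.
Qed.

Lemma rnorm0 : rnorm 0 = 0.
Proof. by rewrite -(rmorph0 ofR) rnorm_of_real normr0. Qed.

Lemma rnorm1 : rnorm 1 = 1.
Proof. by rewrite -(rmorph1 ofR) rnorm_of_real normr1. Qed.

Lemma rnorm_nat (m : nat) : rnorm m%:R = m%:R.
Proof. by rewrite -(rmorph_nat ofR) rnorm_of_real normr_nat. Qed.

Lemma rnorm_eq0 x : (rnorm x == 0) = (x == 0).
Proof. by rewrite -(inj_eq of_real_inj) -normr_rnorm rmorph0 normr_eq0. Qed.

Lemma rnorm_gt0 x : (0 < rnorm x) = (x != 0).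
Proof. by rewrite lt_neqAle rnorm_ge0 andbT eq_sym rnorm_eq0. Qed.

Lemma mulr_conj x : x * conj x = ofR (rnorm x ^+ 2).
Proof.
rewrite rmorphXn /= -normr_rnorm; move: x; case: b => x /=.
  by rewrite real_normK ?num_real // expr2.
by rewrite sqr_normc.
Qed.

Lemma rnorm_conj x : rnorm (conj x) = rnorm x.
Proof.
apply/eqP; rewrite -(eqrXn2 (n := 2)) ?rnorm_ge0 //; apply/eqP.
by apply: of_real_inj; rewrite -!mulr_conj conj_scalarK mulrC.
Qed.

Lemma rnormX x (m : nat) : rnorm (x ^+ m) = rnorm x ^+ m.
Proof. by elim: m => [|m IH]; rewrite ?expr0 ?rnorm1 // !exprS rnormM IH. Qed.

Lemma rnormV x : rnorm x^-1 = (rnorm x)^-1.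
Proof. by apply: of_real_inj; rewrite fmorphV /= -!normr_rnorm normfV. Qed.

Lemma rnorm_sum (I : Type) (r : seq I) (P : pred I) (f : I -> K) :
  rnorm (\sum_(i <- r | P i) f i) <= \sum_(i <- r | P i) rnorm (f i).
Proof.
elim/big_rec2: _ => [|i u v _ H]; first by rewrite rnorm0.
by apply: le_trans (rnormD _ _) _; rewrite lerD2l.
Qed.

Lemma rnorm_prod (I : Type) (r : seq I) (P : pred I) (f : I -> K) :
  rnorm (\prod_(i <- r | P i) f i) = \prod_(i <- r | P i) rnorm (f i).
Proof. by elim/big_rec2: _ => [|i u v _ <-]; rewrite ?rnorm1 ?rnormM. Qed.

Lemma cvg_rnormP (T : Type) (F : set_system T) {FF : Filter F} (f : T -> K) (l : K) :
  f x @[x --> F] --> l <-> forall e : R, 0 < e -> \forall x \near F, rnorm (f x - l) < e.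
Proof.
split=> [/cvgrPdist_lt H e e0|H].
  have := H (ofR e); rewrite -(rmorph0 ofR) of_real_lt => /(_ e0).
  by apply: filterS => x; rewrite normr_rnorm of_real_lt rnormB.
apply/cvgrPdist_lt => e /pos_of_real[e' e0 ->].
by apply: filterS (H e' e0) => x; rewrite normr_rnorm of_real_lt rnormB.
Qed.

Lemma cvg_rnorm (T : Type) (F : set_system T) {FF : Filter F} (f : T -> K) (l : K) :
  f x @[x --> F] --> l -> rnorm (f x) @[x --> F] --> rnorm l.
Proof.
move=> /cvg_rnormP H; apply/cvgrPdist_lt => e /H; apply: filterS => x.
apply: le_lt_trans; rewrite ler_norml; apply/andP; split.
  have := rnormD (f x - l) l; rewrite subrK; lra.
have := rnormD (l - f x) (f x); rewrite subrK (rnormB l); lra.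
Qed.

Lemma cvg_conj (T : Type) (F : set_system T) {FF : Filter F} (f : T -> K) (l : K) :
  f x @[x --> F] --> l -> conj (f x) @[x --> F] --> conj l.
Proof.
move=> /cvg_rnormP H; apply/cvg_rnormP => e /H; apply: filterS => x.
by rewrite -rmorphB /= rnorm_conj.
Qed.

Lemma cvg_sumr (T I : Type) (F : set_system T) {FF : Filter F} (r : seq I) (P : pred I)
    (f : I -> T -> K) (l : I -> K) :
  (forall i, P i -> f i x @[x --> F] --> l i) ->
  \sum_(i <- r | P i) f i x @[x --> F] --> \sum_(i <- r | P i) l i.
Proof. by move=> H; apply: cvg_big => //; exact: add_continuous. Qed.

Lemma cvg_prodr (T I : Type) (F : set_system T) {FF : Filter F} (r : seq I) (P : pred I)
    (f : I -> T -> K) (l : I -> K) :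
  (forall i, P i -> f i x @[x --> F] --> l i) ->
  \prod_(i <- r | P i) f i x @[x --> F] --> \prod_(i <- r | P i) l i.
Proof. by move=> H; apply: cvg_big => //; exact: mul_continuous. Qed.

Lemma cvg_det (T : Type) (F : set_system T) {FF : Filter F} (k : nat)
    (M : T -> 'M[K]_k) (A : 'M[K]_k) :
  (forall i j, M x i j @[x --> F] --> A i j) ->
  \det (M x) @[x --> F] --> \det A.
Proof.
move=> H; rewrite /determinant; apply: cvg_sumr => s _.
apply: cvgM; first exact: cvg_cst.
by apply: cvg_prodr => i _.
Qed.

Lemma cvg_mx (T : Type) (F : set_system T) {FF : Filter F} (m k : nat)
    (M : T -> 'M[K]_(m, k)) (A : 'M[K]_(m, k)) :
  (forall i j, M x i j @[x --> F] --> A i j) -> M x @[x --> F] --> A.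
Proof.
move=> H V [P HP sub]; apply: filterS (sub) _.
apply: filter_forall => i; apply: filter_forall => j; exact: H (HP i j).
Qed.

End ScalarNorm.

(** * Convergent subsequences of bounded scalars *)

Section Subsequences.
Variable R : realType.

Lemma mono_leq_geq_id (f : nat -> nat) : {mono f : p q / (p <= q)%N} -> forall m, (m <= f m)%N.
Proof.
move=> fi; elim=> // q IH; apply: leq_ltn_trans IH _.
by rewrite ltnNge fi -ltnNge.
Qed.

Lemma mono_leq_cvg_oo (f : nat -> nat) : {mono f : p q / (p <= q)%N} -> f m @[m --> \oo] --> \oo.
Proof.
move=> fi; apply/cvgnyPge => A; exists A => // m /= Am; apply: leq_trans Am _.
exact: mono_leq_geq_id.
Qed.

Lemma bounded_scalar_subseq (b : base_field) (u : nat -> scalars R b) (B : R) :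
  (forall m, rnorm (u m) <= B) ->
  exists2 f : nat -> nat, {mono f : p q / (p <= q)%N}
    & exists l : scalars R b, u (f m) @[m --> \oo] --> l.
Proof.
have real_case (v : nat -> R) C : (forall m, `|v m| <= C) ->
    exists2 f : nat -> nat, {mono f : p q / (p <= q)%N}
    & exists l : R, v (f m) @[m --> \oo] --> l.
  move=> vC; have [|f fi /cvg_ex[l fl]] := @bolzano_weierstrass R v.
    exists C; split; first exact: num_real.
    by move=> M CM m _; exact: le_trans (vC m) (ltW CM).
  by exists f => //; exists l.
move: u; case: b => u uB; first exact: (real_case u B).
have nB m : `|complex.Re (u m)| <= B /\ `|complex.Im (u m)| <= B.
  have := uB m; rewrite /rnorm; case: (u m) => p q /= H.
  have pB : p ^+ 2 <= p ^+ 2 + q ^+ 2 by rewrite lerDl sqr_ge0.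
  have qB : q ^+ 2 <= p ^+ 2 + q ^+ 2 by rewrite lerDr sqr_ge0.
  have S0 : 0 <= p ^+ 2 + q ^+ 2 by apply: le_trans pB; exact: sqr_ge0.
  by split; apply: le_trans H; rewrite -sqrtr_sqr ler_sqrt.
have [f fi [l fl]] := real_case _ B (fun m => (nB m).1).
have [h hi [l' hl]] := real_case _ B (fun m => (nB (f m)).2).
exists (f \o h); first by move=> p q /=; rewrite fi hi.
exists (l +i* l')%C; apply/(@cvg_rnormP R ComplexField) => e e0.
have e2 : 0 < e / 2 by lra.
have fl' : complex.Re (u (f (h m))) @[m --> \oo] --> l.
  exact: (cvg_comp _ _ (mono_leq_cvg_oo hi) fl).
near=> m.
have H1 : `|complex.Re (u (f (h m))) - l| < e / 2.
  by near: m; move/cvgrPdist_lt: fl' => /(_ _ e2); apply: filterS => m; rewrite distrC.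
have H2 : `|complex.Im (u (f (h m))) - l'| < e / 2.
  by near: m; move/cvgrPdist_lt: hl => /(_ _ e2); apply: filterS => m; rewrite distrC.
move: H1 H2; rewrite /rnorm /=; case: (u (f (h m))) => p q /= H1 H2.
apply: (@le_lt_trans _ _ (`|p - l| + `|q - l'|)); last by lra.
rewrite -[leRHS]ger0_norm ?addr_ge0 // -[leRHS]sqrtr_sqr ler_sqrt ?sqr_ge0 //.
rewrite -[(p - l) ^+ 2]real_normK ?num_real // -[(q - l') ^+ 2]real_normK ?num_real //.
have := mulr_ge0 (normr_ge0 (p - l)) (normr_ge0 (q - l')); rewrite sqrrD; lra.
Unshelve. all: by end_near. Qed.

Lemma bounded_family_subseq (b : base_field) (I : finType) (u : nat -> I -> scalars R b) (B : R) :
  (forall m i, rnorm (u m i) <= B) ->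
  exists2 f : nat -> nat, {mono f : p q / (p <= q)%N}
    & exists l : I -> scalars R b, forall i, u (f m) i @[m --> \oo] --> l i.
Proof.
move=> uB.
suff [f fi [l fl]] : exists2 f : nat -> nat, {mono f : p q / (p <= q)%N}
    & exists l : I -> scalars R b, forall i, i \in enum I -> u (f m) i @[m --> \oo] --> l i.
  by exists f => //; exists l => i; apply: fl; rewrite mem_enum.
elim: (enum I) => [|i s [f fi [l fl]]]; first by exists id => //; exists (fun=> 0).
have [h hi [l' hl]] := bounded_scalar_subseq (fun m => uB (f m) i).
exists (f \o h); first by move=> p q /=; rewrite fi hi.
exists (fun j => if j == i then l' else l j) => j; rewrite inE.
have [-> _|_ /= js] := eqVneq j i; first exact: hl.
exact: (cvg_comp _ _ (mono_leq_cvg_oo hi) (fl j js)).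
Qed.

End Subsequences.

(** * Minors and the Cauchy-Binet formula *)

Section CauchyBinet.
Variables (F : comNzRingType).

Lemma det_mulmx_sum (k d : nat) (A : 'M[F]_(k, d)) (B : 'M[F]_(d, k)) :
  \det (A *m B) =
    \sum_(h : {ffun 'I_k -> 'I_d}) (\prod_i A i (h i)) * \det (rowsub h B).
Proof.
rewrite {1}/determinant.
transitivity (\sum_(s : 'S_k) \sum_(h : {ffun 'I_k -> 'I_d})
    (-1) ^+ s * \prod_i (A i (h i) * B (h i) (s i))).
  apply: eq_bigr => s _; rewrite -big_distrr /=; congr (_ * _).
  rewrite -(bigA_distr_bigA (fun i j => A i j * B j (s i))) /=.
  by apply: eq_bigr => i _; rewrite mxE.
rewrite exchange_big; apply: eq_bigr => h _ /=.
rewrite /determinant big_distrr /=; apply: eq_bigr => s _.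
rewrite big_split /= mulrCA; congr (_ * (_ * _)).
by apply: eq_bigr => i _; rewrite mxE.
Qed.

(** Write [det_mulmx_sum] once for each permutation s, with h precomposed by s: the minor of B
    acquires the sign of s, and the products of entries of A add up to a determinant. *)
Lemma Cauchy_Binet (k d : nat) (A : 'M[F]_(k, d)) (B : 'M[F]_(d, k)) :
  k`!%:R * \det (A *m B) =
    \sum_(h : {ffun 'I_k -> 'I_d}) \det (colsub h A) * \det (rowsub h B).
Proof.
transitivity (\sum_(s : 'S_k) \sum_(h : {ffun 'I_k -> 'I_d})
    ((-1) ^+ s * \prod_i A i (h (s i))) * \det (rowsub h B)).
  rewrite mulr_natl -card_Sn -sumr_const; apply: eq_bigr => s _.
  rewrite det_mulmx_sum.
  pose c (t : 'S_k) (h : {ffun 'I_k -> 'I_d}) := [ffun i => h (t i)].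
  have cK t : cancel (c t) (c t^-1%g).
    by move=> h; apply/ffunP => i; rewrite !ffunE permKV.
  rewrite (reindex (c s)); last first.
    by exists (c s^-1%g) => h _; [exact: cK|have := cK s^-1%g h; rewrite invgK].
  apply: eq_bigr => h _.
  have -> : rowsub (c s h) B = row_perm s (rowsub h B).
    by apply/matrixP => i j; rewrite !mxE ffunE.
  rewrite row_permE det_mulmx det_perm mulrA [_ * (-1) ^+ s]mulrC.
  by congr (_ * _ * _); apply: eq_bigr => i _; rewrite ffunE.
rewrite exchange_big; apply: eq_bigr => h _ /=.
rewrite -big_distrl /=; congr (_ * _); apply: eq_bigr => s _.
by congr (_ * _); apply: eq_bigr => i _; rewrite mxE.
Qed.

(** Arbitrary maps replace subsets of indices: non-injective maps give 0 and each subset occurs k!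
    times, hence the factorials in what follows. *)
Definition minor (m d k : nat) (A : 'M[F]_(m, d)) (f : 'I_k -> 'I_m) (g : 'I_k -> 'I_d) : F :=
  \det (mxsub f g A).

Lemma minorM (m p d k : nat) (A : 'M[F]_(m, p)) (B : 'M[F]_(p, d))
    (f : 'I_k -> 'I_m) (g : 'I_k -> 'I_d) :
  k`!%:R * minor (A *m B) f g =
    \sum_(h : {ffun 'I_k -> 'I_p}) minor A f h * minor B h g.
Proof.
rewrite /minor mxsub_mul Cauchy_Binet; apply: eq_bigr => h _.
by congr (_ * _); rewrite /minor; congr (\det _); apply/matrixP => i j; rewrite !mxE.
Qed.

Lemma minorZ (m d k : nat) (c : F) (A : 'M[F]_(m, d)) (f : 'I_k -> 'I_m) (g : 'I_k -> 'I_d) :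
  minor (c *: A) f g = c ^+ k * minor A f g.
Proof. by rewrite /minor -detZ; congr (\det _); apply/matrixP => i j; rewrite !mxE. Qed.

Lemma minor_diagl (m d k : nat) (v : 'rV[F]_m) (A : 'M[F]_(m, d))
    (f : 'I_k -> 'I_m) (g : 'I_k -> 'I_d) :
  minor (diag_mx v *m A) f g = (\prod_l v 0 (f l)) * minor A f g.
Proof.
rewrite /minor; have -> : mxsub f g (diag_mx v *m A) = diag_mx (colsub f v) *m mxsub f g A.
  by apply/matrixP => i j; rewrite mxE !mul_diag_mx !mxE.
by rewrite det_mulmx det_diag; congr (_ * _); apply: eq_bigr => l _; rewrite mxE.
Qed.

Lemma minor_diagr (m d k : nat) (v : 'rV[F]_d) (A : 'M[F]_(m, d))
    (f : 'I_k -> 'I_m) (g : 'I_k -> 'I_d) :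
  minor (A *m diag_mx v) f g = minor A f g * \prod_l v 0 (g l).
Proof.
rewrite /minor; have -> : mxsub f g (A *m diag_mx v) = mxsub f g A *m diag_mx (colsub g v).
  by apply/matrixP => i j; rewrite mxE !mul_mx_diag !mxE.
by rewrite det_mulmx det_diag; congr (_ * _); apply: eq_bigr => l _; rewrite mxE.
Qed.

Lemma minor_tr (m d k : nat) (A : 'M[F]_(m, d)) (f : 'I_k -> 'I_m) (g : 'I_k -> 'I_d) :
  minor A^T g f = minor A f g.
Proof. by rewrite /minor -trmx_mxsub det_tr. Qed.

Lemma minor_noninj (m d k : nat) (A : 'M[F]_(m, d)) (f : 'I_k -> 'I_m) (g : 'I_k -> 'I_d) :
  ~ injective g -> minor A f g = 0.
Proof.
move/injectiveP/injectivePn => [i1 [i2 i12 e12]].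
rewrite /minor -det_tr (determinant_alternate i12) // => j.
by rewrite !mxE e12.
Qed.

Lemma minor_perm (m d k : nat) (A : 'M[F]_(m, d)) (f : 'I_k -> 'I_m) (g : 'I_k -> 'I_d)
    (s : 'S_k) :
  minor A f (g \o s) = (-1) ^+ s * minor A f g.
Proof.
rewrite -minor_tr -[minor A f g]minor_tr /minor -det_perm -det_mulmx -row_permE.
by congr (\det _); apply/matrixP => i j; rewrite !mxE.
Qed.

Lemma minor1_inj (m k : nat) (f : 'I_k -> 'I_m) : injective f -> minor (1%:M : 'M[F]_m) f f = 1.
Proof.
move=> fi; rewrite /minor -[RHS](det1 F k); congr (\det _).
by apply/matrixP => i j; rewrite !mxE (inj_eq fi).
Qed.

End CauchyBinet.

(** * Minors of a singular value decomposition *)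

Section SingularMinors.
Variables (R : realType) (b : base_field) (n : nat).
Local Notation K := (scalars R b).
Local Notation conj := (@conj_scalar R b).
Local Notation ofR := (@of_real R b).
Local Notation adj A := (map_mx conj A^T).

Lemma minor_adj (m d k : nat) (A : 'M[K]_(m, d)) (f : 'I_k -> 'I_m) (g : 'I_k -> 'I_d) :
  minor (adj A) g f = conj (minor A f g).
Proof. by rewrite -(minor_tr A) /minor -det_map_mx map_mxsub. Qed.

Lemma unitary_adjl (A : 'M[K]_n.+1) : unitary A -> adj A *m A = 1%:M.
Proof. exact: mulmx1C. Qed.

Lemma adjK (m d : nat) (A : 'M[K]_(m, d)) : adj (adj A) = A.
Proof. by apply/matrixP => i j; rewrite !mxE conj_scalarK. Qed.

Lemma unitary_adj (A : 'M[K]_n.+1) : unitary A -> unitary (adj A).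
Proof. by move=> uA; rewrite /unitary adjK; exact: unitary_adjl. Qed.

Lemma adj_mul (m d p : nat) (A : 'M[K]_(m, d)) (B : 'M[K]_(d, p)) :
  adj (A *m B) = adj B *m adj A.
Proof. by rewrite trmx_mul map_mxM. Qed.

Lemma unitary_mul (A B : 'M[K]_n.+1) : unitary A -> unitary B -> unitary (A *m B).
Proof.
move=> uA uB; rewrite /unitary adj_mul mulmxA -(mulmxA A) uB mulmx1; exact: uA.
Qed.

Lemma unitary_unit (A : 'M[K]_n.+1) : unitary A -> A \in unitmx.
Proof. by move=> uA; have [] := mulmx1_unit uA. Qed.

Lemma unitary_row (A : 'M[K]_n.+1) i : unitary A -> \sum_j rnorm (A i j) ^+ 2 = 1.
Proof.
move=> /matrixP /(_ i i); rewrite !mxE eqxx mulr1n => uA.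
apply: (@of_real_inj R b); rewrite rmorph1 -uA rmorph_sum.
by apply: eq_bigr => j _; rewrite !mxE mulr_conj.
Qed.

Lemma unitary_entry (A : 'M[K]_n.+1) i j : unitary A -> rnorm (A i j) <= 1.
Proof.
move=> uA; rewrite -(expr_le1 (n := 2)) ?rnorm_ge0 // -(unitary_row i uA).
by rewrite (bigD1 j) //= lerDl sumr_ge0 // => l _; rewrite sqr_ge0.
Qed.

Lemma rnorm_det_le (k : nat) (A : 'M[K]_k) (e : 'S_k -> R) :
  (forall s : 'S_k, \prod_i rnorm (A i (s i)) <= e s) -> rnorm (\det A) <= \sum_s e s.
Proof.
move=> H; apply: le_trans (rnorm_sum _ _ _) _; apply: ler_sum => s _.
by rewrite rnormM rnormX rnormN rnorm1 expr1n mul1r rnorm_prod.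
Qed.

Lemma rnorm_det_fact (k : nat) (A : 'M[K]_k) :
  (forall i j, rnorm (A i j) <= 1) -> rnorm (\det A) <= k`!%:R.
Proof.
move=> H; apply: (@le_trans _ _ (\sum_(s : 'S_k) 1)).
  by apply: rnorm_det_le => s; apply: prodr_ile1 => i _; rewrite rnorm_ge0 H.
by rewrite sumr_const card_Sn.
Qed.

Lemma minor_unitary_le (k : nat) (A : 'M[K]_n.+1) (f g : 'I_k -> 'I_n.+1) :
  unitary A -> rnorm (minor A f g) <= k`!%:R.
Proof. by move=> uA; apply: rnorm_det_fact => i j; rewrite mxE unitary_entry. Qed.

Definition inc (i : 'I_n) : 'I_i.+1 -> 'I_n.+1 := widen_ord (leqW (ltn_ord i)).

Lemma inc_ord_inj i : injective (@inc i).
Proof. by move=> l l' /(congr1 val) /= e; apply: val_inj. Qed.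

Definition vol (i : 'I_n) (s : 'rV[R]_n.+1) : R := \prod_(l < i.+1) s 0 (inc l).

(** Cauchy-Binet for adj A g = diag(s) B. In the exterior power, pairing g with its leading left
    singular vector gives [vol] times the leading right one; [svd_minor_right] is the mirror
    statement. *)
Lemma svd_minor_left (i : 'I_n) (g A B : 'M[K]_n.+1) s (f' : 'I_i.+1 -> 'I_n.+1) :
  is_svd g A s B ->
  \sum_(f : {ffun 'I_i.+1 -> 'I_n.+1}) conj (minor A f (@inc i)) * minor g f f' =
    i.+1`!%:R * ofR (vol i s) * minor B (@inc i) f'.
Proof.
case=> uA uB _ _ gE; under eq_bigr do rewrite -minor_adj.
rewrite -minorM gE !mulmxA unitary_adjl // mul1mx minor_diagl -mulrA; congr (_ * (_ * _)).
by rewrite rmorph_prod; apply: eq_bigr => l _; rewrite mxE.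
Qed.

Lemma svd_minor_right (i : 'I_n) (g A B : 'M[K]_n.+1) s (f : 'I_i.+1 -> 'I_n.+1) :
  is_svd g A s B ->
  \sum_(f' : {ffun 'I_i.+1 -> 'I_n.+1}) minor g f f' * conj (minor B (@inc i) f') =
    i.+1`!%:R * ofR (vol i s) * minor A f (@inc i).
Proof.
case=> uA uB _ _ gE; under eq_bigr do rewrite -minor_adj.
rewrite -minorM gE -!mulmxA uB mulmx1 minor_diagr.
rewrite -[RHS]mulrA; congr (_ * _); rewrite mulrC; congr (_ * _).
by rewrite rmorph_prod; apply: eq_bigr => l _; rewrite mxE.
Qed.

Lemma unitary_minor_sum (i : 'I_n) (A : 'M[K]_n.+1) : unitary A ->
  \sum_(f : {ffun 'I_i.+1 -> 'I_n.+1}) rnorm (minor A f (@inc i)) ^+ 2 = i.+1`!%:R.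
Proof.
move=> uA; apply: (@of_real_inj R b); rewrite rmorph_nat rmorph_sum /=.
have := minorM (adj A) A (@inc i) (@inc i).
rewrite unitary_adjl // minor1_inj ?mulr1; last exact: inc_ord_inj.
by move=> ->; apply: eq_bigr => f _; rewrite minor_adj mulrC mulr_conj.
Qed.

(** This bounds the singular values of the exterior power other than the largest. The image of h and
    the initial block differ by equally many indices m >= 1 on each side; those outside the block
    contribute at most the next singular value each, those missing from it at least the top one, and
    (next / top)^m <= next / top. *)
Lemma prod_singular_le (i : 'I_n) (s : 'rV[R]_n.+1) (h : 'I_i.+1 -> 'I_n.+1) :
  (forall j, 0 < s 0 j) -> (forall p q : 'I_n.+1, (p <= q)%N -> s 0 q <= s 0 p) ->
  injective h -> (exists l, (i < h l)%N) ->
  (\prod_l s 0 (h l)) * s 0 (widen_ord (leqnSn n) i) <= vol i s * s 0 (lift ord0 i).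
Proof.
move=> s0 smono hinj [l0 hl0].
pose H := [set h l | l in 'I_i.+1]%SET; pose I := [set @inc i l | l in 'I_i.+1]%SET.
have -> : \prod_l s 0 (h l) = \prod_(j in H) s 0 j.
  by rewrite big_imset /=; [apply: eq_bigl => l; rewrite inE|move=> ? ? _ _; exact: hinj].
have -> : vol i s = \prod_(j in I) s 0 j.
  by rewrite big_imset /=; [apply: eq_bigl => l; rewrite inE|move=> ? ? _ _; exact: inc_ord_inj].
have cHI : #|H| = #|I| by rewrite !card_imset //; exact: inc_ord_inj.
have inI j : (j \in I) = (j <= i)%N.
  apply/imsetP/idP => [[l _ ->]|ji]; first by rewrite /= -ltnS.
  by exists (Ordinal (ji : (j < i.+1)%N)) => //; apply: val_inj.
rewrite (big_setID I) /= [X in _ <= X * _](big_setID H) /= [(I :&: H)%SET]finset.setIC.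
have cD : #|H :\: I| = #|I :\: H|.
  apply/eqP; rewrite -(eqn_add2l #|H :&: I|) cardsID [(H :&: I)%SET]finset.setIC cardsID.
  by rewrite cHI.
have Dpos : (0 < #|H :\: I|)%N.
  by apply/card_gt0P; exists (h l0); rewrite inE inI -ltnNge hl0 imset_f.
set a := s 0 (widen_ord _ _); set c := s 0 (lift _ _).
have ca : c <= a by apply: smono; rewrite /= /bump leq0n add1n.
have c0 : 0 < c by exact: s0.
have a0 : 0 < a by exact: s0.
rewrite -!mulrA; apply: ler_wpM2l; first by apply: prodr_ge0 => j _; exact: ltW.
have le1 : \prod_(j in H :\: I) s 0 j <= c ^+ #|H :\: I|.
  rewrite -prodr_const; apply: ler_prod => j; rewrite inE inI -ltnNge => /andP[ij _].
  by rewrite ltW //= smono // /= /bump leq0n add1n.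
have le2 : a ^+ #|I :\: H| <= \prod_(j in I :\: H) s 0 j.
  rewrite -prodr_const; apply: ler_prod => j; rewrite inE inI => /andP[_ ij].
  by rewrite ltW //= smono.
apply: (@le_trans _ _ (c ^+ #|H :\: I| * a)); first by apply: ler_wpM2r => //; exact: ltW.
apply: (@le_trans _ _ (a ^+ #|I :\: H| * c)); last by apply: ler_wpM2r => //; exact: ltW.
rewrite -cD; case: #|_| Dpos => // m _; rewrite !exprS mulrAC [leRHS]mulrAC [c * a]mulrC.
by apply: ler_wpM2l; [rewrite mulr_ge0 ?ltW|apply: lerXn2r => //; rewrite nnegrE ltW].
Qed.

End SingularMinors.

(** * The norm on the exterior power *)

Section ExteriorNorm.
Variables (R : realType) (b : base_field) (n : nat) (i : 'I_n).
Local Notation K := (scalars R b).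
Local Notation conj := (@conj_scalar R b).
Local Notation ofR := (@of_real R b).
Local Notation adj A := (map_mx conj A^T).
Local Notation Ix := {ffun 'I_i.+1 -> 'I_n.+1}.
Local Notation fct := (i.+1`!%:R : R).
Local Notation inc := (@inc n i).
Implicit Types (g h p A B : 'M[K]_n.+1) (s : 'rV[R]_n.+1) (f : Ix).
Local Notation top s := (s 0 (widen_ord (leqnSn n) i)).
Local Notation next s := (s 0 (lift ord0 i)).

Let fct1 : 1 <= fct.
Proof. by rewrite ler1n fact_gt0. Qed.

Let fct0 : 0 < fct.
Proof. exact: lt_le_trans ltr01 fct1. Qed.

Let rnorm_fct : rnorm (i.+1`!%:R : K) = fct.
Proof. exact: rnorm_nat. Qed.

(* Comparable with e^(omega_i (kappa g)), but submultiplicative for elementary reasons. *)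
Definition ext_norm g : R := \sum_(f : Ix) \sum_(f' : Ix) rnorm (minor g f f').

Lemma ext_norm_ge0 g : 0 <= ext_norm g.
Proof. by apply: sumr_ge0 => f _; apply: sumr_ge0 => f' _; exact: rnorm_ge0. Qed.

Lemma minor_le_ext_norm g (f f' : Ix) : rnorm (minor g f f') <= ext_norm g.
Proof.
rewrite /ext_norm (bigD1 f) //= (bigD1 f') //= -addrA lerDl.
by rewrite addr_ge0 // sumr_ge0 // => ? _; rewrite ?sumr_ge0 // ?rnorm_ge0 // => ? _; rewrite rnorm_ge0.
Qed.

Lemma ext_normM g h : ext_norm (g *m h) <= ext_norm g * ext_norm h.
Proof.
have H (f f' : Ix) : rnorm (minor (g *m h) f f') <=
    \sum_(m : Ix) rnorm (minor g f m) * rnorm (minor h m f').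
  apply: (@le_trans _ _ (fct * rnorm (minor (g *m h) f f'))).
    by rewrite ler_peMl ?rnorm_ge0.
  rewrite -rnorm_fct -rnormM minorM; apply: le_trans (rnorm_sum _ _ _) _.
  by apply: ler_sum => m _; rewrite rnormM.
apply: (@le_trans _ _ (\sum_(f : Ix) \sum_(f' : Ix) \sum_(m : Ix)
  rnorm (minor g f m) * rnorm (minor h m f'))).
  by apply: ler_sum => f _; apply: ler_sum => f' _; exact: H.
rewrite /ext_norm mulr_suml; apply: ler_sum => f _.
rewrite exchange_big /= mulr_suml; apply: ler_sum => m _.
rewrite -mulr_sumr; apply: ler_wpM2l; first exact: rnorm_ge0.
rewrite [leRHS](bigD1 m) //= lerDl sumr_ge0 // => m' _.
by rewrite sumr_ge0 // => ? _; exact: rnorm_ge0.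
Qed.

Lemma ext_normZ (c : K) g : rnorm c = 1 -> ext_norm (c *: g) = ext_norm g.
Proof.
move=> c1; apply: eq_bigr => f _; apply: eq_bigr => f' _.
by rewrite minorZ rnormM rnormX c1 expr1n mul1r.
Qed.

Lemma ext_norm1_gt0 : 0 < ext_norm (1%:M).
Proof.
apply: lt_le_trans ltr01 _; rewrite -(rnorm1 R b).
pose f := [ffun l => inc l] : Ix.
suff e : minor (1%:M : 'M[K]_n.+1) f f = 1.
  by rewrite -[X in rnorm X]e; exact: minor_le_ext_norm.
by apply: minor1_inj => l l'; rewrite !ffunE; exact: inc_ord_inj.
Qed.

Lemma ext_norm_gt0 g : g \in unitmx -> 0 < ext_norm g.
Proof.
move=> ug; have := ext_norm1_gt0; rewrite -(mulmxV ug) => /lt_le_trans/(_ (ext_normM _ _)).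
have := ext_norm_ge0 g; rewrite le_eqVlt => /predU1P[<-|//]; by rewrite mul0r ltxx.
Qed.

Lemma vol_gt0 s : (forall j, 0 < s 0 j) -> 0 < vol i s.
Proof. by move=> s0; apply: prodr_gt0. Qed.

Let coplucker_sum B : unitary B -> \sum_(f : Ix) rnorm (minor B inc f) ^+ 2 = fct.
Proof.
move=> uB; rewrite -(unitary_minor_sum i (unitary_adj uB)); apply: eq_bigr => f _.
by rewrite minor_adj rnorm_conj.
Qed.

Lemma factor_inc (h : 'I_i.+1 -> 'I_n.+1) : injective h -> (forall l, (h l <= i)%N) ->
  exists t : 'S_i.+1, h =1 inc \o t.
Proof.
move=> hi hl; have ti : injective (fun l => inord (h l) : 'I_i.+1).
  move=> l l' /(congr1 val); rewrite /= !inordK ?ltnS // => e.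
  by apply: hi; exact: val_inj.
by exists (perm ti) => l; apply: val_inj; rewrite /= permE inordK // ltnS.
Qed.

Lemma prod_le_vol s (h : 'I_i.+1 -> 'I_n.+1) : (forall j, 0 < s 0 j) ->
  (forall p q : 'I_n.+1, (p <= q)%N -> s 0 q <= s 0 p) -> injective h ->
  \prod_l s 0 (h l) <= vol i s.
Proof.
move=> s0 smono hi; have [[l ml]|small] := pselect (exists l, (i < h l)%N).
  have := prod_singular_le s0 smono hi (ex_intro _ l ml).
  have lt : next s <= top s by apply: smono; rewrite /= /bump leq0n add1n.
  move=> /le_trans/(_ (ler_wpM2l (ltW (vol_gt0 s0)) lt)).
  by rewrite ler_pM2r.
have [l|t ht] := factor_inc hi.
  by rewrite leqNgt; apply/negP => lt; apply: small; exists l.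
rewrite /vol [leRHS](reindex_perm t) le_eqVlt; apply/orP; left; apply/eqP.
by apply: eq_bigr => l _; rewrite ht.
Qed.

Let rnorm_prod_sing s (m : Ix) : (forall j, 0 < s 0 j) ->
  rnorm (\prod_l (map_mx ofR s) 0 (m l)) = \prod_l s 0 (m l).
Proof.
move=> s0; rewrite rnorm_prod; apply: eq_bigr => l _.
by rewrite mxE rnorm_of_real ger0_norm // ltW.
Qed.

Lemma ext_norm_le_vol : exists2 C : R, 0 < C & forall g A s B, is_svd g A s B ->
  (forall j, 0 < s 0 j) -> ext_norm g <= C * vol i s.
Proof.
exists (#|Ix|%:R * #|Ix|%:R * (#|Ix|%:R * (fct * fct))) => [|g A s B svd s0].
  have Ix0 : 0 < #|Ix|%:R :> R.
    by rewrite ltr0n; apply/card_gt0P; exists [ffun=> ord0].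
  by rewrite !mulr_gt0.
have bound (f f' : Ix) : rnorm (minor g f f') <= #|Ix|%:R * (fct * fct) * vol i s.
  apply: (@le_trans _ _ (fct * rnorm (minor g f f'))).
    by rewrite ler_peMl ?rnorm_ge0.
  have [uA uB _ smono gE] := svd; rewrite -rnorm_fct -rnormM {1}gE minorM.
  apply: le_trans (rnorm_sum _ _ _) _; rewrite rnorm_fct -mulrA mulr_natl -sumr_const.
  apply: ler_sum => m _; rewrite minor_diagr !rnormM rnorm_prod_sing //.
  have [mi|/minor_noninj] := pselect (injective m); last first.
    move=> ->; rewrite rnorm0 !mul0r !mulr_ge0 // ltW //; exact: vol_gt0.
  rewrite [leLHS]mulrAC; apply: ler_pM; rewrite ?mulr_ge0 ?rnorm_ge0 ?prodr_ge0 //.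
  - by move=> l _; exact: ltW.
  - by apply: ler_pM; rewrite ?rnorm_ge0 ?minor_unitary_le.
  exact: prod_le_vol.
rewrite /ext_norm -!mulrA mulr_natl -sumr_const; apply: ler_sum => f _.
rewrite [leRHS]mulr_natl -sumr_const; apply: ler_sum => f' _.
by apply: le_trans (bound f f') _; rewrite !mulrA.
Qed.

(** Pairing the minors of g with the leading left and right singular vectors gives [vol] up to
    factorials, and the coordinates of these vectors are bounded. *)
Lemma vol_le_ext_norm g A s B : is_svd g A s B -> (forall j, 0 < s 0 j) ->
  vol i s <= ext_norm g.
Proof.
move=> svd s0; have [uA uB _ _ _] := svd.
have v0 := vol_gt0 s0.
suff : fct * fct * vol i s <= fct * fct * ext_norm g by rewrite ler_pM2l // mulr_gt0.
have -> : fct * fct * vol i s = rnorm (\sum_(f : Ix) \sum_(f' : Ix)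
    conj (minor A f inc) * minor g f f' * conj (minor B inc f')).
  rewrite exchange_big /=; under eq_bigr do rewrite -mulr_suml (svd_minor_left _ svd).
  have -> : \sum_(f' : Ix) i.+1`!%:R * ofR (vol i s) * minor B inc f' * conj (minor B inc f')
    = i.+1`!%:R * ofR (vol i s) * ofR fct.
    rewrite -(coplucker_sum uB) rmorph_sum mulr_sumr; apply: eq_bigr => f _.
    by rewrite -mulrA mulr_conj.
  rewrite !rnormM rnorm_fct !rnorm_of_real !ger0_norm ?ltW //; ring.
apply: le_trans (rnorm_sum _ _ _) _; rewrite /ext_norm mulr_sumr; apply: ler_sum => f _.
apply: le_trans (rnorm_sum _ _ _) _; rewrite mulr_sumr; apply: ler_sum => f' _.
rewrite !rnormM !rnorm_conj mulrAC; apply: ler_wpM2r; first exact: rnorm_ge0.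
by apply: ler_pM; rewrite ?rnorm_ge0 ?minor_unitary_le.
Qed.

(** Pair g h with the leading left vector of g and the leading right vector of h. The corner minor
    of B A' measures how far the attracting flag of h is from the repelling one of g. *)
Lemma ext_norm_mul_ge g h A s B A' s' B' : is_svd g A s B -> is_svd h A' s' B' ->
  (forall j, 0 < s 0 j) -> (forall j, 0 < s' 0 j) ->
  vol i s * vol i s' * rnorm (minor (B *m A') inc inc) <= ext_norm (g *m h).
Proof.
move=> svd svd' s0 s0'; have [uA uB _ _ _] := svd; have [uA' uB' _ _ _] := svd'.
have v0 := vol_gt0 s0; have v0' := vol_gt0 s0'.
have fct3 : 0 < fct * fct * fct by rewrite !mulr_gt0.
rewrite -(ler_pM2l fct3).
have -> : fct * fct * fct * (vol i s * vol i s' * rnorm (minor (B *m A') inc inc)) =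
    rnorm (i.+1`!%:R * \sum_(f : Ix) \sum_(f' : Ix)
    conj (minor A f inc) * minor (g *m h) f f' * conj (minor B' inc f')).
  have -> : i.+1`!%:R * (\sum_(f : Ix) \sum_(f' : Ix)
      conj (minor A f inc) * minor (g *m h) f f' * conj (minor B' inc f')) =
    \sum_(m : Ix) (\sum_(f : Ix) conj (minor A f inc) * minor g f m) *
      (\sum_(f' : Ix) minor h m f' * conj (minor B' inc f')).
    rewrite mulr_sumr.
    under [in RHS]eq_bigr do rewrite mulr_suml.
    rewrite [RHS]exchange_big; apply: eq_bigr => f _ /=.
    under [in RHS]eq_bigr do rewrite mulr_sumr.
    rewrite [RHS]exchange_big mulr_sumr; apply: eq_bigr => f' _ /=.
    transitivity (conj (minor A f inc) * (i.+1`!%:R * minor (g *m h) f f') *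
      conj (minor B' inc f')); first by ring.
    rewrite minorM mulr_sumr mulr_suml; apply: eq_bigr => m _; ring.
  under eq_bigr do rewrite (svd_minor_left _ svd) (svd_minor_right _ svd').
  have -> : \sum_(m : Ix) i.+1`!%:R * ofR (vol i s) * minor B inc m *
      (i.+1`!%:R * ofR (vol i s') * minor A' m inc) =
    i.+1`!%:R * i.+1`!%:R * ofR (vol i s) * ofR (vol i s') *
      (i.+1`!%:R * minor (B *m A') inc inc).
    rewrite minorM mulr_sumr; apply: eq_bigr => m _; ring.
  by rewrite !rnormM rnorm_fct !rnorm_of_real !ger0_norm ?ltW //; ring.
rewrite rnormM rnorm_fct -!mulrA; apply: ler_wpM2l; first exact: ltW.
apply: le_trans (rnorm_sum _ _ _) _; rewrite !mulrA /ext_norm mulr_sumr; apply: ler_sum => f _.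
apply: le_trans (rnorm_sum _ _ _) _; rewrite mulr_sumr; apply: ler_sum => f' _.
rewrite !rnormM !rnorm_conj mulrAC; apply: ler_wpM2r; first exact: rnorm_ge0.
by apply: ler_pM; rewrite ?rnorm_ge0 ?minor_unitary_le.
Qed.

End ExteriorNorm.

(** * Distance between Pluecker lines and contraction *)

Section PluckerDistance.
Variables (R : realType) (b : base_field) (n : nat) (i : 'I_n).
Local Notation K := (scalars R b).
Local Notation conj := (@conj_scalar R b).
Local Notation ofR := (@of_real R b).
Local Notation Ix := {ffun 'I_i.+1 -> 'I_n.+1}.
Local Notation fct := (i.+1`!%:R : R).
Local Notation inc := (@inc n i).
Local Notation ext_norm := (@ext_norm R b n i).
Implicit Types (g h p A B : 'M[K]_n.+1) (s : 'rV[R]_n.+1) (f : Ix).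
Local Notation top s := (s 0 (widen_ord (leqnSn n) i)).
Local Notation next s := (s 0 (lift ord0 i)).

Let fct1 : 1 <= fct.
Proof. by rewrite ler1n fact_gt0. Qed.

Let fct0 : 0 < fct.
Proof. exact: lt_le_trans ltr01 fct1. Qed.

Let rnorm_fct : rnorm (i.+1`!%:R : K) = fct.
Proof. exact: rnorm_nat. Qed.

Let Ix0 : 0 < #|Ix|%:R :> R.
Proof. by rewrite ltr0n; apply/card_gt0P; exists [ffun=> ord0]. Qed.

(* The vector (minor A f inc)_f gives the Pluecker coordinates of the span of the first *)
(* i.+1 columns of A.                                                                   *)
Definition wedge A B (f f' : Ix) : K :=
  minor A f inc * minor B f' inc - minor A f' inc * minor B f inc.

(** Every column of the exterior power of g is nearly on the leading line. In the Cauchy-Binet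
    expansion, the maps h into the initial block give multiples of the leading vector, which cancel
    in the wedge, and the others are small by [prod_singular_le]. *)
Lemma svd_wedge : exists2 C : R, 0 < C & forall g A s B, is_svd g A s B ->
  (forall j, 0 < s 0 j) -> forall (f f' : Ix) (m : Ix),
  rnorm (minor g f m * minor A f' inc - minor g f' m * minor A f inc) * top s
    <= C * (vol i s * next s).
Proof.
exists (#|Ix|%:R * (2 * fct * fct * fct)) => [|g A s B svd s0 f f' m].
  by rewrite !mulr_gt0.
have [uA uB _ smono gE] := svd.
set w := _ - _.
have t0 : 0 < top s by exact: s0.
apply: (@le_trans _ _ (fct * rnorm w * top s)).
  by apply: ler_wpM2r; [exact: ltW|rewrite ler_peMl ?rnorm_ge0].
have -> : fct * rnorm w = rnorm (\sum_(h : Ix)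
    (minor A f h * minor A f' inc - minor A f' h * minor A f inc) *
      ((\prod_l (map_mx ofR s) 0 (h l)) * minor B h m)).
  rewrite -rnorm_fct -rnormM /w mulrBr !mulrA gE !minorM !mulr_suml -sumrB.
  by congr rnorm; apply: eq_bigr => h _; rewrite !minor_diagr; ring.
apply: le_trans (ler_wpM2r (ltW t0) (rnorm_sum _ _ _)) _.
rewrite mulr_suml -mulrA mulr_natl -sumr_const; apply: ler_sum => h _.
have v0 : 0 < vol i s * next s by rewrite mulr_gt0 // vol_gt0.
have rhs0 : 0 <= 2 * fct * fct * fct * (vol i s * next s).
  by rewrite ltW // mulr_gt0 // !mulr_gt0.
have [hi|/minor_noninj H] := pselect (injective h); last first.
  by rewrite !H !mul0r subrr mul0r rnorm0 mul0r.
have [[l hl]|small] := pselect (exists l, (i < h l)%N); last first.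
  have [l|t ht] := factor_inc hi.
    by rewrite leqNgt; apply/negP => lt; apply: small; exists l.
  have E (q : 'I_i.+1 -> 'I_n.+1) : minor A q h = (-1) ^+ t * minor A q inc.
    rewrite -minor_perm /minor; congr (\det _); apply/matrixP => u v.
    by rewrite !mxE ht.
  rewrite (E f) (E f'); set x := minor A f _; set y := minor A f' _.
  have -> : (-1) ^+ t * x * y - (-1) ^+ t * y * x = 0 by rewrite mulrAC subrr.
  by rewrite mul0r rnorm0 mul0r.
rewrite !rnormM rnorm_prod.
under eq_bigr do rewrite mxE rnorm_of_real ger0_norm ?(ltW (s0 _)) //.
have P := prod_singular_le s0 smono hi (ex_intro _ l hl).
have Bm := minor_unitary_le h m uB.
have W : rnorm (minor A f h * minor A f' inc - minor A f' h * minor A f inc) <= 2 * fct * fct.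
  apply: le_trans (rnormD _ _) _; rewrite rnormN !rnormM.
  have M (q q' : 'I_i.+1 -> 'I_n.+1) : rnorm (minor A q h) * rnorm (minor A q' inc) <= fct * fct.
    by apply: ler_pM; rewrite ?rnorm_ge0 ?minor_unitary_le.
  have := M f f'; have := M f' f; lra.
have -> : 2 * fct * fct * fct * (vol i s * next s) =
  (2 * fct * fct) * ((vol i s * next s) * fct) by ring.
rewrite -[leLHS]mulrA; apply: ler_pM; rewrite ?rnorm_ge0 //.
  by rewrite !mulr_ge0 ?rnorm_ge0 ?prodr_ge0 // => *; rewrite ltW.
rewrite mulrAC; apply: ler_pM; rewrite ?rnorm_ge0 // mulr_ge0 ?prodr_ge0 ?ltW //.
by move=> *; rewrite ltW.
Qed.

(** The leading left vector of p is, up to [vol] and a phase, the image under g of a vector V built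
    from h and B'. It is thus a combination of columns of the exterior power of g, and [svd_wedge]
    applies to each of them. *)
Lemma wedge_contract : exists2 C : R, 0 < C & forall g h p c A s B A' s' B',
  rnorm c = 1 -> p = c *: (g *m h) -> is_svd g A s B -> is_svd p A' s' B' ->
  (forall j, 0 < s 0 j) -> (forall j, 0 < s' 0 j) -> forall f f',
  rnorm (wedge A' A f f') * ext_norm p * top s <= C * (next s * (ext_norm g * ext_norm h)).
Proof.
have [C0 C00 HC0] := svd_wedge; have [C1 C10 HC1] := ext_norm_le_vol R b i.
exists (C1 * (C0 * fct)) => [|g h p c A s B A' s' B' c1 pE svd svd' s0 s0' f f'].
  by rewrite !mulr_gt0.
have [uA uB _ _ _] := svd; have [uA' uB' _ _ _] := svd'.
have v0 := vol_gt0 i s0; have v0' := vol_gt0 i s0'.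
pose V (m : Ix) := \sum_(q : Ix) minor h m q * conj (minor B' inc q).
have E (f0 : Ix) : i.+1`!%:R * i.+1`!%:R * ofR (vol i s') * minor A' f0 inc =
    c ^+ i.+1 * \sum_(m : Ix) minor g f0 m * V m.
  rewrite -!mulrA [X in _ * X]mulrA -(svd_minor_right f0 svd') mulr_sumr.
  transitivity (\sum_(q : Ix) c ^+ i.+1 * \sum_(m : Ix)
      minor g f0 m * (minor h m q * conj (minor B' inc q))).
    apply: eq_bigr => q _; rewrite pE minorZ.
    transitivity (c ^+ i.+1 * ((i.+1`!%:R * minor (g *m h) f0 q) * conj (minor B' inc q))).
      by ring.
    by rewrite minorM mulr_suml; congr (_ * _); apply: eq_bigr => m _; rewrite mulrA.
  rewrite -mulr_sumr exchange_big /=; congr (_ * _); apply: eq_bigr => m _.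
  by rewrite -mulr_sumr.
have EW : i.+1`!%:R * i.+1`!%:R * ofR (vol i s') * wedge A' A f f' =
    c ^+ i.+1 * \sum_(m : Ix)
      (minor g f m * minor A f' inc - minor g f' m * minor A f inc) * V m.
  rewrite /wedge mulrBr !mulrA !E -!mulrA -mulrBr; congr (_ * _).
  rewrite !mulr_suml -sumrB; apply: eq_bigr => m _; ring.
have VB m : rnorm (V m) <= fct * \sum_(q : Ix) rnorm (minor h m q).
  apply: le_trans (rnorm_sum _ _ _) _; rewrite mulr_sumr; apply: ler_sum => q _.
  rewrite rnormM rnorm_conj mulrC; apply: ler_wpM2r; rewrite ?rnorm_ge0 //.
  exact: minor_unitary_le.
have t0 : 0 < top s by exact: s0.
have n0 : 0 < next s by exact: s0.
have bound : vol i s' * rnorm (wedge A' A f f') * top s <=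
    C0 * fct * (vol i s * next s) * ext_norm h.
  apply: (@le_trans _ _ (rnorm (i.+1`!%:R * i.+1`!%:R * ofR (vol i s') * wedge A' A f f') * top s)).
    apply: ler_wpM2r; first exact: ltW.
    rewrite !rnormM rnorm_fct rnorm_of_real ger0_norm ?(ltW v0') //.
    rewrite -[leRHS]mulrA; apply: ler_peMl; first by rewrite mulr_ge0 ?rnorm_ge0 ?ltW.
    by apply: le_trans fct1 _; apply: ler_peMl => //; exact: ltW.
  rewrite EW rnormM rnormX c1 expr1n mul1r.
  apply: le_trans (ler_wpM2r (ltW t0) (rnorm_sum _ _ _)) _.
  rewrite mulr_suml /ext_norm mulr_sumr; apply: ler_sum => m _.
  rewrite rnormM mulrAC.
  have -> (x : R) : C0 * fct * (vol i s * next s) * x = C0 * (vol i s * next s) * (fct * x) by ring.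
  apply: ler_pM; rewrite ?mulr_ge0 ?rnorm_ge0 ?(ltW t0) //; exact: HC0 svd s0 f f' m.
have N1 := HC1 _ _ _ _ svd' s0'.
have N2 := vol_le_ext_norm i svd s0.
apply: (@le_trans _ _ (rnorm (wedge A' A f f') * (C1 * vol i s') * top s)).
  by apply: ler_wpM2r; [exact: ltW|apply: ler_wpM2l; rewrite ?rnorm_ge0].
have -> : rnorm (wedge A' A f f') * (C1 * vol i s') * top s =
  C1 * (vol i s' * rnorm (wedge A' A f f') * top s) by ring.
rewrite -[leRHS]mulrA; apply: ler_wpM2l; first exact: ltW.
apply: le_trans bound _.
have -> : C0 * fct * (next s * (ext_norm g * ext_norm h)) =
  (C0 * fct) * (ext_norm g * next s) * ext_norm h by ring.
apply: ler_wpM2r; first exact: ext_norm_ge0.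
apply: ler_wpM2l; first by rewrite mulr_ge0 ?ltW.
by apply: ler_wpM2r; [exact: ltW|].
Qed.

(* Up to a constant, the projection onto the Pluecker line of the first i.+1 columns of a  *)
(* unitary A; unlike the Pluecker vector it depends only on their span.                    *)
Definition plucker_proj A (f f' : Ix) : K := minor A f inc * conj (minor A f' inc).

Definition plucker_dist A B : R :=
  \sum_(f : Ix) \sum_(f' : Ix) rnorm (plucker_proj A f f' - plucker_proj B f f').

Lemma plucker_distC A B : plucker_dist A B = plucker_dist B A.
Proof. by apply: eq_bigr => f _; apply: eq_bigr => f' _; rewrite rnormB. Qed.

Lemma plucker_dist_refl A : plucker_dist A A = 0.
Proof. by rewrite /plucker_dist big1 // => f _; rewrite big1 // => f' _; rewrite subrr rnorm0. Qed.

Lemma plucker_dist_tri A B D : plucker_dist A D <= plucker_dist A B + plucker_dist B D.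
Proof.
rewrite /plucker_dist -big_split; apply: ler_sum => f _ /=.
rewrite -big_split; apply: ler_sum => f' _ /=.
rewrite (_ : _ - _ = (plucker_proj A f f' - plucker_proj B f f') +
  (plucker_proj B f f' - plucker_proj D f f')); last by ring.
exact: rnormD.
Qed.

(** Both Pluecker vectors have squared norm (i+1)!. Inserting these norms writes (i+1)! times the
    difference of the projections as a sum in which each term contains a coordinate of the wedge. *)
Lemma plucker_dist_wedge : exists2 C : R, 0 < C & forall A B (w : R), unitary A -> unitary B ->
  (forall f f', rnorm (wedge A B f f') <= w) -> plucker_dist A B <= C * w.
Proof.
exists (#|Ix|%:R * (#|Ix|%:R * (#|Ix|%:R * (2 * fct * fct)))) => [|A B w uA uB W].
  by rewrite !mulr_gt0.
rewrite /plucker_dist -mulrA mulr_natl -sumr_const; apply: ler_sum => f _.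
rewrite -mulrA mulr_natl -sumr_const; apply: ler_sum => f' _.
have sq C : unitary C -> i.+1`!%:R = \sum_(h : Ix) minor C h inc * conj (minor C h inc).
  move=> uC; rewrite -(rmorph_nat ofR) -(unitary_minor_sum i uC) rmorph_sum.
  by apply: eq_bigr => h _; rewrite mulr_conj.
have key : i.+1`!%:R * (plucker_proj A f f' - plucker_proj B f f') = \sum_(h : Ix)
   (wedge A B f h * (conj (minor A f' inc) * conj (minor B h inc)) +
    minor A h inc * minor B f inc * conj (wedge A B f' h)).
  rewrite mulrBr {1}(sq B uB) (sq A uA) !mulr_suml -sumrB; apply: eq_bigr => h _.
  rewrite /wedge /plucker_proj rmorphB !rmorphM; ring.
apply: (@le_trans _ _ (fct * rnorm (plucker_proj A f f' - plucker_proj B f f'))).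
  by rewrite ler_peMl ?rnorm_ge0.
rewrite -rnorm_fct -rnormM key; apply: le_trans (rnorm_sum _ _ _) _.
rewrite rnorm_fct -mulrA mulr_natl -sumr_const; apply: ler_sum => h _.
have M C q : unitary C -> rnorm (minor C q inc) <= fct by exact: minor_unitary_le.
apply: le_trans (rnormD _ _) _; rewrite !rnormM !rnorm_conj.
have w0 : 0 <= w by apply: le_trans (W f f'); exact: rnorm_ge0.
have H1 : rnorm (wedge A B f h) * (rnorm (minor A f' inc) * rnorm (minor B h inc)) <=
    w * (fct * fct).
  by rewrite ler_pM ?mulr_ge0 ?rnorm_ge0 ?ler_pM ?rnorm_ge0 ?M.
have H2 : rnorm (minor A h inc) * rnorm (minor B f inc) * rnorm (wedge A B f' h) <=
    fct * fct * w.
  by rewrite ler_pM ?mulr_ge0 ?rnorm_ge0 ?ler_pM ?rnorm_ge0 ?M.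
by apply: le_trans (lerD H1 H2) _; rewrite le_eqVlt; apply/orP; left; apply/eqP; ring.
Qed.

Lemma plucker_contract : exists2 C : R, 0 < C & forall g h p c A s B A' s' B',
  rnorm c = 1 -> p = c *: (g *m h) -> is_svd g A s B -> is_svd p A' s' B' ->
  (forall j, 0 < s 0 j) -> (forall j, 0 < s' 0 j) -> 0 < ext_norm p ->
  plucker_dist A' A * ext_norm p * top s <= C * (next s * (ext_norm g * ext_norm h)).
Proof.
have [C C0 HC] := wedge_contract; have [D D0 HD] := plucker_dist_wedge.
exists (D * C) => [|g h p c A s B A' s' B' c1 pE svd svd' s0 s0' N0].
  by rewrite mulr_gt0.
have [uA uB _ _ _] := svd; have [uA' uB' _ _ _] := svd'.
have t0 : 0 < top s by exact: s0.
rewrite -ler_pdivlMr // -ler_pdivlMr // -!mulrA; apply: HD => // f f'.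
rewrite !mulrA ler_pdivlMr // ler_pdivlMr // -!mulrA.
by have := HC _ _ _ _ _ _ _ _ _ _ c1 pE svd svd' s0 s0' f f'; rewrite -!mulrA.
Qed.

End PluckerDistance.

(** * Flags *)

Section AdaptedFlags.
Variables (R : realType) (b : base_field) (n : nat) (theta : {set 'I_n}).
Local Notation K := (scalars R b).
Local Notation conj := (@conj_scalar R b).
Local Notation adj A := (map_mx conj A^T).
Local Notation flag := (flag K theta).
Implicit Types (A B : 'M[K]_n.+1) (F G : flag).

Lemma adapted_mem A F (i : {i : 'I_n | i \in theta}) (v : 'cV[K]_n.+1) : adapted A F ->
  v \in val F i <->
  exists2 y : 'cV[K]_n.+1, (forall j : 'I_n.+1, (val i < j)%N -> y j 0 = 0) & v = A *m y.
Proof.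
move=> /(_ i) ->; set s := [seq j : 'I_n.+1 <- enum 'I_n.+1 | (j <= val i)%N].
have sE j : (j \in s) = (j <= val i)%N by rewrite mem_filter mem_enum andbT.
split=> [vs|[y y0 ->]]; last first.
  have -> : A *m y = \sum_j y j 0 *: col j A.
    apply/matrixP => p q; rewrite !mxE summxE; apply: eq_bigr => j _.
    by rewrite !mxE ord1 mulrC.
  apply: memv_suml => j _; have [ji|ij] := leqP j (val i); last first.
    by rewrite y0 // scale0r mem0v.
  by apply: memvZ; apply: memv_span; apply: map_f; rewrite sE.
pose X := in_tuple [seq col j A | j <- s].
pose y := \sum_(l < size [seq col j A | j <- s]) coord X l v *:
  (delta_mx (nth ord0 s l) 0 : 'cV[K]_n.+1).
exists y => [j ij|].
  rewrite /y summxE big1 // => l _; rewrite !mxE.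
  case: eqP => [jE|]; last by rewrite mulr0.
  have : nth ord0 s l \in s by apply: mem_nth; rewrite -(size_map (fun j => col j A)).
  by rewrite sE -jE leqNgt ij.
rewrite {1}(coord_span (X := X) vs) /y mulmx_sumr; apply: eq_bigr => l _.
rewrite -scalemxAr -colE; congr (_ *: _).
by rewrite (nth_map ord0) // -(size_map (fun j => col j A)).
Qed.

Lemma free_cols A (s : seq 'I_n.+1) : A \in unitmx -> uniq s -> free [seq col j A | j <- s].
Proof.
move=> uA us; rewrite -[map _ _]/(val (in_tuple [seq col j A | j <- s])).
apply/freeP => k; set N := size _ in k * => H l0.
pose y : 'cV[K]_n.+1 := \sum_(l < N) k l *: delta_mx (nth ord0 s l) 0.
have Nl (l : 'I_N) : (l < size s)%N by case: l => l; rewrite /N size_map.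
have y0 : y = 0.
  rewrite -[y](mulKmx uA); suff -> : A *m y = 0 by rewrite mulmx0.
  rewrite -[RHS]H /y mulmx_sumr; apply: eq_bigr => l _.
  by rewrite -scalemxAr -colE (nth_map ord0).
have : y (nth ord0 s l0) 0 = 0 by rewrite y0 mxE.
rewrite /y summxE (bigD1 l0) //= !mxE !eqxx mulr1 big1 ?addr0 // => l ll0.
rewrite !mxE nth_uniq // andbT.
by rewrite eq_sym (inj_eq val_inj) (negbTE ll0) mulr0.
Qed.

Lemma adapted_exists A : A \in unitmx -> exists F, adapted A F.
Proof.
move=> uA.
pose S (m : nat) := [seq j : 'I_n.+1 <- enum 'I_n.+1 | (j <= m)%N].
pose F0 : {ffun {i : 'I_n | i \in theta} -> {vspace 'cV[K]_n.+1}} :=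
  [ffun i => <<[seq col j A | j <- S (val (val i))]>>%VS].
have fF : is_flag F0.
  apply/andP; split; apply/forallP => i.
    rewrite ffunE; have := free_cols uA (filter_uniq (fun j : 'I_n.+1 => (j <= val i)%N) (enum_uniq 'I_n.+1)).
    rewrite /free => /eqP ->; rewrite size_map size_filter -sum1_count.
    rewrite big_enum_cond /= (big_ord_narrow_leq (ltnW (ltn_ord (val i)))).
    by rewrite sum1_card card_ord.
  apply/forallP => j; apply/implyP => ij; rewrite !ffunE; apply: sub_span => v.
  case/mapP => l; rewrite mem_filter => /andP[li _] ->; apply: map_f.
  by rewrite mem_filter mem_enum (leq_trans li).
by exists (exist _ F0 fF) => i; rewrite /= ffunE.
Qed.

Lemma flag_cvg (u : nat -> 'M[K]_n.+1) (U : nat -> flag) A F :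
  A \in unitmx -> (forall m, u m \in unitmx) -> (forall m, adapted (u m) (U m)) ->
  adapted A F -> u m @[m --> \oo] --> A -> U m @[m --> \oo] --> F.
Proof.
move=> uA uu uU AF uA' V; rewrite nbhsE => -[W [oW fW] WV].
have H : \forall B \near A, B \in unitmx -> forall G, adapted B G -> W G.
  exact: (oW A F uA AF fW).
have H2 : \forall m \near \oo, u m \in unitmx -> forall G, adapted (u m) G -> W G := uA' _ H.
change (\forall m \near \oo, V (U m)).
by apply: filterS H2 => m um; apply: WV; exact: um (uu m) _ (uU m).
Qed.

(** Two matrices adapted to F differ by a right factor whose initial columns vanish below the block;
    t is the determinant of that block. *)
Lemma adapted_minor A B F (i : 'I_n) : i \in theta ->
  A \in unitmx -> B \in unitmx -> adapted A F -> adapted B F ->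
  exists2 t : K, t != 0 & forall (m : nat) (X : 'M[K]_(m, n.+1)) (f : 'I_i.+1 -> 'I_m),
    minor (X *m B) f (@inc n i) = t * minor (X *m A) f (@inc n i).
Proof.
move=> ith uA uB AF BF; pose Y := invmx A *m B.
have BE : B = A *m Y by rewrite /Y mulKVmx.
have Y0 (j : 'I_n.+1) (l : 'I_i.+1) : (i < j)%N -> Y j (inc l) = 0.
  move=> ij; pose i' : {i : 'I_n | i \in theta} := exist _ i ith.
  have : B *m delta_mx (inc l) 0 \in val F i'.
    apply/(adapted_mem i' _ BF); exists (delta_mx (inc l) 0) => // j' /= ij'.
    rewrite mxE eqxx andbT; case: eqP => // j'E.
    by move: ij'; rewrite j'E /= ltnNge -ltnS ltn_ord.
  case/(adapted_mem i' _ AF) => y y0 /(congr1 (mulmx (invmx A))).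
  by rewrite mulKmx // mulmxA -/Y -colE => /matrixP/(_ j 0); rewrite mxE => ->; exact: y0.
pose t := \det (mxsub (@inc n i) (@inc n i) Y).
have tE (m : nat) (X : 'M[K]_(m, n.+1)) (f : 'I_i.+1 -> 'I_m) :
    minor (X *m B) f (@inc n i) = t * minor (X *m A) f (@inc n i).
  rewrite {1}BE mulmxA /minor mulrC -det_mulmx; congr (\det _).
  apply/matrixP => p q; rewrite !mxE [RHS](eq_bigr
    (fun l => (X *m A) (f p) (inc l) * Y (inc l) (inc q))); last by move=> l _; rewrite !mxE.
  rewrite (bigID (fun j : 'I_n.+1 => (j <= i)%N)) /= [X in _ + X]big1 ?addr0; last first.
    by move=> j; rewrite -ltnNge => ij; rewrite Y0 // mulr0.
  rewrite (big_ord_narrow_leq (ltnW (ltn_ord i))); apply: eq_bigr => l _.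
  by rewrite (_ : widen_ord _ l = inc l) //; exact: val_inj.
exists t => //; apply/eqP => t0.
have := tE _ (invmx B) (@inc n i); rewrite t0 mul0r mulVmx // minor1_inj; last exact: inc_ord_inj.
by move/eqP; rewrite oner_eq0.
Qed.

(** The last i.+1 indices. The corresponding rows of adj B cut out the span of the other columns of
    B, which is the complementary part of the flag of B. *)
Definition tl (i : 'I_n) (l : 'I_i.+1) : 'I_n.+1 := rev_ord (inc l).
Arguments tl : clear implicits.

(** A kernel vector of the block would give a nonzero vector common to the two complementary
    subspaces. *)
Lemma transverse_minor A B F G (i : 'I_n) : i \in theta -> rev_ord i \in theta ->
  A \in unitmx -> unitary B -> adapted A F -> adapted B G -> transverse F G ->
  minor (adj B *m A) (tl i) (@inc n i) != 0.
Proof.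
move=> ith rith uA uB AF BG FG; apply/negP; rewrite /minor -det_tr => /det0P[x x0 xM].
pose i' : {i : 'I_n | i \in theta} := exist _ i ith.
pose j' : {i : 'I_n | i \in theta} := exist _ (rev_ord i) rith.
have [/directv_addP FG0 _] := FG i' j' erefl.
pose y : 'cV[K]_n.+1 := \sum_l x 0 l *: delta_mx (inc l) 0.
have yE l : y (inc l) 0 = x 0 l.
  rewrite /y summxE (bigD1 l) //= !mxE !eqxx mulr1 big1 ?addr0 // => l' ll'.
  by rewrite !mxE (inj_eq (@inc_ord_inj _ _)) eq_sym (negbTE ll') mulr0.
have y0 (j : 'I_n.+1) : (i < j)%N -> y j 0 = 0.
  move=> ij; rewrite /y summxE big1 // => l _; rewrite !mxE.
  case: eqP => [jE|]; last by rewrite mulr0.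
  by move: ij; rewrite jE /= ltnNge -ltnS ltn_ord.
have vF : A *m y \in val F i' by apply/(adapted_mem i' _ AF); exists y.
have z0 (j : 'I_n.+1) : (rev_ord i < j)%N -> (adj B *m (A *m y)) j 0 = 0.
  move=> ij; have jn : (rev_ord j < i.+1)%N.
    by move: ij; rewrite /= !subSS => ij; have := ltn_ord j; have := ltn_ord i; lia.
  pose l : 'I_i.+1 := Ordinal jn.
  have jE : j = tl i l by rewrite /tl -[LHS]rev_ordK; congr rev_ord; apply: val_inj.
  have H : \sum_p x 0 p * (adj B *m A) (tl i l) (inc p) = 0.
    have H0 : (x *m (mxsub (tl i) (@inc n i) (adj B *m A))^T) 0 l = 0 by rewrite xM mxE.
    rewrite -[RHS]H0 [RHS]mxE.
    by apply: eq_bigr => p _; rewrite [in RHS]mxE [in RHS]mxE.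
  rewrite mulmxA jE mxE -[RHS]H (bigID (fun j : 'I_n.+1 => (j <= i)%N)) /= addrC big1 ?add0r; last first.
    by move=> p; rewrite -ltnNge => /y0 ->; rewrite mulr0.
  rewrite (big_ord_narrow_leq (ltnW (ltn_ord i))); apply: eq_bigr => p _.
  rewrite (_ : widen_ord _ p = inc p); last exact: val_inj.
  by rewrite yE mulrC.
have vG : A *m y \in val G j'.
  apply/(adapted_mem j' _ BG); exists (adj B *m (A *m y)) => //.
  by rewrite mulmxA uB mul1mx.
have : A *m y \in (val F i' :&: val G j')%VS by rewrite memv_cap vF vG.
rewrite FG0 memv0 => /eqP Ay0.
have yz : y = 0 by rewrite -[y](mulKmx uA) Ay0 mulmx0.
by case/eqP: x0; apply/matrixP => p l; rewrite ord1 -yE yz !mxE.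
Qed.

(** A flag is not transverse to itself: the row of the last index vanishes on the first i.+1
    columns, because i < n. *)
Lemma minor1_tl (i : 'I_n) : minor (1%:M : 'M[K]_n.+1) (tl i) (@inc n i) = 0.
Proof.
rewrite /minor (expand_det_row _ ord0) big1 // => l _; rewrite !mxE.
case: eqP => [/(congr1 val) /= e|]; last by rewrite mul0r.
by have := ltn_ord l; have := ltn_ord i; move: e; rewrite !subSS subn0; lia.
Qed.

End AdaptedFlags.

(** * Compactness of unitary matrices and limits of flags *)

Section UnitaryLimits.
Variables (R : realType) (b : base_field) (n : nat).
Local Notation K := (scalars R b).
Local Notation conj := (@conj_scalar R b).
Local Notation adj A := (map_mx conj A^T).

Lemma cvg_mulmx (T : Type) (F : set_system T) {FF : Filter F} (m p q : nat)
    (M : T -> 'M[K]_(m, p)) (N : T -> 'M[K]_(p, q)) (A : 'M[K]_(m, p)) (B : 'M[K]_(p, q)) :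
  (forall i j, M x i j @[x --> F] --> A i j) -> (forall i j, N x i j @[x --> F] --> B i j) ->
  forall i j, (M x *m N x) i j @[x --> F] --> (A *m B) i j.
Proof.
move=> cM cN i j; rewrite mxE; under eq_cvg do rewrite mxE.
by apply: cvg_sumr => l _; apply: cvgM.
Qed.

Lemma cvg_adj (T : Type) (F : set_system T) {FF : Filter F} (m p : nat)
    (M : T -> 'M[K]_(m, p)) (A : 'M[K]_(m, p)) :
  (forall i j, M x i j @[x --> F] --> A i j) ->
  forall i j, adj (M x) i j @[x --> F] --> adj A i j.
Proof.
move=> cM i j; rewrite !mxE; under eq_cvg do rewrite !mxE.
exact: cvg_conj.
Qed.

Lemma cvg_minor (T : Type) (F : set_system T) {FF : Filter F} (m p k : nat)
    (M : T -> 'M[K]_(m, p)) (A : 'M[K]_(m, p)) (f : 'I_k -> 'I_m) (g : 'I_k -> 'I_p) :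
  (forall i j, M x i j @[x --> F] --> A i j) -> minor (M x) f g @[x --> F] --> minor A f g.
Proof.
move=> cM; apply: cvg_det => i j; rewrite mxE; under eq_cvg do rewrite mxE.
exact: cM.
Qed.

Lemma unitary_subseq (J : finType) (u : nat -> J -> 'M[K]_n.+1) :
  (forall m j, unitary (u m j)) ->
  exists2 f : nat -> nat, {mono f : p q / (p <= q)%N} &
    exists2 A : J -> 'M[K]_n.+1, (forall j, unitary (A j)) &
      forall j p q, u (f m) j p q @[m --> \oo] --> A j p q.
Proof.
move=> uu.
have [|f fi [l fl]] := @bounded_family_subseq R b (J * 'I_n.+1 * 'I_n.+1)%type
    (fun m z => u m z.1.1 z.1.2 z.2) 1.
  by move=> m z; exact: unitary_entry.
exists f => //; pose A j : 'M[K]_n.+1 := \matrix_(p, q) l (j, p, q).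
have fA j p q : u (f m) j p q @[m --> \oo] --> A j p q.
  by rewrite mxE; exact: (fl (j, p, q)).
exists A => // j; apply/matrixP => p q.
have H : (u (f m) j *m adj (u (f m) j)) p q @[m --> \oo] --> (A j *m adj (A j)) p q.
  by apply: cvg_mulmx => // p' q'; exact: cvg_adj.
have E : (fun m => (u (f m) j *m adj (u (f m) j)) p q) = fun=> (1%:M : 'M[K]_n.+1) p q.
  by apply/funext => m; rewrite uu.
rewrite E in H; exact: (cvg_unique (@norm_hausdorff _ _) H (cvg_cst _)).
Qed.

Lemma unitary_plucker_ge1 (i : 'I_n) (A : 'M[K]_n.+1) : unitary A ->
  1 <= \sum_(f : {ffun 'I_i.+1 -> 'I_n.+1}) rnorm (minor A f (@inc n i)).
Proof.
move=> uA; have f0 : 0 < i.+1`!%:R :> R by rewrite ltr0n fact_gt0.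
rewrite -(ler_pM2l f0) mulr1 -[leLHS](unitary_minor_sum i uA) mulr_sumr; apply: ler_sum => f _.
by rewrite expr2; apply: ler_wpM2r; rewrite ?rnorm_ge0 ?minor_unitary_le //.
Qed.

(* Being transverse to G is an open condition on flags, which fails for G itself; this    *)
(* replaces the Hausdorff property of the flag variety.                                    *)
Lemma limit_flag_unique (theta : {set 'I_n}) (u : nat -> 'M[K]_n.+1)
    (U : nat -> flag K theta) A F G (i : 'I_n) :
  i \in theta -> rev_ord i \in theta ->
  unitary A -> (forall m, unitary (u m)) -> (forall m, adapted (u m) (U m)) ->
  adapted A G -> (forall p q, u m p q @[m --> \oo] --> A p q) ->
  U m @[m --> \oo] --> F -> ~ transverse F G.
Proof.
move=> ith rith uA uu uU AG cu cU FG.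
pose N (B : 'M[K]_n.+1) := rnorm (minor (adj A *m B) (@tl n i) (@inc n i)).
pose S (B : 'M[K]_n.+1) : R :=
  \sum_(f : {ffun 'I_i.+1 -> 'I_n.+1}) rnorm (minor B f (@inc n i)).
have cNS (T : Type) (E : set_system T) (FE : Filter E) (M : T -> 'M[K]_n.+1) (B : 'M[K]_n.+1) :
    (forall p q, M x p q @[x --> E] --> B p q) ->
    N (M x) @[x --> E] --> N B /\ S (M x) @[x --> E] --> S B.
  move=> cM; split.
    apply: cvg_rnorm; apply: cvg_minor; apply: cvg_mulmx => // p q; exact: cvg_cst.
  rewrite /S; apply: cvg_big => [|f _]; first exact: add_continuous.
  by apply: cvg_rnorm; exact: cvg_minor.
have near_NS (c : R) (T : Type) (E : set_system T) (FE : Filter E) (M : T -> 'M[K]_n.+1)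
    (B : 'M[K]_n.+1) : (forall p q, M x p q @[x --> E] --> B p q) -> c * S B < N B ->
    \forall x \near E, c * S (M x) < N (M x).
  move=> /cNS[cN cS] lt.
  have cd : N (M x) - c * S (M x) @[x --> E] --> N B - c * S B.
    by apply: cvgB => //; apply: cvgM cS; exact: cvg_cst.
  have d0 : 0 < N B - c * S B by rewrite subr_gt0.
  by apply: filterS (cvgr_gt _ cd _ d0) => x; rewrite subr_gt0.
have contra (V : set (flag K theta)) : flag_open V -> V F ->
    (exists2 c : R, 0 < c & forall m, V (U m) -> c <= N (u m)) -> False.
  move=> oV VF [c c0 HV].
  have nV : nbhs F V by apply: open_nbhs_nbhs; split => //; exact: oV.
  have [cN _] := cNS _ _ _ _ _ cu.
  have N0 : N A = 0 by rewrite /N unitary_adjl // minor1_tl rnorm0.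
  rewrite N0 in cN.
  have evV : \forall m \near \oo, V (U m) by exact: cU nV.
  have [m [/= Vm Nm]] := filter_ex (filterI evV (cvgr_lt _ cN _ c0)).
  by have := HV m Vm; rewrite leNgt Nm.
(* If no invertible matrix is adapted to F, then {F} is open for trivial reasons, and the flags U m,
   adapted to unitary matrices, never meet it. *)
have [[B uB BF]|noB] := pselect (exists2 B, B \in unitmx & adapted B F); last first.
  apply: (contra [set F]) => //.
    by move=> B F' uB BF' /= FF'; case: noB; exists B; rewrite // -FF'.
  exists 1 => // m /= UF; case: noB; exists (u m); last by rewrite -UF.
  exact: unitary_unit.
have NB0 : 0 < N B by rewrite rnorm_gt0; exact: transverse_minor BF AG FG.
have S0 : 0 <= S B by apply: sumr_ge0 => f _; exact: rnorm_ge0.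
(* A change of adapted matrix multiplies N and S by the same factor, so c * S < N is an open
   condition on the flag. As S is at least 1 on unitary matrices, it would give N (u m) >= c,
   against the convergence of N (u m) to 0. *)
pose c := N B / (2 * (S B + 1)).
have c0 : 0 < c by rewrite divr_gt0 //; lra.
pose phi (M : 'M[K]_n.+1) := c * S M < N M.
have phiB : phi B.
  rewrite /phi /c mulrAC ltr_pdivrMr; last by lra.
  by rewrite ltr_pM2l //; lra.
have phi_inv M M' (F' : flag K theta) : M \in unitmx -> M' \in unitmx -> adapted M F' -> adapted M' F' ->
    phi M -> phi M'.
  move=> uM uM' MF M'F; have [t t0 tE] := adapted_minor ith uM uM' MF M'F.
  have SE : S M' = rnorm t * S M.
    rewrite /S mulr_sumr; apply: eq_bigr => f _.
    by rewrite -[M' in LHS]mul1mx tE mul1mx rnormM.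
  have NE : N M' = rnorm t * N M by rewrite /N tE rnormM.
  by rewrite /phi SE NE mulrCA ltr_pM2l // rnorm_gt0.
apply: (contra [set F' | forall M, M \in unitmx -> adapted M F' -> phi M]).
- move=> M F' uM MF' VF'; have phiM := VF' M uM MF'.
  have ev := near_NS c _ (nbhs M) (nbhs_filter M) (fun X => X) M
    (fun p q => @coord_continuous K _ _ p q M) phiM.
  apply: filterS ev => X phiX uX F'' XF'' X' uX' X'F''; exact: (phi_inv X X' F'').
- by move=> M uM MF; exact: phi_inv BF MF phiB.
exists c => // m /(_ (u m) (unitary_unit (uu m)) (uU m)) /ltW; apply: le_trans.
by rewrite ler_peMr ?unitary_plucker_ge1 // ltW.
Qed.

End UnitaryLimits.

(** * Fundamental weights and the Cartan projection *)

Section WeightBasis.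
Variables (R : realType) (n : nat) (theta : {set 'I_n}).
Implicit Types (v : 'rV[R]_n.+1).

(* If coord_sum v = 0 and, for each i, one of fund_weight i v and simple_root i v is 0,   *)
(* then v = 0: any such choice of linear forms is, together with coord_sum, a basis.       *)
Lemma sum_sqr_by_parts v :
  \sum_j v 0 j ^+ 2 = \sum_(i < n) fund_weight i v * simple_root i v + coord_sum v * v 0 ord_max.
Proof.
pose a (j : nat) : R := v 0 (inord j).
have key m : \sum_(0 <= j < m.+1) a j ^+ 2 =
    \sum_(0 <= i < m) (\sum_(0 <= j < i.+1) a j) * (a i - a i.+1) + (\sum_(0 <= j < m.+1) a j) * a m.
  elim: m => [|m IH]; first by rewrite !big_nat1 big_geq // add0r expr2.
  rewrite big_nat_recr //= IH [in RHS]big_nat_recr //= [X in _ = _ + X * _]big_nat_recr //=.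
  ring.
have := key n; rewrite !big_mkord.
have aE (j : 'I_n.+1) : a j = v 0 j by rewrite /a inord_val.
rewrite (eq_bigr (fun j => v 0 j ^+ 2)) => [->|j _]; last by rewrite aE.
congr (_ + _ * _); last by rewrite -aE.
  apply: eq_bigr => i _; congr (_ * _).
    rewrite /fund_weight (big_ord_narrow_leq (ltnW (ltn_ord i))) big_mkord.
    apply: eq_bigr => j _; rewrite /a; congr (v 0 _); apply: val_inj; rewrite /= inordK //.
    by have := ltn_ord j; have := ltn_ord i; lia.
  rewrite /simple_root /a; congr (v 0 _ - v 0 _); apply: val_inj; rewrite /= inordK //;
    have := ltn_ord i; rewrite /bump; lia.
by rewrite /coord_sum; apply: eq_bigr => j _; rewrite aE.
Qed.

Let ell (j : 'I_n.+1) : 'rV[R]_n.+1 -> R^o :=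
  if unlift ord_max j is Some i then
    if i \in theta then @fund_weight R n i else @simple_root R n i
  else @coord_sum R n.

Let ell_lin j : linear (ell j).
Proof.
rewrite /ell; case: unliftP => [i _|_]; last exact: coord_sum_linear.
by case: ifP => _; [exact: fund_weight_linear|exact: simple_root_linear].
Qed.

Let ell_mx : 'M[R]_n.+1 := \matrix_(k, j) ell j (delta_mx 0 k).

Let ell_mxE v j : (v *m ell_mx) 0 j = ell j v.
Proof.
pose f : {linear 'rV[R]_n.+1 -> R^o} :=
  HB.pack (ell j) (GRing.isLinear.Build R _ R^o _ (ell j) (ell_lin j)).
rewrite mxE -[ell j v]/(f v) {2}[v]row_sum_delta linear_sum; apply: eq_bigr => k _.
by rewrite linearZ mxE.
Qed.

Let ell_inj v : (forall j, ell j v = 0) -> v = 0.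
Proof.
move=> H; have v0 : coord_sum v = 0 by have := H ord_max; rewrite /ell unlift_none.
have Hi i : fund_weight i v * simple_root i v = 0.
  have := H (lift ord_max i); rewrite /ell liftK; case: ifP => _ ->; [exact: mul0r|exact: mulr0].
have /eqP := sum_sqr_by_parts v; rewrite v0 mul0r addr0 [X in _ == X]big1 => [|i _]; last exact: Hi.
rewrite psumr_eq0 => [/allP vj|j _]; last exact: sqr_ge0.
apply/matrixP => i j; rewrite ord1 mxE; apply/eqP; rewrite -sqrf_eq0.
by have := vj j; rewrite mem_index_enum => /(_ isT).
Qed.

Let ell_unit : ell_mx \in unitmx.
Proof.
rewrite -row_free_unit; apply: inj_row_free => v vM; apply: ell_inj => j.
by rewrite -ell_mxE vM mxE.
Qed.

Lemma fund_weight_dual : exists e : 'I_n -> 'rV[R]_n.+1,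
  [/\ forall i, i \in theta -> e i \in cartan_theta R theta,
    forall i j, j \in theta -> fund_weight j (e i) = (j == i)%:R
  & forall v, v \in cartan_theta R theta -> v = \sum_(i in theta) fund_weight i v *: e i].
Proof.
pose w i : 'rV[R]_n.+1 := delta_mx 0 (lift ord_max i).
exists (fun i => w i *m invmx ell_mx).
have ew i j : ell j (w i *m invmx ell_mx) = (w i) 0 j by rewrite -ell_mxE mulmxKV.
have wE i j : w i 0 (lift ord_max j) = (j == i)%:R by rewrite mxE eqxx (inj_eq lift_inj).
have wmax i : w i 0 ord_max = 0 by rewrite mxE eqxx (negbTE (neq_lift _ _)).
have eth i : i \in theta -> w i *m invmx ell_mx \in cartan_theta R theta.
  move=> ith; apply/mem_cartan_theta; split.
    by have := ew i ord_max; rewrite /ell unlift_none /coord_sum => ->.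
  move=> j jth; have := ew i (lift ord_max j); rewrite /ell liftK (negbTE jth) wE.
  case: eqP => [ji|_ /eqP]; first by rewrite ji ith in jth.
  by rewrite /simple_root subr_eq0 => /eqP.
split=> // [i j jth|v /mem_cartan_theta[v0 vth]].
  by have := ew i (lift ord_max j); rewrite /ell liftK jth wE.
apply/eqP; rewrite -subr_eq0; apply/eqP; apply: ell_inj => j.
have -> : ell j (v - \sum_(i in theta) fund_weight i v *: (w i *m invmx ell_mx)) =
    ell j v - \sum_(i in theta) fund_weight i v * w i 0 j.
  rewrite -!ell_mxE mulmxBl mulmx_suml mxE [X in _ + X]mxE summxE; congr (_ - _).
  by apply: eq_bigr => i _; rewrite -scalemxAl mulmxKV // mxE.
rewrite /ell; case: unliftP => [i ->|->]; last first.
  by rewrite big1 ?subr0 // => i' _; rewrite wmax mulr0.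
case: ifP => ith.
  rewrite (bigD1 i) //= wE eqxx mulr1 big1 ?addr0 ?subrr // => i' /andP[_ i'i].
  by rewrite wE eq_sym (negbTE i'i) mulr0.
rewrite big1 ?subr0 => [|i' i'th].
  by rewrite /simple_root vth ?ith // subrr.
rewrite wE; case: eqP => [ii|]; last by rewrite mulr0.
by rewrite ii i'th in ith.
Qed.

End WeightBasis.

(** Besides decomposing phi, this settles the choice made in [kappa_theta]: its constraints are
    solved by the combination of the dual basis with coefficients omega_i (kappa g). *)
Lemma dual_cartan_theta (R : realType) (b : base_field) (n : nat) (theta : {set 'I_n})
    (phi : cartan_dual R theta) :
  exists c : 'I_n -> R, forall g : PSL (scalars R b) n,
    phi (kappa_theta theta g) = \sum_(i in theta) c i * fund_weight i (kappa g).
Proof.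
have [e [eth ed eV]] := fund_weight_dual R theta.
exists (fun i => phi (vsproj (cartan_theta R theta) (e i))) => g.
have dual (v : subvs_of (cartan_theta R theta)) : phi v =
    \sum_(i in theta) phi (vsproj (cartan_theta R theta) (e i)) * fund_weight i (vsval v).
  have vE : v = \sum_(i in theta) fund_weight i (vsval v) *: vsproj (cartan_theta R theta) (e i).
    apply: val_inj => /=; rewrite {1}(eV (vsval v)) ?subvsP // linear_sum.
    by apply: eq_bigr => i ith; rewrite linearZ /= vsprojK ?eth.
  rewrite {1}vE linear_sum; apply: eq_bigr => i _.
  by rewrite linearZ /= mulrC.
suff wP : forall i, i \in theta ->
    fund_weight i (vsval (kappa_theta theta g)) = fund_weight i (kappa g).
  by rewrite dual; apply: eq_bigr => i ith; rewrite wP.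
rewrite /kappa_theta; case: xgetP => // no.
pose v := \sum_(i in theta) fund_weight i (kappa g) *: e i.
have vth : v \in cartan_theta R theta.
  by apply: memv_suml => i ith; apply: memvZ; exact: eth.
exfalso; apply: (no (vsproj (cartan_theta R theta) v)) => j jth.
rewrite vsprojK // /v linear_sum (bigD1 j) //= linearZ /= ed // eqxx big1 => [|i /andP[_ ij]].
  by rewrite addr0; exact: mulr1.
by rewrite linearZ /= ed // eq_sym (negbTE ij); exact: mulr0.
Qed.

Section SVDofPSL.
Variables (R : realType) (b : base_field) (n : nat).
Local Notation K := (scalars R b).
Local Notation conj := (@conj_scalar R b).
Local Notation ofR := (@of_real R b).
Local Notation adj A := (map_mx conj A^T).
Local Notation top i s := (s 0 (widen_ord (leqnSn n) i)).
Local Notation next i s := (s 0 (lift ord0 i)).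
Implicit Types (g : PSL K n).

Definition lift_mx g : 'M[K]_n.+1 := val (repr g).

Lemma det_lift_mx g : \det (lift_mx g) = 1.
Proof. exact/eqP/(valP (repr g)). Qed.

Lemma lift_mx_unit g : lift_mx g \in unitmx.
Proof. by rewrite unitmxE det_lift_mx unitr1. Qed.

Lemma svd_pos (A k l : 'M[K]_n.+1) s : is_svd A k s l -> A \in unitmx -> forall j, 0 < s 0 j.
Proof.
case=> _ _ s0 _ AE uA j; rewrite lt_neqAle s0 andbT eq_sym; apply/eqP => sj.
move: uA; rewrite AE unitmxE !det_mulmx det_diag (bigD1 j) //= mxE sj rmorph0.
by rewrite mul0r mulr0 mul0r unitr0.
Qed.

(** If the choice in [singular_values] failed, its default 0 would make all simple roots vanish. *)
Lemma svd_of_gap g i : 0 < simple_root i (kappa g) ->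
  exists k l, is_svd (lift_mx g) k (singular_values (lift_mx g)) l.
Proof.
rewrite /kappa -/(lift_mx g) /singular_values; case: xgetP => // _.
by rewrite /simple_root !mxE subrr ltxx.
Qed.

Lemma fund_weight_kappa g k l i : is_svd (lift_mx g) k (singular_values (lift_mx g)) l ->
  fund_weight i (kappa g) = ln (vol i (singular_values (lift_mx g))).
Proof.
move=> svd; have s0 := svd_pos svd (lift_mx_unit g).
rewrite /fund_weight (big_ord_narrow_leq (ltnW (ltn_ord i))) /vol.
have -> : \prod_(l0 < i.+1) singular_values (lift_mx g) 0 (inc l0) =
   \prod_(l0 < i.+1) expR (kappa g 0 (inc l0)).
  by apply: eq_bigr => j _; rewrite mxE lnK // posrE; exact: s0.
by rewrite -expR_sum expRK; apply: eq_bigr => j _; congr (kappa g 0 _); exact: val_inj.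
Qed.

Lemma expR_simple_root g k l i : is_svd (lift_mx g) k (singular_values (lift_mx g)) l ->
  let s := singular_values (lift_mx g) in next i s = expR (- simple_root i (kappa g)) * top i s.
Proof.
move=> svd s; have s0 := svd_pos svd (lift_mx_unit g).
rewrite /simple_root opprB expRD expRN !mxE -/(lift_mx g) -/s !lnK ?posrE ?s0 //.
by rewrite mulfVK // gt_eqF.
Qed.

Lemma expR_kappa g k l : is_svd (lift_mx g) k (singular_values (lift_mx g)) l ->
  map_mx expR (kappa g) = singular_values (lift_mx g).
Proof.
move=> svd; apply/matrixP => p j; rewrite !mxE ord1 lnK // posrE.
exact: svd_pos svd (lift_mx_unit g) j.
Qed.

Lemma rnorm_root1 (c : K) m : (0 < m)%N -> c ^+ m = 1 -> rnorm c = 1.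
Proof.
move=> m0 cm; apply/eqP; rewrite -(eqrXn2 (n := m)) ?rnorm_ge0 //.
by rewrite -rnormX cm expr1n rnorm1.
Qed.

Lemma lift_mxM g h : exists2 c : K, rnorm c = 1 &
  lift_mx (g * h)%g = c *: (lift_mx g *m lift_mx h).
Proof.
have : (\pi_(PSL K n) (repr (g * h)%g))%qT = (\pi_(PSL K n) (repr g * repr h)%g)%qT.
  by rewrite reprK.
move=> /PSL_piP[c cE]; exists c => //; apply: (@rnorm_root1 c n.+1) => //.
have := det_lift_mx (g * h)%g; rewrite /lift_mx cE detZ det_mulmx.
by rewrite -!/(lift_mx _) !det_lift_mx !mulr1.
Qed.

Lemma lift_mxV g : exists2 c : K, rnorm c = 1 & lift_mx g *m lift_mx g^-1%g = c%:M.
Proof.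
have [c c1 cE] := lift_mxM g g^-1%g; move: cE; rewrite mulgV.
have : (\pi_(PSL K n) (repr (1%g : PSL K n)))%qT = (\pi_(PSL K n) (1%g : SL K n))%qT.
  by rewrite reprK.
move=> /PSL_piP[e eE] cE; have c0 : c != 0 by rewrite -rnorm_eq0 c1 oner_eq0.
have lE : lift_mx 1%g = e%:M by rewrite /lift_mx eE /= scalemx1.
exists (c^-1 * e).
  rewrite rnormM rnormV c1 invr1 mul1r; apply: (@rnorm_root1 e n.+1) => //.
  by have := det_lift_mx 1%g; rewrite lE det_scalar.
by rewrite -[LHS](scale1r) -(mulVf c0) -scalerA -cE lE scale_scalar_mx.
Qed.

Lemma rnorm_det_unitary (Y : 'M[K]_n.+1) : unitary Y -> rnorm (\det Y) = 1.
Proof.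
move=> uY; apply/eqP; rewrite -(eqrXn2 (n := 2)) ?rnorm_ge0 // expr1n; apply/eqP.
apply: (@of_real_inj R b); rewrite -mulr_conj.
have -> : conj (\det Y) = \det (adj Y) by rewrite det_map_mx det_tr.
by rewrite -det_mulmx uY det1 rmorph1.
Qed.

(* A permutation cannot avoid a block whose numbers of rows and columns add up to  *)
(* more than the size of the matrix.                                               *)
Lemma unitary_block_ge (Y : 'M[K]_n.+1) (i : 'I_n) (m : R) : unitary Y ->
  (forall p q : 'I_n.+1, (i < p)%N -> (rev_ord i <= q)%N -> rnorm (Y p q) <= m) ->
  1 <= n.+1`!%:R * m.
Proof.
move=> uY Ym.
rewrite -[leLHS](rnorm_det_unitary uY) mulr_natl -card_Sn -sumr_const; apply: rnorm_det_le => s.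
have [p /andP[ip rq]] : exists p : 'I_n.+1, (i < p)%N && (rev_ord i <= s p)%N.
  apply: contrapT => /forallNP no.
  pose P := [set p : 'I_n.+1 | (i < p)%N]%SET; pose Q := [set q : 'I_n.+1 | (q < rev_ord i)%N]%SET.
  have sub : [set s p | p in P]%SET \subset Q.
    apply/fintype.subsetP => q /imsetP[p]; rewrite !inE => ip ->; rewrite ltnNge; apply/negP => rq.
    by apply: (no p); rewrite ip rq.
  have := subset_leq_card sub; rewrite card_imset; last exact: perm_inj.
  have cP : #|P| = (n - i)%N.
    have -> : P = ~: [set p : 'I_n.+1 | (p <= i)%N]%SET.
      by apply/setP => p; rewrite !inE ltnNge.
    rewrite cardsCs finset.setCK card_ord cardsE -sum1_card.
    rewrite (big_ord_narrow_leq (ltnW (ltn_ord i))) sum1_card card_ord; have := ltn_ord i; lia.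
  have cQ : #|Q| = (n - i.+1)%N.
    rewrite cardsE -sum1_card (big_ord_narrow (leq_trans (ltnW (ltn_ord (rev_ord i))) (leqnSn n))).
    by rewrite sum1_card card_ord.
  by rewrite cP cQ; have := ltn_ord i; lia.
rewrite (bigD1 p) //= -[leRHS]mulr1; apply: ler_pM; rewrite ?rnorm_ge0 ?prodr_ge0 //.
- by move=> *; exact: rnorm_ge0.
- exact: Ym.
by apply: prodr_ile1 => q; rewrite rnorm_ge0 unitary_entry.
Qed.

(* As g g^-1 is scalar, diag(s) (l k') diag(s') is unitary up to a phase, so l k' cannot   *)
(* be large in its upper left block: k' nearly spans the repelling flag of g.              *)
Lemma opposite_block g (k l k' l' : 'M[K]_n.+1) s s' (i : 'I_n) (p q : 'I_n.+1) :
  is_svd (lift_mx g) k s l -> is_svd (lift_mx g^-1%g) k' s' l' ->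
  (p <= i)%N -> (q <= rev_ord i)%N ->
  rnorm ((l *m k') p q) * top i s <= n.+1`!%:R * next i s.
Proof.
move=> svd svd' pi qi.
have s0 := svd_pos svd (lift_mx_unit g); have s0' := svd_pos svd' (lift_mx_unit _).
have [uk ul _ sm gE] := svd; have [uk' ul' _ sm' gE'] := svd'.
have [c c1 cE] := lift_mxV g.
pose X := l *m k'; pose Y := c *: (adj k *m adj l').
have uY : unitary Y.
  have := unitary_mul (unitary_adj uk) (unitary_adj ul'); rewrite /unitary /Y => H.
  have -> : adj (c *: (adj k *m adj l')) = conj c *: adj (adj k *m adj l').
    by apply/matrixP => u v; rewrite !mxE rmorphM.
  by rewrite -scalemxAl -scalemxAr scalerA H mulr_conj c1 expr1n rmorph1 scale1r.
have YE : diag_mx (map_mx ofR s) *m X *m diag_mx (map_mx ofR s') = Y.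
  have : adj k *m (lift_mx g *m lift_mx g^-1%g) *m adj l' = Y.
    by rewrite cE scalar_mxC mul_scalar_mx -scalemxAl.
  rewrite gE gE' -!mulmxA ul' mulmx1 !mulmxA unitary_adjl // mul1mx => <-.
  by [].
have YpqE u v : rnorm (Y u v) = s 0 u * rnorm (X u v) * s' 0 v.
  rewrite -YE mul_mx_diag mxE mul_diag_mx !mxE !rnormM !rnorm_of_real.
  by rewrite !ger0_norm ?(ltW (s0 _)) ?(ltW (s0' _)).
have uX : unitary X by exact: unitary_mul.
pose r := widen_ord (leqnSn n) (rev_ord i).
have B1 : 1 <= n.+1`!%:R * (next i s * s' 0 r).
  apply: (unitary_block_ge (i := i) uY) => u v iu rv; rewrite YpqE.
  apply: (@le_trans _ _ (next i s * 1 * s' 0 r)); last by rewrite mulr1.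
  apply: ler_pM; rewrite ?mulr_ge0 ?rnorm_ge0 ?(ltW (s0 _)) ?(ltW (s0' _)) //.
    apply: ler_pM; rewrite ?rnorm_ge0 ?(ltW (s0 _)) ?unitary_entry //.
    by apply: sm; rewrite lift0.
  exact: sm'.
have B2 : top i s * rnorm (X p q) * s' 0 r <= 1.
  apply: le_trans (unitary_entry p q uY); rewrite YpqE.
  apply: ler_pM; rewrite ?mulr_ge0 ?rnorm_ge0 ?(ltW (s0 _)) ?(ltW (s0' _)) //.
    by apply: ler_wpM2r; rewrite ?rnorm_ge0 ?sm.
  exact: sm'.
have := le_trans B2 B1; rewrite mulrA ler_pM2r; last exact: s0'.
by rewrite mulrC.
Qed.

End SVDofPSL.

(** * Transverse groups *)

Section SubgroupType.
Variables (G : groupType) (P : {pred G}) (clP : group_closed P).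

(* clP occurs in the type so that the group structure can be inferred from it. *)
Definition subgroup : Type := let _ := clP in {g : G | g \in P}.
HB.instance Definition _ := Choice.on subgroup.
Implicit Types x y z : subgroup.

Fact subgroup_mul_subproof x y : (sval x * sval y)%g \in P.
Proof. exact: group_closedM clP _ _ (svalP x) (svalP y). Qed.
Fact subgroup_inv_subproof x : (sval x)^-1%g \in P.
Proof. exact: group_closedV clP _ (svalP x). Qed.

Definition subgroup_mul x y : subgroup := exist (fun g => g \in P) _ (subgroup_mul_subproof x y).
Definition subgroup_inv x : subgroup := exist (fun g => g \in P) _ (subgroup_inv_subproof x).
Definition subgroup_one : subgroup := exist (fun g => g \in P) _ clP.1.

Fact subgroup_mulA : associative subgroup_mul.
Proof. by move=> x y z; apply: val_inj; exact: mulgA. Qed.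
Fact subgroup_mul1g : left_id subgroup_one subgroup_mul.
Proof. by move=> x; apply: val_inj; exact: mul1g. Qed.
Fact subgroup_mulg1 : right_id subgroup_one subgroup_mul.
Proof. by move=> x; apply: val_inj; exact: mulg1. Qed.
Fact subgroup_mulVg : left_inverse subgroup_one subgroup_inv subgroup_mul.
Proof. by move=> x; apply: val_inj; exact: mulVg. Qed.
Fact subgroup_mulgV : right_inverse subgroup_one subgroup_inv subgroup_mul.
Proof. by move=> x; apply: val_inj; exact: mulgV. Qed.

HB.instance Definition _ := isGroup.Build subgroup subgroup_mulA subgroup_mul1g
  subgroup_mulg1 subgroup_mulVg subgroup_mulgV.

End SubgroupType.

(** Each term is chosen to avoid all keys used before. Several sequences read off the terms become
    injective at once. *)
Lemma fresh_sequence (X : Type) (T : eqType) (keys : X -> seq T) (Q : nat -> X -> Prop) :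
  (forall m (s : seq T), exists x, (forall k, k \in keys x -> k \notin s) /\ Q m x) ->
  exists u : nat -> X, (forall m, Q m (u m)) /\
    forall p q, (p < q)%N -> forall k, k \in keys (u p) -> k \notin keys (u q).
Proof.
move=> H; have /choice[c Hc] : forall z : nat * seq T,
    exists x, (forall k, k \in keys x -> k \notin z.2) /\ Q z.1 x.
  by move=> [m s]; exact: H.
pose st := fix st m := if m is m'.+1 then keys (c (m', st m')) ++ st m' else [::].
exists (fun m => c (m, st m)); split=> [m|p q pq k kp]; first by have [] := Hc (m, st m).
have sub r : (p < r)%N -> k \in st r.
  elim: r => // r IH; rewrite ltnS leq_eqVlt /= mem_cat => /predU1P[<-|/IH->].
    by rewrite kp.
  by rewrite orbT.
have [Hq _] := Hc (q, st q).
by apply/negP => /Hq /=; rewrite sub.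
Qed.

Lemma eventually_notin (T : eqType) (u : nat -> T) (s : seq T) : injective u ->
  \forall m \near \oo, u m \notin s.
Proof.
move=> ui; elim: s => [|k s IH]; first by apply: nearW.
have Hk : \forall m \near \oo, u m != k.
  have [[p pk]|no] := pselect (exists p, u p = k); last first.
    by apply: nearW => m; apply/eqP => uk; apply: no; exists m.
  exists p.+1 => // m /= pm; apply/eqP; rewrite -pk => /ui mp.
  by move: pm; rewrite mp ltnn.
by apply: filterS2 Hk IH => m mk ms; rewrite inE negb_or mk ms.
Qed.

Lemma bounded_off_finite (R : realType) (T : eqType) (f : T -> R) (K : seq T) (C : R) :
  (forall x, x \notin K -> `|f x| <= C) -> exists C', forall x, `|f x| <= C'.
Proof.
move=> H; exists (`|C| + \sum_(k <- K) `|f k|) => x.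
have S0 : 0 <= \sum_(k <- K) `|f k| by exact: sumr_ge0.
have [xK|/H xK] := boolP (x \in K); last first.
  by apply: le_trans xK _; apply: le_trans (ler_norm C) _; rewrite lerDl.
apply: (@le_trans _ _ (\sum_(k <- K) `|f k|)); last by rewrite lerDr.
elim: K xK {H S0} => // k K IH; rewrite inE big_cons => /predU1P[->|/IH H].
  by rewrite lerDl sumr_ge0.
by rewrite (le_trans H) // lerDr.
Qed.

Section Perturbation.
Variables (R : realType) (G : groupType) (d : G -> G -> R).

Lemma quasi_additive_perturb (f g : G -> R) (C : R) : (forall x, `|f x - g x| <= C) ->
  quasi_additive d f -> quasi_additive d g.
Proof.
move=> fg qf eta eta0; have [D HD] := qf _ eta0; exists (D + 3 * C) => p q /HD.
have := fg (p * q)%g; have := fg p; have := fg q; rewrite !ler_norml.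
move=> /andP[? ?] /andP[? ?] /andP[? ?] /andP[? ?]; apply/andP; split; lra.
Qed.

Lemma left_quasi_invariant_perturb (f g : G -> R) (C : R) : (forall x, `|f x - g x| <= C) ->
  left_quasi_invariant f -> left_quasi_invariant g.
Proof.
move=> fg qf h; have [D HD] := qf h; exists (D + 2 * C) => x.
have := fg (h * x)%g; have := fg x; have := HD x; rewrite !ler_norml.
move=> /andP[? ?] /andP[? ?] /andP[? ?]; apply/andP; split; lra.
Qed.

Lemma quasi_additive_sum (I : Type) (r : seq I) (P : pred I) (c : I -> R) (f : I -> G -> R) :
  (forall i, P i -> quasi_additive d (f i)) ->
  quasi_additive d (fun x => \sum_(i <- r | P i) c i * f i x).
Proof.
move=> H; elim: r => [|i r IH].
  move=> eta eta0; exists 0 => p q _; rewrite !big_nil !subr0 normr0; exact: lexx.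
have [Pi|nPi] := boolP (P i).
  have := quasi_additive_lin (c i) 1 (H i Pi) IH.
  by under eq_fun do rewrite mul1r; under [X in _ -> quasi_additive d X]eq_fun do rewrite big_cons Pi.
by under eq_fun do rewrite big_cons (negbTE nPi).
Qed.

Lemma left_quasi_invariant_sum (I : Type) (r : seq I) (P : pred I) (c : I -> R) (f : I -> G -> R) :
  (forall i, P i -> left_quasi_invariant (f i)) ->
  left_quasi_invariant (fun x => \sum_(i <- r | P i) c i * f i x).
Proof.
move=> H; elim: r => [|i r IH].
  by move=> h; exists 0 => x; rewrite !big_nil subrr normr0.
have [Pi|nPi] := boolP (P i).
  have := left_quasi_invariant_lin (c i) 1 (H i Pi) IH.
  by under eq_fun do rewrite mul1r; under [X in _ -> left_quasi_invariant X]eq_fun do rewrite big_cons Pi.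
by under eq_fun do rewrite big_cons (negbTE nPi).
Qed.

End Perturbation.

(** * Transversality and degenerate limits in Pluecker coordinates *)

Section PluckerLimits.
Variables (R : realType) (b : base_field) (n : nat) (i : 'I_n).
Local Notation K := (scalars R b).
Local Notation conj := (@conj_scalar R b).
Local Notation adj A := (map_mx conj A^T).
Local Notation inc := (@inc n i).
Local Notation tl := (@tl n i).
Local Notation Ix := {ffun 'I_i.+1 -> 'I_n.+1}.
Implicit Types (A B X Z : 'M[K]_n.+1).

(** The squared modulus of this minor depends on A only through its Pluecker projection, and for B
    itself it is 0 by [minor1_tl]. *)
Lemma plucker_dist_eq0 A B : unitary B -> plucker_dist i A B = 0 ->
  minor (adj B *m A) tl inc = 0.
Proof.
move=> uB AB0.
have projE (f f' : Ix) : plucker_proj A f f' = plucker_proj B f f'.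
  apply/eqP; rewrite -subr_eq0 -rnorm_eq0; apply/eqP/le_anti; rewrite rnorm_ge0 andbT -AB0.
  rewrite /plucker_dist (bigD1 f) //= (bigD1 f') //= -addrA lerDl addr_ge0 //.
    by apply: sumr_ge0 => *; exact: rnorm_ge0.
  by apply: sumr_ge0 => *; apply: sumr_ge0 => *; exact: rnorm_ge0.
have sq (M : 'M[K]_n.+1) : (i.+1`!%:R * minor (adj B *m M) tl inc) *
    conj (i.+1`!%:R * minor (adj B *m M) tl inc) =
    \sum_(h : Ix) \sum_(h' : Ix) minor (adj B) tl h * conj (minor (adj B) tl h') * plucker_proj M h h'.
  rewrite minorM rmorph_sum big_distrlr /=; apply: eq_bigr => h _; apply: eq_bigr => h' _.
  by rewrite rmorphM /plucker_proj; ring.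
have : i.+1`!%:R * minor (adj B *m A) tl inc * conj (i.+1`!%:R * minor (adj B *m A) tl inc) = 0.
  rewrite sq (eq_bigr (fun h : Ix => \sum_(h' : Ix)
    minor (adj B) tl h * conj (minor (adj B) tl h') * plucker_proj B h h')); last first.
    by move=> h _; apply: eq_bigr => h' _; rewrite projE.
  by rewrite -sq unitary_adjl // minor1_tl mulr0 mul0r.
rewrite mulr_conj -(rmorph0 (@of_real R b)) => /of_real_inj/eqP.
have f0 : (i.+1`!%:R : K) != 0 by rewrite pnatr_eq0 -lt0n fact_gt0.
by rewrite expf_eq0 /= rnorm_eq0 mulf_eq0 (negbTE f0) => /eqP ->; rewrite rmorph0.
Qed.

Lemma plucker_dist_adapted (theta : {set 'I_n}) (F : flag K theta) A B : i \in theta ->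
  unitary A -> unitary B -> adapted A F -> adapted B F -> plucker_dist i A B = 0.
Proof.
move=> ith uA uB AF BF; have [C C0 HC] := plucker_dist_wedge R b i.
have [t _ tE] := adapted_minor ith (unitary_unit uA) (unitary_unit uB) AF BF.
apply/le_anti/andP; split; last first.
  by apply: sumr_ge0 => *; apply: sumr_ge0 => *; exact: rnorm_ge0.
rewrite -(mulr0 C); apply: HC => // f f'; rewrite /wedge.
have bE (h : Ix) : minor B h inc = t * minor A h inc by rewrite -[B]mul1mx tE mul1mx.
rewrite !bE (_ : _ - _ = 0) ?rnorm0 //; ring.
Qed.

Lemma cvg_plucker_dist (T : Type) (F : set_system T) {FF : Filter F}
    (u v : T -> 'M[K]_n.+1) A B :
  (forall p q, u x p q @[x --> F] --> A p q) -> (forall p q, v x p q @[x --> F] --> B p q) ->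
  plucker_dist i (u x) (v x) @[x --> F] --> plucker_dist i A B.
Proof.
move=> uA vB; rewrite /plucker_dist.
apply: cvg_big => [|f _]; first exact: add_continuous.
apply: cvg_big => [|f' _]; first exact: add_continuous.
apply: cvg_rnorm; apply: cvgB; apply: cvgM; [|apply: cvg_conj| |apply: cvg_conj];
  exact: cvg_minor.
Qed.

Lemma sum_tl (F : 'I_n.+1 -> K) : (forall j : 'I_n.+1, (j <= rev_ord i)%N -> F j = 0) ->
  \sum_j F j = \sum_l F (tl l).
Proof.
move=> F0; rewrite (reindex_inj rev_ord_inj) /=.
rewrite (bigID (fun j : 'I_n.+1 => (j <= i)%N)) /= [X in _ + X]big1 ?addr0; last first.
  by move=> j; rewrite -ltnNge => ij; apply: F0; rewrite /= subSS leq_sub2l.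
rewrite (big_ord_narrow_leq (ltnW (ltn_ord i))); apply: eq_bigr => l _.
by congr (F (rev_ord _)); exact: val_inj.
Qed.

(** The first i.+1 rows of X only see the last i.+1 coordinates, so the corner minor of X Z is the
    minor of Z times the determinant of a block of X, which is nonzero as X is unitary. *)
Lemma opposite_block_minor X Z : unitary X ->
  (forall p q : 'I_n.+1, (p <= i)%N -> (q <= rev_ord i)%N -> X p q = 0) ->
  minor (X *m Z) inc inc = 0 -> minor Z tl inc = 0.
Proof.
move=> uX X0; have inci (l : 'I_i.+1) : (inc l <= i)%N by rewrite /= -ltnS.
have E (W : 'M[K]_n.+1) : mxsub inc inc (X *m W) = mxsub inc tl X *m mxsub tl inc W.
  apply/matrixP => p q; rewrite !mxE sum_tl => [|j ji]; last by rewrite X0 // mul0r.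
  by apply: eq_bigr => l _; rewrite !mxE.
rewrite /minor E det_mulmx => /eqP; rewrite mulf_eq0 => /orP[/eqP X12|/eqP //].
have := det_mulmx (mxsub inc tl X) (mxsub tl inc (adj X)).
rewrite -E uX X12 mul0r => /eqP; suff -> : mxsub inc inc (1%:M : 'M[K]_n.+1) = 1%:M.
  by rewrite det1 oner_eq0.
by apply/matrixP => p q; rewrite !mxE (inj_eq (@inc_ord_inj _ _)).
Qed.

End PluckerLimits.

Lemma scalar_cvg0 (R : realType) (b : base_field) (z : nat -> scalars R b) l (C : R) :
  z m @[m --> \oo] --> l -> (forall m, rnorm (z m) <= C / m.+1%:R) -> l = 0.
Proof.
move=> zl zC; apply/eqP; rewrite -rnorm_eq0; apply/eqP/le_anti; rewrite rnorm_ge0 andbT leNgt.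
apply/negP => l0; have l2 : rnorm l / 2 < rnorm l by lra.
have [M _ HM] := cvgr_gt _ (cvg_rnorm zl) _ l2.
pose m := maxn M (Num.bound (C / (rnorm l / 2))).
have := HM m (leq_maxl _ _) => /= H1; have := lt_le_trans H1 (zC m).
rewrite ltr_pdivlMr // mulrC -ltr_pdivlMr; last by lra.
apply/negP; rewrite -leNgt; have [C0|C0] := leP 0 (C / (rnorm l / 2)); last first.
  by apply: le_trans (ltW C0) _.
apply: ltW; apply: lt_le_trans (archi_boundP C0) _; rewrite ler_nat.
by apply: leqW; exact: leq_maxr.
Qed.

Lemma ball_separation (R : realFieldType) (m u p q t w : R) : m <= u -> p < m / 4 -> q < m / 4 ->
  u <= p + t -> t <= w + q -> 20 * (m / 40) <= w.
Proof. by lra. Qed.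

(** * The flag metric of a transverse group *)

Section TransverseGeometry.
Variables (R : realType) (b : base_field) (n : nat) (theta : {set 'I_n}).
Local Notation K := (scalars R b).
Local Notation conj := (@conj_scalar R b).
Local Notation adj A := (map_mx conj A^T).
Local Notation inc i := (@inc n i).
Local Notation tl i := (@tl n i).
Local Notation top i s := (s 0 (widen_ord (leqnSn n) i)).
Local Notation next i s := (s 0 (lift ord0 i)).
Hypothesis theta_sym : symmetric_roots theta.
Variables (Gamma : set (PSL K n)) (clG : group_closed [in Gamma]).
Hypothesis divG : divergent theta Gamma.
Hypothesis transG : forall F G : flag K theta, limit_set Gamma F -> limit_set Gamma G ->
  F != G -> transverse F G.
Variable i0 : 'I_n.
Hypothesis i0th : i0 \in theta.
Local Notation T := (subgroup clG).
Implicit Types (x y g h : T) (i : 'I_n).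

Let gam x : PSL K n := sval x.
Let mx x : 'M[K]_n.+1 := lift_mx (gam x).
Let sv x := singular_values (mx x).

Let gamG x : Gamma (gam x).
Proof. by have := svalP x; rewrite inE. Qed.

Lemma divergent_finite (M : R) : exists s : seq T, forall x, x \notin s ->
  forall i, i \in theta -> M < simple_root i (kappa (gam x)).
Proof.
apply: contrapT => /forallNP no.
have [m s|u [uQ uF]] := @fresh_sequence T T (fun x => [:: x])
    (fun _ x => ~ forall i, i \in theta -> M < simple_root i (kappa (gam x))).
  have /existsNP[x /not_implyP[xs nx]] := no s.
  by exists x; split=> // k; rewrite inE => /eqP ->.
have ui : injective (fun m => gam (u m)).
  move=> p q /val_inj upq; have [pq|qp|//] := ltngtP p q.
    by have := uF _ _ pq (u p); rewrite upq mem_head => /(_ isT).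
  by have := uF _ _ qp (u p); rewrite upq mem_head => /(_ isT).
have := divG ui (fun m => gamG (u m)); move/cvgeyPge => /(_ (M + 1)) [m _ /(_ m (leqnn m)) /=].
apply/negP; rewrite -ltNge; have /existsNP[i /not_implyP[ith /negP]] := uQ m.
rewrite -leNgt => aM.
apply: (@le_lt_trans _ _ (simple_root i (kappa (gam (u m))))%:E).
  exact: bigmin_le_cond.
by rewrite lte_fin; lra.
Qed.

(* Junk value (1, 1) when the choice in kappa fails; divergence leaves finitely many such x. *)
Definition svd_pair x : 'M[K]_n.+1 * 'M[K]_n.+1 :=
  xget (1%:M, 1%:M) [set z | is_svd (mx x) z.1 (sv x) z.2].
Let Kx x := (svd_pair x).1.
Let Lx x := (svd_pair x).2.

Definition gapped x := forall i, i \in theta -> 0 < simple_root i (kappa (gam x)).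

Lemma svd_pairP x : gapped x -> is_svd (mx x) (Kx x) (sv x) (Lx x).
Proof.
move=> gx; rewrite /Kx /Lx /svd_pair; case: xgetP => [z _ //|no].
have [k [l svd]] := svd_of_gap (gx i0 i0th).
by case: (no (k, l)).
Qed.

Lemma sv_gt0 x : gapped x -> forall j, 0 < sv x 0 j.
Proof. by move=> /svd_pairP svd; exact: svd_pos svd (lift_mx_unit _). Qed.

Definition flag_dist x y : R := \sum_(i in theta) plucker_dist i (Kx x) (Kx y).

Lemma flag_distC x y : flag_dist x y = flag_dist y x.
Proof. by apply: eq_bigr => i _; exact: plucker_distC. Qed.

Lemma flag_dist_refl x : flag_dist x x = 0.
Proof. by apply: big1 => i _; exact: plucker_dist_refl. Qed.

Lemma flag_dist_tri x y z : flag_dist x z <= flag_dist x y + flag_dist y z.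
Proof. by rewrite -big_split; apply: ler_sum => i _; exact: plucker_dist_tri. Qed.

Definition gnorm i x : R := ext_norm i (mx x).

Lemma gnorm_gt0 i x : 0 < gnorm i x.
Proof. exact: ext_norm_gt0 (lift_mx_unit _). Qed.

Lemma gnormM i x y : gnorm i (x * y)%g <= gnorm i x * gnorm i y.
Proof.
have [c c1 E] := lift_mxM (gam x) (gam y).
by rewrite /gnorm /mx [gam (x * y)%g]/(gam x * gam y)%g E ext_normZ // ext_normM.
Qed.

Lemma gnorm_mull i h x : gnorm i x <= gnorm i h^-1%g * gnorm i (h * x)%g.
Proof. by rewrite -{1}(mulKg h x) gnormM. Qed.

Lemma gnorm_mulr i x h : gnorm i x <= gnorm i (x * h)%g * gnorm i h^-1%g.
Proof. by rewrite -{1}(mulgK h x) gnormM. Qed.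

Lemma flag_dist_contract : exists2 C : R, 0 < C & forall (c M : R) g h, 0 < c ->
  gapped g -> gapped (g * h)%g ->
  (forall i, i \in theta -> M <= simple_root i (kappa (gam g))) ->
  (forall i, i \in theta -> c * (gnorm i g * gnorm i h) <= gnorm i (g * h)%g) ->
  flag_dist (g * h)%g g <= C * expR (- M) / c.
Proof.
have /choice[C HC] : forall i : 'I_n, exists C : R, 0 < C /\
    forall (g h p : 'M[K]_n.+1) (c : K) A s B A' s' B',
    rnorm c = 1 -> p = c *: (g *m h) -> is_svd g A s B -> is_svd p A' s' B' ->
    (forall j, 0 < s 0 j) -> (forall j, 0 < s' 0 j) -> 0 < ext_norm i p ->
    plucker_dist i A' A * ext_norm i p * top i s <=
      C * (next i s * (ext_norm i g * ext_norm i h)).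
  by move=> i; have [C C0 HC] := plucker_contract R b i; exists C; split=> //; exact: HC.
exists (\sum_(i in theta) C i) => [|c M g h c0 gg ggh gM gc].
  rewrite (bigD1 i0) //=; have [C0 _] := HC i0.
  by rewrite ltr_pwDl // sumr_ge0 // => i _; rewrite ltW //; have [] := HC i.
rewrite /flag_dist -mulrA mulr_suml; apply: ler_sum => i ith.
have [C0 HCi] := HC i; have [k k1 kE] := lift_mxM (gam g) (gam h).
have t0 := sv_gt0 gg (widen_ord (leqnSn n) i).
have N0 := gnorm_gt0 i (g * h)%g.
have := HCi _ _ _ _ _ _ _ _ _ _ k1 kE (svd_pairP gg) (svd_pairP ggh) (sv_gt0 gg) (sv_gt0 ggh) N0.
have [k' [l' svd']] := svd_of_gap (gg i0 i0th).
rewrite /= (expR_simple_root i svd') -/(mx g) -/(sv g) -!/(gnorm i _) => H.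
have e1 : expR (- simple_root i (kappa (gam g))) <= expR (- M).
  by rewrite ler_expR lerN2 gM.
rewrite -(ler_pM2r N0) -(ler_pM2r t0); apply: le_trans H _.
have -> : C i * (expR (- M) / c) * gnorm i (g * h)%g * top i (sv g) =
  C i * (expR (- M) * top i (sv g) * (gnorm i (g * h)%g / c)) by ring.
apply: ler_wpM2l; first exact: ltW.
apply: ler_pM; rewrite ?mulr_ge0 ?expR_ge0 ?(ltW t0) ?(ltW (gnorm_gt0 _ _)) //.
  by apply: ler_wpM2r; [exact: ltW|].
by rewrite ler_pdivlMr // mulrC gc.
Qed.

Lemma mem_limit_set (v : nat -> T) A (F : flag K theta) : injective v -> (forall m, gapped (v m)) ->
  unitary A -> adapted A F -> (forall p q, Kx (v m) p q @[m --> \oo] --> A p q) ->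
  limit_set Gamma F.
Proof.
move=> vi vg uA AF cA.
have uK m : unitary (Kx (v m)) by have [] := svd_pairP (vg m).
have /choice[U HU] : forall m, exists F : flag K theta, adapted (Kx (v m)) F.
  by move=> m; apply: adapted_exists; exact: unitary_unit.
exists (fun m => gam (v m)), U; split.
- by move=> p q /val_inj; exact: vi.
- by move=> m; exact: gamG.
- move=> m; split; first by move=> i ith; exact: vg.
  exists (Kx (v m)), (Lx (v m)); split; last exact: HU.
  have svd := svd_pairP (vg m).
  by rewrite (expR_kappa svd).
- apply: flag_cvg HU AF _; first exact: unitary_unit.
    by move=> m; exact: unitary_unit.
  exact: cvg_mx.
Qed.

Lemma cvg_flag_dist (u v : nat -> T) (A B : 'M[K]_n.+1) :
  (forall p q, Kx (u m) p q @[m --> \oo] --> A p q) ->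
  (forall p q, Kx (v m) p q @[m --> \oo] --> B p q) ->
  flag_dist (u m) (v m) @[m --> \oo] --> \sum_(i in theta) plucker_dist i A B.
Proof.
move=> uA vB; apply: cvg_big => [|i _]; first exact: add_continuous.
exact: cvg_plucker_dist.
Qed.

(* A sequence of counterexamples subconverges; the limits of x_m and h_m^-1 are limit     *)
(* flags that are not transverse, hence equal, although flag_dist x_m h_m^-1 >= eta.       *)
Lemma transverse_gap i : i \in theta -> forall eta : R, 0 < eta ->
  exists2 c : R, 0 < c & forall h x, eta <= flag_dist x h^-1%g ->
    c * (gnorm i h * gnorm i x) <= gnorm i (h * x)%g.
Proof.
move=> ith eta eta0; apply: contrapT => no.
have small (c : R) : 0 < c -> exists h x, eta <= flag_dist x h^-1%g /\
    gnorm i (h * x)%g < c * (gnorm i h * gnorm i x).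
  move=> c0; apply: contrapT => nc; apply: no; exists c => // h x hx.
  by rewrite leNgt; apply/negP => lt; apply: nc; exists h, x.
(* When h or x equals k the inequality holds with constant 1 / cond k, so counterexamples for small
   constants avoid any given finite list. *)
pose cond k := gnorm i k * gnorm i k^-1%g.
have cond0 k : 0 < cond k by rewrite mulr_gt0 ?gnorm_gt0.
have condl h x : gnorm i h * gnorm i x <= cond h * gnorm i (h * x)%g.
  by rewrite /cond -mulrA ler_pM2l ?gnorm_gt0 // gnorm_mull.
have condr h x : gnorm i h * gnorm i x <= cond x * gnorm i (h * x)%g.
  rewrite /cond mulrC -mulrA ler_pM2l ?gnorm_gt0 // [leRHS]mulrC.
  exact: gnorm_mulr.
pose Q (m : nat) (z : (T * T)%type) := [/\ eta <= flag_dist z.2 z.1^-1%g,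
  gnorm i (z.1 * z.2)%g * m.+1%:R <= gnorm i z.1 * gnorm i z.2 &
  forall j, j \in theta -> [/\ m%:R < simple_root j (kappa (gam z.1)),
    m%:R < simple_root j (kappa (gam z.1^-1%g)) & m%:R < simple_root j (kappa (gam z.2))]].
pose keys (z : (T * T)%type) : seq T := [:: z.1; z.1^-1%g; z.2].
have [m s|u [uQ uF]] := @fresh_sequence (T * T)%type T keys Q.
  have [Km HKm] := divergent_finite m%:R.
  pose s1 := s ++ Km; pose s2 := s1 ++ map (fun x => x^-1)%g s1.
  pose S := \sum_(k <- s2) cond k.
  have condS k : k \in s2 -> cond k <= S.
    rewrite /S; elim: (s2) => // y r IH; rewrite inE big_cons => /predU1P[->|/IH H].
      by rewrite lerDl sumr_ge0 // => z _; exact: ltW.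
    by rewrite (le_trans H) // lerDr ltW.
  have S0 : 0 <= S by apply: sumr_ge0 => z _; exact: ltW.
  have m0 : 0 < m.+1%:R :> R by [].
  have mS : 0 < m.+1%:R + S by rewrite ltr_pwDl.
  have [|h [x [hx lt]]] := small (m.+1%:R + S)^-1; first by rewrite invr_gt0.
  have Nhx : 0 < gnorm i (h * x)%g by exact: gnorm_gt0.
  move: lt; rewrite mulrC ltr_pdivlMr // => lt.
  have notin k : gnorm i h * gnorm i x <= cond k * gnorm i (h * x)%g -> k \notin s2.
    move=> le; apply/negP => /condS kS.
    have := lt_le_trans lt le; rewrite mulrC ltr_pM2r // ltNge => /negP; apply.
    by apply: le_trans kS _; rewrite lerDr ltW.
  have hs := notin h (condl h x); have xs := notin x (condr h x).
  have inv_notin k : k \notin s2 -> k^-1%g \notin s1.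
    rewrite mem_cat negb_or => /andP[_]; apply: contra => ks.
    by rewrite -[k]invgK map_f.
  have sub k : k \notin s2 -> k \notin s1 by rewrite mem_cat negb_or => /andP[].
  have sub1 k : k \notin s1 -> (k \notin s) && (k \notin Km) by rewrite mem_cat negb_or.
  have /andP[h1 h2] := sub1 _ (sub _ hs); have /andP[x1 x2] := sub1 _ (sub _ xs).
  have /andP[i1 i2] := sub1 _ (inv_notin _ hs).
  exists (h, x); split=> [k|].
    by rewrite !inE => /or3P[]/eqP ->.
  split=> //=.
    apply: le_trans (ltW lt); rewrite ler_pM2l // lerDl //.
  by move=> j jth; split; [exact: HKm h2 j jth|exact: HKm i2 j jth|exact: HKm x2 j jth].
have distinct (k : (T * T)%type -> T) : (forall z, k z \in keys z) ->
  injective (fun m : nat => k (u m)).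
  move=> kin p q upq; have [pq|qp|//] := ltngtP p q.
    by have := uF _ _ pq (k (u p)) (kin _); rewrite upq kin.
  by have := uF _ _ qp (k (u q)) (kin _); rewrite -upq kin.
have gap1 m : gapped (u m).1.
  by move=> j jth; have [_ _ /(_ j jth)[H _ _]] := uQ m; apply: le_lt_trans H.
have gap1V m : gapped (u m).1^-1%g.
  by move=> j jth; have [_ _ /(_ j jth)[_ H _]] := uQ m; apply: le_lt_trans H.
have gap2 m : gapped (u m).2.
  by move=> j jth; have [_ _ /(_ j jth)[_ _ H]] := uQ m; apply: le_lt_trans H.
pose w (m : nat) (j : option bool) : 'M[K]_n.+1 :=
  if j is Some j' then if j' then Kx (u m).1^-1%g else Lx (u m).1 else Kx (u m).2.
have [|f fi [A uA cA]] := @unitary_subseq R b n _ w.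
  by move=> m [[]|]; [have [] := svd_pairP (gap1V m)|have [] := svd_pairP (gap1 m)
    |have [] := svd_pairP (gap2 m)].
have finj : injective f.
  move=> p q fpq; apply/eqP; rewrite eqn_leq.
  by rewrite -(fi p q) -(fi q p) fpq leqnn.
have fge := mono_leq_geq_id fi.
set A0 := A None in cA *; pose A1 := A (Some true); pose A2 := A (Some false).
have c0 p q : Kx (u (f m)).2 p q @[m --> \oo] --> A0 p q by exact: cA None p q.
have c1 p q : Kx (u (f m)).1^-1%g p q @[m --> \oo] --> A1 p q by exact: cA (Some true) p q.
have c2 p q : Lx (u (f m)).1 p q @[m --> \oo] --> A2 p q by exact: cA (Some false) p q.
have [F AF] := adapted_exists theta (unitary_unit (uA None)).
have [G AG] := adapted_exists theta (unitary_unit (uA (Some true))).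
have LF : limit_set Gamma F.
  apply: (@mem_limit_set (fun m => (u (f m)).2) A0) => //; last exact: uA.
  apply: (inj_comp (f := fun m => (u m).2)) finj.
  by apply: (distinct (fun z => z.2)) => z; rewrite !inE; apply/or3P; apply: Or33; exact: eqxx.
have LG : limit_set Gamma G.
  apply: (@mem_limit_set (fun m => (u (f m)).1^-1%g) A1) => //; last exact: uA.
  apply: (inj_comp (f := fun m => (u m).1^-1%g)) finj.
  by apply: (distinct (fun z => z.1^-1%g)) => z; rewrite !inE; apply/or3P; apply: Or32; exact: eqxx.
have [FG|/eqP FG] := pselect (F = G).
  have := cvg_flag_dist c0 c1; rewrite big1 => [cv|j jth]; last first.
    by apply: (plucker_dist_adapted jth (uA None) (uA (Some true)) AF); rewrite FG.
  have [m _ /(_ m (leqnn m)) /=] := cvgr_lt _ cv _ eta0.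
  by have [+ _ _] := uQ (f m); rewrite leNgt => /negP.
have tFG := transG LF LG FG.
have := transverse_minor ith (etrans (esym (theta_sym i)) ith) (unitary_unit (uA None))
  (uA (Some true)) AF AG tFG.
(* By [opposite_block] the limit A2 A1 has a zero upper left block. As A2 A0 = (A2 A1) (adj A1 A0),
   the transversality minor of adj A1 A0 vanishes as soon as the corner minor of A2 A0 does. *)
move/eqP; apply; apply: (@opposite_block_minor R b n i (A2 *m A1)).
- exact: unitary_mul (uA _) (uA _).
- move=> p q pi qi.
  apply: (scalar_cvg0 (cvg_mulmx c2 c1 (i := p) (j := q)) (C := n.+1`!%:R)) => m.
  have svd := svd_pairP (gap1 (f m)).
  have := opposite_block svd (svd_pairP (gap1V (f m))) pi qi.
  have [k' [l' svd']] := svd_of_gap (gap1 (f m) i0 i0th).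
  rewrite (expR_simple_root i svd') mulrA ler_pM2r; last first.
    exact: sv_gt0 (gap1 (f m)) _.
  move=> H; apply: le_trans H _; apply: ler_wpM2l; first by [].
  have [_ _ /(_ i ith)[H1 _ _]] := uQ (f m).
  rewrite expRN lef_pV2 ?posrE ?expR_gt0 //.
  apply: le_trans (expR_ge1Dx _); rewrite -natr1 addrC lerD2l.
  by apply: le_trans (ltW H1); rewrite ler_nat.
rewrite -mulmxA [A1 *m _]mulmxA (uA (Some true)) mul1mx.
have [C C0 HC] := ext_norm_le_vol R b i.
have cm : minor (Lx (u (f m)).1 *m Kx (u (f m)).2) (inc i) (inc i) @[m --> \oo] -->
    minor (A2 *m A0) (inc i) (inc i).
  by apply: cvg_minor; exact: cvg_mulmx.
(* [ext_norm_mul_ge] bounds the corner minor by the norm of h x divided by the two volumes, and the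
   choice of counterexamples makes this at most C^2 / (m + 1). *)
apply: (scalar_cvg0 cm (C := C * C)) => m.
have [_ Nm _] := uQ (f m); set h := (u (f m)).1 in Nm *; set x := (u (f m)).2 in Nm *.
have sh := svd_pairP (gap1 (f m)); have sx := svd_pairP (gap2 (f m)).
have ph := sv_gt0 (gap1 (f m)); have px := sv_gt0 (gap2 (f m)).
have vh := vol_gt0 i ph; have vx := vol_gt0 i px.
have H1 := ext_norm_mul_ge i sh sx ph px.
have [k k1 kE] := lift_mxM (gam h) (gam x).
have NE : gnorm i (h * x)%g = ext_norm i (mx h *m mx x).
  by rewrite /gnorm /mx [gam (h * x)%g]/(gam h * gam x)%g kE ext_normZ.
rewrite -NE in H1.
have Hh := HC _ _ _ _ sh ph; have Hx := HC _ _ _ _ sx px.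
rewrite ler_pdivlMr // -(ler_pM2l (mulr_gt0 vh vx)) mulrA.
apply: (@le_trans _ _ (gnorm i (h * x)%g * m.+1%:R)); first by rewrite ler_pM2r.
apply: (@le_trans _ _ (gnorm i (h * x)%g * (f m).+1%:R)).
  by rewrite ler_pM2l ?gnorm_gt0 // ler_nat ltnS.
apply: le_trans Nm _.
have -> : vol i (sv h) * vol i (sv x) * (C * C) = (C * vol i (sv h)) * (C * vol i (sv x)) by ring.
by apply: ler_pM; rewrite ?ext_norm_ge0.
Qed.

Lemma transverse_gap_unif (eta : R) : 0 < eta -> exists2 c : R, 0 < c &
  forall h x, eta <= flag_dist x h^-1%g -> forall i, i \in theta ->
    c * (gnorm i h * gnorm i x) <= gnorm i (h * x)%g.
Proof.
move=> eta0; have /choice[c Hc] : forall i, exists c : R, 0 < c /\ (i \in theta ->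
    forall h x, eta <= flag_dist x h^-1%g ->
    c * (gnorm i h * gnorm i x) <= gnorm i (h * x)%g).
  move=> i; have [ith|nith] := boolP (i \in theta); last by exists 1.
  by have [c c0 H] := transverse_gap ith eta0; exists c.
exists (\big[Num.min/1]_(i in theta) c i).
  by apply: lt_bigmin => // i _; have [] := Hc i.
move=> h x hx i ith; have [_ /(_ ith h x hx)] := Hc i; apply: le_trans.
apply: ler_wpM2r; first by rewrite mulr_ge0 // ltW // gnorm_gt0.
exact: bigmin_le_cond.
Qed.

Let gapped_finite : exists s : seq T, forall x, x \notin s -> gapped x.
Proof. by have [s Hs] := divergent_finite 0; exists s. Qed.

Let expN_small (C c eta : R) : 0 < C -> 0 < c -> 0 < eta ->
  C * expR (- (2 * C / (c * eta))) / c <= eta / 2.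
Proof.
move=> C0 c0 eta0; set M := 2 * C / (c * eta).
have M0 : 0 < M by rewrite divr_gt0 ?mulr_gt0.
rewrite ler_pdivrMr //; apply: (@le_trans _ _ (C / M)).
  apply: ler_wpM2l; first exact: ltW.
  rewrite expRN lef_pV2 ?posrE ?expR_gt0 //.
  by apply: le_trans (expR_ge1Dx _); lra.
by rewrite le_eqVlt; apply/orP; left; apply/eqP; rewrite /M; field; rewrite !gt_eqF.
Qed.

(** The gap inequality for x away from h^-1 is what [flag_dist_contract] needs, and the contraction
    is strong once the simple roots of h are large. *)
Lemma flag_dist_convergence : convergence_metric flag_dist.
Proof.
move=> eta eta0; have half : eta / 2 < eta by rewrite ltr_pdivrMr // mulr_natr mulr2n ltrDl.
have [c c0 Hc] := transverse_gap_unif eta0.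
have [C C0 HC] := flag_dist_contract; have [Kg HKg] := gapped_finite.
pose cond i k := gnorm i k * gnorm i k^-1%g.
have cond0 i k : 0 <= cond i k by rewrite mulr_ge0 // ltW // gnorm_gt0.
pose S := 1 + \sum_(k <- Kg) \sum_i cond i k.
have S0 : 0 < S.
  by rewrite ltr_pwDl // sumr_ge0 // => k _; rewrite sumr_ge0.
have condS i k : k \in Kg -> cond i k <= S.
  move=> kK; apply: (@le_trans _ _ (\sum_(k <- Kg) \sum_i cond i k)); last by rewrite lerDr.
  elim: (Kg) kK => // k' r IH; rewrite inE big_cons => /predU1P[->|/IH H].
    rewrite (bigD1 i) //= -addrA lerDl addr_ge0 // sumr_ge0 // => *; exact: sumr_ge0.
  by rewrite (le_trans H) // lerDr sumr_ge0.
have iS0 : 0 < S^-1 by rewrite invr_gt0.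
have [K1 HK1] := divergent_finite (2 * C / (c * eta)).
have [K2 HK2] := divergent_finite (2 * C / (S^-1 * eta)).
(* If y = h x lies in the exceptional list Kg, then x = h^-1 y is compared with h^-1 instead: right
   multiplication by y changes norms by at most S, so x would be within eta / 2 of h^-1. Excluding
   the quotients y z^-1 ensures that h^-1 y has a gap. *)
exists (K1 ++ Kg ++ map (fun x => x^-1)%g (K2 ++ Kg) ++ [seq (y * z^-1)%g | y <- Kg, z <- Kg]).
move=> h x; rewrite !mem_cat !negb_or => /and4P[h1 hg hi hyz] hx.
have hi' : h^-1%g \notin K2 ++ Kg.
  by apply: contra hi => H; rewrite -[h]invgK map_f.
move: hi'; rewrite mem_cat negb_or => /andP[hi2 hig].
have [hxK|hxK] := boolP ((h * x)%g \in Kg); last first.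
  apply: le_trans (ltW half); apply: le_trans (expN_small C0 c0 eta0); apply: HC => //.
  - exact: HKg.
  - exact: HKg.
  - by move=> i ith; rewrite ltW // HK1.
  by move=> i ith; exact: Hc.
set y := (h * x)%g in hxK.
have xE : x = (h^-1 * y)%g by rewrite /y mulKg.
suff /le_lt_trans/(_ half) : flag_dist x h^-1%g <= eta / 2 by rewrite ltNge hx.
rewrite xE; apply: le_trans (expN_small C0 iS0 eta0); apply: HC => //.
- exact: HKg.
- apply: HKg; apply: contra hyz => H; apply/allpairsP; exists (y, (h^-1 * y)%g).
  by split=> //=; rewrite invgM invgK mulgA mulgV mul1g.
- by move=> i ith; rewrite ltW // HK2.
move=> i ith; rewrite mulrC ler_pdivrMr //.
have H := gnorm_mulr i h^-1%g y.
apply: (@le_trans _ _ (cond i y * gnorm i (h^-1 * y)%g)).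
  rewrite /cond mulrC -mulrA; apply: ler_wpM2l; first by rewrite ltW // gnorm_gt0.
  by rewrite [leRHS]mulrC.
by rewrite mulrC; apply: ler_wpM2l; rewrite ?condS // ltW // gnorm_gt0.
Qed.

(** The upper bound is submultiplicativity, the lower bound is [transverse_gap_unif]. *)
Lemma ln_gnorm_quasi_additive i : i \in theta ->
  quasi_additive flag_dist (fun x => ln (gnorm i x)).
Proof.
move=> ith eta eta0; have [c c0 Hc] := transverse_gap_unif eta0.
exists (`|ln c|) => p q; rewrite flag_distC => /Hc/(_ i ith) H.
have [[Np Nq] Npq] := (gnorm_gt0 i p, gnorm_gt0 i q, gnorm_gt0 i (p * q)%g).
have U : ln (gnorm i (p * q)%g) <= ln (gnorm i p) + ln (gnorm i q).
  by rewrite -lnM ?posrE // ler_ln ?posrE ?mulr_gt0 // gnormM.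
have L : ln c + (ln (gnorm i p) + ln (gnorm i q)) <= ln (gnorm i (p * q)%g).
  by rewrite -lnM ?posrE // -lnM ?posrE ?mulr_gt0 // ler_ln ?posrE ?mulr_gt0.
have e1 := ler_norm (- ln c); rewrite normrN in e1; have e2 := normr_ge0 (ln c).
by rewrite ler_norml; apply/andP; split; lra.
Qed.

Lemma ln_gnorm_left_quasi_invariant i : left_quasi_invariant (fun x => ln (gnorm i x)).
Proof.
move=> h; exists (`|ln (gnorm i h)| + `|ln (gnorm i h^-1%g)|) => x.
have [[Nh Nx] Nhx] := (gnorm_gt0 i h, gnorm_gt0 i x, gnorm_gt0 i (h * x)%g).
have Nh' := gnorm_gt0 i h^-1%g.
have U : ln (gnorm i (h * x)%g) <= ln (gnorm i h) + ln (gnorm i x).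
  by rewrite -lnM ?posrE // ler_ln ?posrE ?mulr_gt0 // gnormM.
have L : ln (gnorm i x) <= ln (gnorm i h^-1%g) + ln (gnorm i (h * x)%g).
  by rewrite -lnM ?posrE // ler_ln ?posrE ?mulr_gt0 // gnorm_mull.
have e1 := ler_norm (ln (gnorm i h)); have e2 := ler_norm (ln (gnorm i h^-1%g)).
have e3 := normr_ge0 (ln (gnorm i h)); have e4 := normr_ge0 (ln (gnorm i h^-1%g)).
by rewrite ler_norml; apply/andP; split; lra.
Qed.

Lemma fund_weight_ln_gnorm i : exists C : R, forall x,
  `|ln (gnorm i x) - fund_weight i (kappa (gam x))| <= C.
Proof.
have [Kg HKg] := gapped_finite; have [C C0 HC] := ext_norm_le_vol R b i.
apply: (@bounded_off_finite R T _ Kg `|ln C|) => x /HKg gx.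
have svd := svd_pairP gx; have v0 := vol_gt0 i (sv_gt0 gx).
rewrite (fund_weight_kappa i svd) -/(mx x) -/(sv x).
have Nx := gnorm_gt0 i x.
have U : ln (gnorm i x) <= ln C + ln (vol i (sv x)).
  by rewrite -lnM ?posrE // ler_ln ?posrE ?mulr_gt0 //; exact: HC svd (sv_gt0 gx).
have L : ln (vol i (sv x)) <= ln (gnorm i x).
  by rewrite ler_ln ?posrE //; apply: vol_le_ext_norm svd (sv_gt0 gx).
have e1 := ler_norm (ln C); have e2 := normr_ge0 (ln C).
by rewrite ler_norml; apply/andP; split; lra.
Qed.

Lemma weight_perturb (phi : cartan_dual R theta) : exists c : 'I_n -> R, exists C : R,
  forall x, `|\sum_(i in theta) c i * ln (gnorm i x) - phi (kappa_theta theta (gam x))| <= C.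
Proof.
have [c Hc] := dual_cartan_theta b phi.
have /choice[C HC] := fund_weight_ln_gnorm.
exists c, (\sum_(i in theta) `|c i| * C i) => x; rewrite Hc -sumrB.
apply: le_trans (ler_norm_sum _ _ _) _; apply: ler_sum => i _.
by rewrite -mulrBr normrM ler_wpM2l.
Qed.

Lemma weight_quasi_additive (phi : cartan_dual R theta) :
  quasi_additive flag_dist (fun x => phi (kappa_theta theta (gam x))).
Proof.
have [c [C HC]] := weight_perturb phi; apply: quasi_additive_perturb HC _.
by apply: quasi_additive_sum => i; exact: ln_gnorm_quasi_additive.
Qed.

Lemma weight_left_quasi_invariant (phi : cartan_dual R theta) :
  left_quasi_invariant (fun x => phi (kappa_theta theta (gam x))).
Proof.
have [c [C HC]] := weight_perturb phi; apply: left_quasi_invariant_perturb HC _.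
by apply: left_quasi_invariant_sum => i _; exact: ln_gnorm_left_quasi_invariant.
Qed.

(** A subsequence of the decompositions defining F converges to some A, and the flag adapted to A
    must be F, since otherwise it would be transverse to F, against [limit_flag_unique]. *)
Lemma limit_flag_approx (F : flag K theta) : limit_set Gamma F ->
  exists A : 'M[K]_n.+1, [/\ unitary A, adapted A F & exists2 u : nat -> T, injective u &
    forall eta : R, 0 < eta ->
      \forall m \near \oo, \sum_(i in theta) plucker_dist i (Kx (u m)) A < eta].
Proof.
move=> [gamma [U [gi gG gU cU]]].
have gP m : gamma m \in [in Gamma] by rewrite inE; exact: gG.
pose v m : T := exist (fun y : PSL K n => y \in [in Gamma]) (gamma m) (gP m).
have vi : injective v by move=> p q /(congr1 gam); exact: gi.
have vg m : gapped (v m) by have [] := gU m.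
have /choice[kl Hkl] : forall m, exists z : 'M[K]_n.+1 * 'M[K]_n.+1,
    is_svd (mx (v m)) z.1 (sv (v m)) z.2 /\ adapted z.1 (U m).
  move=> m; have [_ [k [l [svd AF]]]] := gU m; exists (k, l); split=> //.
  by move: svd; rewrite (expR_kappa (svd_pairP (vg m))).
have uk m : unitary (kl m).1 by have [[]] := Hkl m.
have [//|f fi [A uA cA]] := @unitary_subseq R b n unit (fun m _ => (kl m).1).
have finj : injective f.
  by move=> p q fpq; apply/eqP; rewrite eqn_leq -(fi p q) -(fi q p) fpq leqnn.
have [G AG] := adapted_exists theta (unitary_unit (uA tt)).
have kU m : adapted (kl (f m)).1 (U (f m)) by have [] := Hkl (f m).
have LG : limit_set Gamma G.
  exists (fun m => gamma (f m)), (fun m => U (f m)); split=> [p q /gi/finj //|m|m|].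
  - exact: gG.
  - exact: gU.
  apply: flag_cvg kU AG _; first exact: unitary_unit.
    by move=> m; exact: unitary_unit.
  by apply: cvg_mx => p q; exact: cA.
have FG : F = G.
  apply/eqP; apply: contrapT => /negP FG.
  have LF : limit_set Gamma F by exists gamma, U.
  have tFG := transG LF LG FG.
  have rith : rev_ord i0 \in theta by rewrite -theta_sym.
  have cUf : U (f m) @[m --> \oo] --> F by exact: cvg_comp (mono_leq_cvg_oo fi) cU.
  exact: (limit_flag_unique i0th rith (uA tt) (fun m => uk (f m)) kU AG (cA tt) cUf tFG).
exists (A tt); rewrite FG; split=> //; exists (fun m => v (f m)) => [p q /vi/finj //|eta eta0].
(* The limit set refers to arbitrary decompositions, [flag_dist] to the chosen one.
   [plucker_contract] with h = 1 says that their leading flags differ by O(next / top). *)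
have /choice[C HC] : forall i : 'I_n, exists C : R, 0 <= C /\ forall x A s B A' s' B',
    is_svd (mx x) A s B -> is_svd (mx x) A' s' B' ->
    (forall j, 0 < s 0 j) -> (forall j, 0 < s' 0 j) ->
    plucker_dist i A' A * top i s <= C * next i s.
  move=> i; have [C C0 HC] := plucker_contract R b i.
  exists (C * ext_norm i (1%:M : 'M[K]_n.+1)); split=> [|x A1 s B1 A2 s' B2 svd svd' s0 s0'].
    by rewrite mulr_ge0 ?(ltW C0) ?ext_norm_ge0.
  have N0 := gnorm_gt0 i x.
  have := HC (mx x) 1%:M (mx x) 1 _ _ _ _ _ _ (rnorm1 R b) _ svd svd' s0 s0' N0.
  rewrite scale1r mulmx1 => /(_ erefl) H.
  rewrite -(ler_pM2r N0) mulrAC; apply: le_trans H _.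
  by rewrite le_eqVlt; apply/orP; left; apply/eqP; rewrite /gnorm; ring.
pose S := \sum_(i in theta) C i.
have S0 : 0 <= S by apply: sumr_ge0 => i _; have [] := HC i.
have e2 : 0 < eta / 2 by rewrite divr_gt0.
have [Km HKm] := divergent_finite (2 * S / eta).
have ev1 := @eventually_notin T (fun m => v (f m)) Km (inj_comp vi finj).
pose D (B : 'M[K]_n.+1) : R := \sum_(i in theta) plucker_dist i B (A tt).
have cv : D (kl (f m)).1 @[m --> \oo] --> D (A tt).
  apply: cvg_big => [|i _]; first exact: add_continuous.
  by apply: cvg_plucker_dist => p q; [exact: cA|exact: cvg_cst].
rewrite {2}/D big1 in cv => [|i _]; last exact: plucker_dist_refl.
apply: filterS2 ev1 (cvgr_lt _ cv _ e2) => m mK lt.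
apply: (@le_lt_trans _ _ (\sum_(i in theta) plucker_dist i (Kx (v (f m))) (kl (f m)).1 +
    \sum_(i in theta) plucker_dist i (kl (f m)).1 (A tt))).
  by rewrite -big_split; apply: ler_sum => i _; exact: plucker_dist_tri.
rewrite [ltRHS](splitr eta); apply: ler_ltD lt.
(* From e^(-r) <= 1 / (1 + r), for r above the bound 2 S / eta that holds off Km. *)
apply: (@le_trans _ _ (S / (1 + 2 * S / eta))); last first.
  have q0 : 0 < 1 + 2 * S / eta by rewrite ltr_pwDl // divr_ge0 ?mulr_ge0 ?(ltW eta0).
  rewrite ler_pdivrMr // mulrDr mulr1 [X in _ + X](_ : _ = S); last by field; rewrite gt_eqF.
  by rewrite lerDr ltW.
rewrite /S mulr_suml; apply: ler_sum => i ith; have [Ci HCi] := HC i.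
have [svd _] := Hkl (f m); have sp := sv_gt0 (vg (f m)).
have := HCi _ _ _ _ _ _ _ svd (svd_pairP (vg (f m))) sp sp.
rewrite (expR_simple_root i svd) mulrA ler_pM2r ?sp // => H; apply: le_trans H _.
apply: ler_wpM2l; first exact: Ci.
rewrite expRN lef_pV2 ?posrE ?expR_gt0 //; last first.
  by rewrite ltr_pwDl // divr_ge0 ?mulr_ge0 ?(ltW eta0).
apply: le_trans (expR_ge1Dx _); rewrite lerD2l ltW //.
exact: HKm mK i ith.
Qed.

Lemma distinct_limit_flags (F G : flag K theta) (A B : 'M[K]_n.+1) :
  limit_set Gamma F -> limit_set Gamma G -> F <> G -> unitary A -> unitary B ->
  adapted A F -> adapted B G -> 0 < \sum_(i in theta) plucker_dist i A B.
Proof.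
move=> LF LG /eqP FG uA uB AF BG.
have tGF : transverse F G by exact: transG.
have rith : rev_ord i0 \in theta by rewrite -theta_sym.
have := transverse_minor i0th rith (unitary_unit uA) uB AF BG tGF => N0.
rewrite lt_neqAle sumr_ge0 ?andbT => [|i _]; last first.
  by apply: sumr_ge0 => *; apply: sumr_ge0 => *; exact: rnorm_ge0.
rewrite eq_sym; apply: contra N0; rewrite psumr_eq0 => [/allP H|i _]; last first.
  by apply: sumr_ge0 => *; apply: sumr_ge0 => *; exact: rnorm_ge0.
have := H i0; rewrite mem_index_enum i0th => /(_ isT) /= /eqP H0.
by apply/eqP; exact: plucker_dist_eq0.
Qed.

(** Each of three distinct limit flags is approached by infinitely many elements; with m their least
    mutual distance, the balls of radius m / 4 around them are m / 2 apart, as [uniform_escape]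
    requires. *)
Lemma flag_dist_escape (phi : cartan_dual R theta) : infinite_set (limit_set Gamma : set (flag K theta)) ->
  proper_below (fun x => phi (kappa_theta theta (gam x))) ->
  exists2 eta : R, 0 < eta & exists F : seq T,
    forall x q, exists2 h, h \in F & eta <= flag_dist x (h * q)%g.
Proof.
move=> infL prop.
have [F1 L1] := infinite_setN0 infL.
have inf2 : infinite_set ((limit_set Gamma : set (flag K theta)) `\ F1).
  by apply: infinite_setD => //; exact: finite_set1.
have [F2 [L2 /= F21]] := infinite_setN0 inf2.
have inf3 : infinite_set ((limit_set Gamma : set (flag K theta)) `\ F1 `\ F2).
  by apply: infinite_setD => //; exact: finite_set1.
have [F3 [[L3 /= F31] /= F32]] := infinite_setN0 inf3.
have [A1 [uA1 AF1 [u1 u1i cv1]]] := limit_flag_approx L1.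
have [A2 [uA2 AF2 [u2 u2i cv2]]] := limit_flag_approx L2.
have [A3 [uA3 AF3 [u3 u3i cv3]]] := limit_flag_approx L3.
pose D (A B : 'M[K]_n.+1) : R := \sum_(i in theta) plucker_dist i A B.
have DC A B : D A B = D B A by apply: eq_bigr => i _; exact: plucker_distC.
have Dtri A B C : D A C <= D A B + D B C.
  by rewrite -big_split; apply: ler_sum => i _; exact: plucker_dist_tri.
have d12 : 0 < D A1 A2 by apply: distinct_limit_flags AF1 AF2 => // ?; apply: F21.
have d13 : 0 < D A1 A3 by apply: distinct_limit_flags AF1 AF3 => // ?; apply: F31.
have d23 : 0 < D A2 A3 by apply: distinct_limit_flags AF2 AF3 => // ?; apply: F32.
pose m := Num.min (D A1 A2) (Num.min (D A1 A3) (D A2 A3)).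
have m0 : 0 < m by rewrite !lt_min d12 d13 d23.
have m12 : m <= D A1 A2 by rewrite ge_min lexx.
have m13 : m <= D A1 A3 by rewrite !ge_min lexx orbT.
have m23 : m <= D A2 A3 by rewrite !ge_min lexx !orbT.
pose P A x := D (Kx x) A < m / 4.
have m4 : 0 < m / 4 by rewrite divr_gt0.
have infP A (u : nat -> T) : injective u ->
    (forall eta : R, 0 < eta -> \forall m \near \oo, D (Kx (u m)) A < eta) -> infinite_pred (P A).
  move=> ui cv s.
  have [k [/= ks kA]] := filter_ex (filterI (eventually_notin s ui) (cv _ m4)).
  by exists (u k).
have sep A B : m <= D A B -> forall x y, P A x -> P B y -> 20 * (m / 40) <= flag_dist x y.
  move=> mAB x y; rewrite /P => Px Py; rewrite -[flag_dist x y]/(D (Kx x) (Kx y)).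
  have := Dtri A (Kx x) B; rewrite (DC A (Kx x)) => t1.
  exact: ball_separation mAB Px Py t1 (Dtri (Kx x) (Kx y) B).
have e0 : 0 < m / 40 by rewrite divr_gt0.
have [F HF] := uniform_escape flag_distC flag_dist_refl flag_dist_tri flag_dist_convergence
  (weight_quasi_additive phi) (weight_left_quasi_invariant phi) prop e0
  (infP _ _ u1i cv1) (infP _ _ u2i cv2) (infP _ _ u3i cv3)
  (sep _ _ m12) (sep _ _ m13) (sep _ _ m23).
by exists (m / 40 / 2); [rewrite divr_gt0|exists F].
Qed.

End TransverseGeometry.

(** * Critical exponents *)

(** The weight f may be negative, so terms need not decrease in s; but f <= 0 happens only on a
    finite list, whose terms are added separately. *)
Lemma bounded_sums_scale_le (R : realType) (T : eqType) (f : T -> R) (s0 s : R) : 0 < s0 -> s0 <= s ->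
  bounded_sums (fun g => expR (- (s0 * f g))) -> bounded_sums (fun g => expR (- (s * f g))).
Proof.
move=> s00 s0s bs; have [K HK] := sublevel_finite s00 bs 0; have [B HB] := bs.
exists (B + \sum_(g <- undup K) expR (- (s * f g))) => X uX.
apply: (@le_trans _ _ (\sum_(g <- X) (expR (- (s0 * f g)) +
    (if g \in K then expR (- (s * f g)) else 0)))).
  apply: ler_sum => g _; case: ifPn => gK; first by rewrite lerDr expR_ge0.
  rewrite addr0 ler_expR lerN2; apply: ler_wpM2r s0s.
  by rewrite leNgt; apply: contra gK => f0; apply: HK; exact: ltW.
rewrite big_split /= lerD ?HB // -big_mkcond -big_filter; apply: ler_sum_subset.
- by move=> g; exact: expR_ge0.
- exact: filter_uniq.
- exact: undup_uniq.
by move=> g; rewrite mem_filter mem_undup => /andP[].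
Qed.

Lemma esum_subgroup_lty (R : realType) (G : groupType) (P : set G) (clP : group_closed [in P])
    (w : G -> R) : (forall g, 0 <= w g) ->
  (\esum_(g in P) (w g)%:E < +oo)%E <-> bounded_sums (fun x : subgroup clP => w (sval x)).
Proof.
move=> w0; split=> [fin|[B HB]].
  have e0 : (0 <= \esum_(g in P) (w g)%:E)%E by apply: esum_ge0 => g _; rewrite lee_fin.
  exists (fine (\esum_(g in P) (w g)%:E)) => X uX.
  rewrite -lee_fin fineK ?ge0_fin_numE //; apply: esum_ge; exists [set` map sval X].
    split; first by apply/finite_seqP; exists (map sval X).
    by move=> g /= /mapP[x _ ->]; have := svalP x; rewrite inE.
  rewrite -fsbig_seq ?(map_inj_uniq val_inj) // big_map sumEFin.
  exact: lexx.
apply: (@le_lt_trans _ _ B%:E); last exact: ltry.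
apply: ge_ereal_sup => _ [A [/finite_seqP[s ->] sP] <-].
have sub : forall r : seq G, (forall g, g \in r -> P g) -> exists X : seq (subgroup clP), map sval X = r.
  elim=> [|g r IH] rP; first by exists [::].
  have [|X XE] := IH; first by move=> h hr; apply: rP; rewrite inE hr orbT.
  have Pg : g \in [in P] by rewrite inE; apply: rP; exact: mem_head.
  by exists ((exist (fun y : G => y \in [in P]) g Pg : subgroup clP) :: X); rewrite /= XE.
have [|X XE] := sub (undup s); first by move=> g; rewrite mem_undup => gs; exact: sP.
have -> : [set` s] = [set` undup s] by apply/seteqP; split=> g /=; rewrite mem_undup.
rewrite -fsbig_seq ?undup_uniq // -XE big_map sumEFin lee_fin; apply: HB.
by rewrite -(map_inj_uniq val_inj) XE undup_uniq.
Qed.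

(* The limits need not exist: both sequences have the same set of limits. *)
Lemma limn_bounded_difference (R : realType) (f g : nat -> R) (M : R) :
  (forall m, `|f m - g m| <= M) ->
  limn (fun m => m%:R^-1 * f m : R) = limn (fun m => m%:R^-1 * g m : R).
Proof.
move=> fgM; pose u m : R := m%:R^-1 * f m; pose v m : R := m%:R^-1 * g m.
have inv0 : (m%:R : R)^-1 @[m --> \oo] --> (0 : R).
  by apply/(gtr0_cvgV0 _); [exists 1%N => // m /= m1; rewrite ltr0n|exact: cvgr_idn].
have uv0 : u m - v m @[m --> \oo] --> (0 : R).
  have cM : (m%:R^-1 * M : R) @[m --> \oo] --> (0 : R).
    by rewrite -(mul0r M); apply: cvgM inv0 (cvg_cst _).
  apply/norm_cvg0P; apply: (squeeze_cvgr _ (cvg_cst 0) cM).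
  apply: nearW => m; rewrite normr_ge0 /u /v -mulrBr normrM ger0_norm ?invr_ge0 //.
  by rewrite ler_wpM2l ?invr_ge0.
have E (l : R) : (u @ \oo --> l) = (v @ \oo --> l).
  apply/propext; split=> [ul|vl].
    have -> : v = (fun m => u m - (u m - v m)) by apply/funext => m; rewrite subKr.
    by rewrite -(subr0 l); apply: cvgB.
  have -> : u = (fun m => v m + (u m - v m)) by apply/funext => m; rewrite addrC subrK.
  by rewrite -(addr0 l); apply: cvgD.
rewrite -[LHS]/(lim (u @ \oo)) -[RHS]/(lim (v @ \oo)) /lim_in; congr (get _).
by apply/funext => l; exact: E.
Qed.

Section CriticalExponents.
Variables (R : realType) (b : base_field) (n : nat) (theta : {set 'I_n}).
Variables (Gamma : set (PSL (scalars R b) n)) (clG : group_closed [in Gamma]).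
Implicit Types (phi : cartan_dual R theta) (s : R).

Lemma poincare_lty phi s : (poincare Gamma phi s < +oo)%E <->
  bounded_sums (fun x : subgroup clG => expR (- (s * phi (kappa_theta theta (sval x))))).
Proof.
exact: (esum_subgroup_lty clG (w := fun g => expR (- (s * phi (kappa_theta theta g))))
  (fun=> expR_ge0 _)).
Qed.

Lemma bounded_sums_above_critical_exponent phi s : (critical_exponent Gamma phi < s%:E)%E ->
  bounded_sums (fun x : subgroup clG => expR (- (s * phi (kappa_theta theta (sval x))))).
Proof.
move=> /ereal_inf_lt[_ [s0 [s00 /poincare_lty bs] <-]]; rewrite lte_fin => s0s.
exact: bounded_sums_scale_le s00 (ltW s0s) bs.
Qed.

Lemma critical_exponent_le phi s : 0 <= s -> (forall t, s < t ->
    bounded_sums (fun x : subgroup clG => expR (- (t * phi (kappa_theta theta (sval x)))))) ->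
  (critical_exponent Gamma phi <= s%:E)%E.
Proof.
move=> s0 H; apply/lee_addgt0Pr => e e0; apply: ereal_inf_lbound; exists (s + e) => //.
split; first by rewrite ltr_wpDl.
by apply/poincare_lty; apply: H; rewrite ltrDl.
Qed.

End CriticalExponents.

Lemma non_elementary_root (R : realType) (b : base_field) (n : nat) (theta : {set 'I_n})
    (Gamma : set (PSL (scalars R b) n)) : non_elementary theta Gamma -> exists i, i \in theta.
Proof.
move=> inf; apply: contrapT => /forallNP no; apply: inf.
(* Without a root in theta there is at most one flag. *)
have [[F0 _]|none] := pselect (exists F : flag (scalars R b) theta, True); last first.
  by apply: (sub_finite_set _ (finite_set0 _)) => F _; apply: none; exists F.
apply: (sub_finite_set _ (finite_set1 F0)) => F _ /=.
by apply: val_inj; apply/ffunP => -[i ith]; case: (no i).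
Qed.

Theorem theorem1p5 (R : realType) (b : base_field) (n : nat)
    (theta : {set 'I_n}) (theta_sym : symmetric_roots theta)
    (Gamma : set (PSL (scalars R b) n))
    (Gamma_transverse : transverse_group theta Gamma)
    (Gamma_non_elementary : non_elementary theta Gamma)
    (phi1 phi2 : cartan_dual R theta)
    (delta1 : critical_exponent Gamma phi1 = 1%:E)
    (delta2 : critical_exponent Gamma phi2 = 1%:E)
    (lambda : R) (lambda_gt0 : 0 < lambda) (lambda_lt1 : lambda < 1)
    (phi : cartan_dual R theta)
    (phiE : phi = lambda *: phi1 + (1 - lambda) *: phi2) :
  (critical_exponent Gamma phi <= 1%:E)%E /\
  (critical_exponent Gamma phi = 1%:E ->
   poincare Gamma phi (fine (critical_exponent Gamma phi)) = +oo%E ->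
   forall gamma, Gamma gamma -> phi_length phi1 gamma = phi_length phi2 gamma).

Proof.
have [clG divG transG] := Gamma_transverse; have [i0 i0th] := non_elementary_root Gamma_non_elementary.
pose len (psi : cartan_dual R theta) (x : subgroup clG) := psi (kappa_theta theta (sval x)).
have sums psi s : critical_exponent Gamma psi = 1%:E -> 1 < s ->
    bounded_sums (fun x => expR (- (s * len psi x))).
  by move=> psi1 s1; apply: bounded_sums_above_critical_exponent; rewrite psi1 lte_fin.
have phi_len x : len phi x = lambda * len phi1 x + (1 - lambda) * len phi2 x.
  by rewrite /len phiE add_lfunE !scale_lfunE.
split=> [|crit1 div g gG].
  apply: (@critical_exponent_le R b n theta Gamma clG phi 1) => // s s1.
  under [X in bounded_sums X]eq_fun do rewrite -/(len phi _) phi_len.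
  apply: bounded_sums_convex; rewrite ?ltW //; [exact: lt_trans s1|exact: sums|exact: sums].
have prop1 : proper_below (len phi1).
  by apply: (sublevel_finite (s := 2)) => //; apply: sums; rewrite ?ltr1n.
have [eta eta0 [F escape]] :=
  flag_dist_escape theta_sym divG transG i0th Gamma_non_elementary prop1.
(* An unbounded difference would make the series converge at the exponent 1, contrary to the assumed
   divergence. *)
have [[M HM]|unb] := pselect (exists M, forall x, `|len phi1 x - len phi2 x| <= M); last first.
  suff : (poincare Gamma phi 1 < +oo)%E by move: div; rewrite crit1 /= => ->.
  have escape10 x q : exists2 h, h \in F & 10 * (eta / 10) <= flag_dist theta x (h * q)%g.
    by have [h hF H] := escape x q; exists h; rewrite // mulrC divfK.
  have unb' M : exists x, M < `|len phi1 x - len phi2 x|.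
    apply: contrapT => no; apply: unb; exists M => x; rewrite leNgt.
    by apply/negP => lt; apply: no; exists x.
  have eta10 : 0 < eta / 10 by rewrite divr_gt0.
  have bs := bounded_sums_of_unbounded_difference (@flag_distC R b n theta Gamma clG)
    (@flag_dist_tri R b n theta Gamma clG) (flag_dist_convergence theta_sym clG divG transG i0th)
    lambda_gt0 lambda_lt1
    (weight_quasi_additive theta_sym clG divG transG i0th phi1)
    (weight_quasi_additive theta_sym clG divG transG i0th phi2)
    (weight_left_quasi_invariant divG i0th phi1)
    (weight_left_quasi_invariant divG i0th phi2)
    (sums phi1 ^~ delta1) (sums phi2 ^~ delta2) eta10 escape10 unb'.
  apply/(poincare_lty clG); congr bounded_sums: bs.
  by apply/funext => x; rewrite mul1r -/(len phi x) phi_len.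
(* The bound M holds at every power of gamma, since these stay in Gamma, and disappears after
   division by m. *)
apply: (limn_bounded_difference (M := M)) => m.
have gP : g \in [in Gamma] by rewrite inE.
pose x : subgroup clG := exist (fun y : PSL (scalars R b) n => y \in [in Gamma]) g gP.
suff <- : sval (x ^+ m)%g = (g ^+ m)%g by exact: HM.
by elim: m => // m IH; rewrite !expgS -IH.
Qed.
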